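(* Let $(X,J;\Omega_R,\mathcal{H}_R)$ be a pseudo-holomorphic Hamiltonian system with Hamiltonian vector field $X_{\mathcal{H}}=\frac12(X^{\Omega_R}_{\mathcal{H}_R}-iJ(X^{\Omega_R}_{\mathcal{H}_R}))$ and regular value $E$ of $\mathcal{H}$. Then the energy hypersurface $\mathcal{H}^{-1}(E)$ admits a pseudo-holomorphic foliation. Writing $V:=X^{\Omega_R}_{\mathcal{H}_R}$, the leaf $L_{x_0}$ of this foliation through a point $x_0\in\mathcal{H}^{-1}(E)$ is given by $$L_{x_0}:=\{y\in X\mid y=\varphi^{V}_{t_1}\circ\varphi^{J(V)}_{s_1}\circ\varphi^{V}_{t_2}\circ\varphi^{J(V)}_{s_2}\circ\cdots\circ\varphi^{V}_{t_n}\circ\varphi^{J(V)}_{s_n}(x_0);\ t_1,\dots,t_n,s_1,\dots,s_n\in\mathbb{R};\ n\in\mathbb{N}\},$$ where $\varphi^{V}_{t_j}$ and $\varphi^{J(V)}_{s_j}$ are the flows of $V$ and $J(V)$ for time $t_j$ and $s_j$, respectively. Every pseudo-holomorphic trajectory of $(X,J;\Omega_R,\mathcal{H}_R)$ with energy $E$ is completely contained in one such leaf.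
   Context: A pseudo-holomorphic Hamiltonian system (PHHS) is a collection $(X,J;\Omega_R,\mathcal{H}_R)$ where $(X,\Omega_R)$ is a real symplectic manifold, $J$ is an almost complex structure on $X$ (not necessarily integrable) with $\Omega_R(J\cdot,J\cdot)=-\Omega_R$, $\mathcal{H}_R:X\to\mathbb{R}$ is smooth, and the $1$-form $\Omega_R(J(X^{\Omega_R}_{\mathcal{H}_R}),\cdot)$ is exact, where $\Omega_R(X^{\Omega_R}_{\mathcal{H}_R},\cdot)=-d\mathcal{H}_R$. Set $\Omega:=\Omega_R-i\Omega_R(J\cdot,\cdot)$ and $\mathcal{H}:=\mathcal{H}_R+i\mathcal{H}_I$, where $\mathcal{H}_I$ is a (fixed) primitive of $\Omega_R(J(X^{\Omega_R}_{\mathcal{H}_R}),\cdot)$. The Hamiltonian vector field $X_{\mathcal{H}}$ is the smooth section of $T^{(1,0)}X$ with $\iota_{X_{\mathcal{H}}}\Omega=-d\mathcal{H}$. $E\in\mathbb{C}$ is a regular value iff $d\mathcal{H}$ (equivalently $d\mathcal{H}_R$) does not vanish at any point of $\mathcal{H}^{-1}(E)$. A pseudo-holomorphic trajectory is a map $\gamma:U\to X$, $U\subset\mathbb{C}$ open and connected, which is pseudo-holomorphic ($d\gamma\circ i=J\circ d\gamma$) and satisfies $\frac12(\partial_t\gamma-i\partial_s\gamma)(z)=X_{\mathcal{H}}(\gamma(z))$ for all $z=t+is\in U$; it has energy $E$ iff $\mathcal{H}\circ\gamma\equiv E$. The flows may be only locally defined; in the description of $L_{x_0}$ all times for which the composition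 is defined at $x_0$ are allowed. A pseudo-holomorphic foliation of an almost complex manifold is a smooth foliation such that the tangent spaces of its leaves are closed under the action of the almost complex structure. *)

(* Defs.v *)
From HB Require Import structures.
From mathcomp Require Import all_boot all_order all_algebra.
From mathcomp Require Import complex.
From mathcomp Require Import all_classical all_reals all_analysis.
Import numFieldNormedType.Exports.

Set Implicit Arguments.
Unset Strict Implicit.
Unset Printing Implicit Defensive.

Import Order.TTheory GRing.Theory Num.Theory.
Local Open Scope classical_set_scope.
Local Open Scope ring_scope.
Local Open Scope complex_scope.

(* C^k and C^oo maps on an open set A of a normed space; the definition is only
   meaningful for open A, which is the only way it is used below. *)
Fixpoint Ck_on (R : realType) (V W : normedModType R) (k : nat) (A : set V)
    (f : V -> W) : Prop :=
  match k with
  | 0 => forall p, A p -> {for p, continuous f}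
  | k'.+1 => (forall p, A p -> differentiable f p) /\
             (forall v : V, Ck_on k' A (fun p => 'D_v f p))
  end.

Definition smooth_on (R : realType) (V W : normedModType R) (A : set V)
  (f : V -> W) : Prop := forall k, Ck_on k A f.

(* A coordinate chart with values in R^m (row vectors). cmap and cinv are total
   functions whose values off cdom and off its image are irrelevant. *)
Record chart (R : realType) (m : nat) (X : topologicalType) := Chart {
  cdom : set X;
  cmap : X -> 'rV[R]_m;
  cinv : 'rV[R]_m -> X;
  cdom_open : open cdom;
  img_open : open (cmap @` cdom);
  cmapK : forall x, cdom x -> cinv (cmap x) = x;
  cmap_cont : forall x, cdom x -> {for x, continuous cmap};
  cinv_cont : forall p, (cmap @` cdom) p -> {for p, continuous cinv}
}.

Definition transition_smooth (R : realType) (m : nat) (X : topologicalType)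
    (c c' : chart R m X) : Prop :=
  smooth_on (cmap c @` (cdom c `&` cdom c')) (cmap c' \o cinv c).

(* Smooth m-manifold: Hausdorff, second countable, with a maximal smooth atlas. *)
Record manifold (R : realType) (m : nat) := Manifold {
  carrier :> topologicalType;
  atlas : set (chart R m carrier);
  manifold_hausdorff : hausdorff_space carrier;
  manifold_second_countable : @second_countable carrier;
  atlas_cover : forall x : carrier, exists2 c, atlas c & cdom c x;
  atlas_compat : forall c c', atlas c -> atlas c' -> transition_smooth c c';
  atlas_max : forall c,
    (forall c', atlas c' -> transition_smooth c c' /\ transition_smooth c' c) ->
    atlas c
}.

(* Tensor fields are given by their components in every chart of the atlas,
   subject to the transformation law. Tangent vectors are row vectors, so an
   endomorphism with matrix A acts by v |-> v *m A and a bilinear form with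
   matrix B is (v, w) |-> v *m B *m w^T. Components are only meaningful in
   charts of the atlas, at points of their domain. *)
Definition vfield (R : realType) (m : nat) (X : manifold R m) : Type :=
  chart R m X -> X -> 'rV[R]_m.
Definition cvfield (R : realType) (m : nat) (X : manifold R m) : Type :=
  chart R m X -> X -> 'rV[R[i]]_m.
Definition mxfield (R : realType) (m : nat) (X : manifold R m) : Type :=
  chart R m X -> X -> 'M[R]_m.
Definition form1 (R : realType) (m : nat) (X : manifold R m) : Type :=
  chart R m X -> X -> 'rV[R]_m -> R.

(* Change of the components of a tangent vector at x from chart c to chart c'. *)
Definition dtrans (R : realType) (m : nat) (X : topologicalType)
    (c c' : chart R m X) (x : X) (v : 'rV[R]_m) : 'rV[R]_m :=
  'd (cmap c' \o cinv c) (cmap c x) v.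

Definition smooth_components (R : realType) (m : nat) (X : manifold R m)
    (W : normedModType R) (F : chart R m X -> X -> W) : Prop :=
  forall c, atlas c -> smooth_on (cmap c @` cdom c) (fun p => F c (cinv c p)).

Definition smooth_fun (R : realType) (m : nat) (X : manifold R m)
    (f : X -> R) : Prop :=
  forall c, @atlas R m X c ->
    smooth_on (cmap c @` cdom c) (fun p => f (cinv c p)).

Definition smooth_vfield (R : realType) (m : nat) (X : manifold R m)
    (V : vfield X) : Prop :=
  smooth_components V /\
  forall c c' x, atlas c -> atlas c' -> cdom c x -> cdom c' x ->
    V c' x = dtrans c c' x (V c x).

Definition smooth_endo (R : realType) (m : nat) (X : manifold R m)
    (J : mxfield X) : Prop :=
  smooth_components J /\
  forall c c' x, atlas c -> atlas c' -> cdom c x -> cdom c' x ->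
    forall v, dtrans c c' x (v *m J c x) = dtrans c c' x v *m J c' x.

Definition bil (R : realType) (m : nat) (B : 'M[R]_m) (v w : 'rV[R]_m) : R :=
  (v *m B *m w^T) 0 0.

Definition smooth_bilinear (R : realType) (m : nat) (X : manifold R m)
    (om : mxfield X) : Prop :=
  smooth_components om /\
  forall c c' x, atlas c -> atlas c' -> cdom c x -> cdom c' x ->
    forall v w,
      bil (om c x) v w = bil (om c' x) (dtrans c c' x v) (dtrans c c' x w).

Definition dfun (R : realType) (m : nat) (X : manifold R m) (f : X -> R) :
    form1 X :=
  fun c x v => 'D_v (fun p => f (cinv c p)) (cmap c x).

Definition is_primitive (R : realType) (m : nat) (X : manifold R m)
    (al : form1 X) (f : X -> R) : Prop :=
  smooth_fun f /\
  forall c x, atlas c -> cdom c x -> forall v, dfun f c x v = al c x v.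

(* d om = 0, evaluated on the constant vector fields u, v, w of a chart. *)
Definition closed_form2 (R : realType) (m : nat) (X : manifold R m)
    (om : mxfield X) : Prop :=
  forall c x, atlas c -> cdom c x -> forall u v w,
    'D_u (fun p => bil (om c (cinv c p)) v w) (cmap c x) +
    'D_v (fun p => bil (om c (cinv c p)) w u) (cmap c x) +
    'D_w (fun p => bil (om c (cinv c p)) u v) (cmap c x) = 0.

Definition symplectic (R : realType) (m : nat) (X : manifold R m)
    (om : mxfield X) : Prop :=
  [/\ smooth_bilinear om,
      forall c x, atlas c -> cdom c x ->
        (om c x)^T = - om c x /\ om c x \in unitmx &
      closed_form2 om].

Definition almost_complex (R : realType) (m : nat) (X : manifold R m)
    (J : mxfield X) : Prop :=
  smooth_endo J /\
  forall c x, atlas c -> cdom c x -> J c x *m J c x = - 1%:M.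

Definition Jvf (R : realType) (m : nat) (X : manifold R m) (J : mxfield X)
    (V : vfield X) : vfield X :=
  fun c x => V c x *m J c x.

Definition interior_prod (R : realType) (m : nat) (X : manifold R m)
    (om : mxfield X) (V : vfield X) : form1 X :=
  fun c x w => bil (om c x) (V c x) w.

Definition hamiltonian_vf (R : realType) (m : nat) (X : manifold R m)
    (om : mxfield X) (H : X -> R) (V : vfield X) : Prop :=
  smooth_vfield V /\
  forall c x, atlas c -> cdom c x -> forall w,
    interior_prod om V c x w = - dfun H c x w.

Record phhs (R : realType) (m : nat) (X : manifold R m) (J om : mxfield X)
    (HR : X -> R) : Prop := PHHS {
  phhs_symplectic : symplectic om;
  phhs_almost_complex : almost_complex J;
  phhs_anti : forall c x, atlas c -> cdom c x -> forall v w,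
    bil (om c x) (v *m J c x) (w *m J c x) = - bil (om c x) v w;
  phhs_smooth : smooth_fun HR;
  phhs_exact : exists2 V, hamiltonian_vf om HR V &
    exists HI, is_primitive (interior_prod om (Jvf J V)) HI
}.

Definition toC (R : realType) (p q : nat) (A : 'M[R]_(p, q)) : 'M[R[i]]_(p, q) :=
  map_mx (fun r : R => r%:C) A.

Definition hamC (R : realType) (T : Type) (HR HI : T -> R) : T -> R[i] :=
  fun x => HR x +i* HI x.

Definition dhamC (R : realType) (m : nat) (X : manifold R m)
    (HR HI : X -> R) : chart R m X -> X -> 'rV[R]_m -> R[i] :=
  fun c x v => dfun HR c x v +i* dfun HI c x v.

(* The matrix of Omega = Omega_R - i Omega_R(J ., .). *)
Definition OmegaC (R : realType) (m : nat) (X : manifold R m)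
    (J om : mxfield X) : chart R m X -> X -> 'M[R[i]]_m :=
  fun c x => toC (om c x) - 'i *: toC (J c x *m om c x).

(* Smooth sections of the complexified tangent bundle lying in T^(1,0), the
   i-eigenbundle of J. *)
Definition section10 (R : realType) (m : nat) (X : manifold R m)
    (J : mxfield X) (Z : cvfield X) : Prop :=
  [/\ smooth_vfield ((fun c x => map_mx (@complex.Re R) (Z c x)) : vfield X),
      smooth_vfield ((fun c x => map_mx (@complex.Im R) (Z c x)) : vfield X) &
      forall c x, atlas c -> cdom c x -> Z c x *m toC (J c x) = 'i *: Z c x].

Definition hamiltonian_cvf (R : realType) (m : nat) (X : manifold R m)
    (J om : mxfield X) (HR HI : X -> R) (Z : cvfield X) : Prop :=
  section10 J Z /\
  forall c x, atlas c -> cdom c x -> forall w : 'rV[R]_m,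
    (Z c x *m OmegaC J om c x *m (toC w)^T) 0 0 = - dhamC HR HI c x w.

Definition regular_value (R : realType) (m : nat) (X : manifold R m)
    (HR HI : X -> R) (E : R[i]) : Prop :=
  forall x : X, hamC HR HI x = E -> forall c, @atlas R m X c -> cdom c x ->
    exists v, dhamC HR HI c x v <> 0.

Definition energy_level (R : realType) (m : nat) (X : manifold R m)
    (HR HI : X -> R) (E : R[i]) : set X :=
  [set x | hamC HR HI x = E].

Definition integral_curve (R : realType) (m : nat) (X : manifold R m)
    (V : vfield X) (a b : R) (u : R -> X) : Prop :=
  forall t, a < t < b -> {for t, continuous u} /\
    forall c, atlas c -> cdom c (u t) ->
      is_derive t 1 (fun s => cmap c (u s)) (V c (u t)).

(* flow V t x y: the time-t flow of V is defined at x and sends x to y. *)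
Definition flow (R : realType) (m : nat) (X : manifold R m) (V : vfield X)
    (t : R) (x y : X) : Prop :=
  exists a b u, [/\ a < 0 < b, a < t < b, integral_curve V a b u,
                    u 0 = x & u t = y].

(* y = phi^V_{t1} o phi^W_{s1} o ... o phi^V_{tn} o phi^W_{sn} (x), where
   ts = [:: (t1, s1); ...; (tn, sn)]. *)
Fixpoint flow_comp (R : realType) (m : nat) (X : manifold R m)
    (V W : vfield X) (ts : seq (R * R)) (x y : X) : Prop :=
  match ts with
  | [::] => y = x
  | (t, s) :: ts' =>
      exists p q, [/\ flow_comp V W ts' x p, flow W s p q & flow V t q y]
  end.

Definition flow_leaf (R : realType) (m : nat) (X : manifold R m)
    (J : mxfield X) (V : vfield X) (x0 : X) : set X :=
  [set y | exists ts, flow_comp V (Jvf J V) ts x0 y].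

(* The coordinates of index >= k of v vanish. *)
Definition tail_zero (R : realType) (m k : nat) (v : 'rV[R]_m) : Prop :=
  forall j : 'I_m, (k <= j)%N -> v 0 j = 0.

(* c is a slice chart for N: in it N is R^d x {0}. The first d coordinates are
   then local coordinates of the d-dimensional submanifold N, and every local
   coordinate system of N arises locally in this way. The tangent space of N at
   a point consists of the v with tail_zero d v. *)
Definition slice_chart (R : realType) (m : nat) (X : manifold R m) (d : nat)
    (N : set X) (c : chart R m X) : Prop :=
  atlas c /\ forall y, cdom c y -> (N y <-> tail_zero d (cmap c y)).

Definition plaque (R : realType) (m : nat) (X : manifold R m) (p : nat)
    (N : set X) (c : chart R m X) (y : X) : set X :=
  [set z | [/\ cdom c z, N z & tail_zero p (cmap c z - cmap c y)]].

(* A slice chart whose first d coordinates are a foliated chart of N for the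
   decomposition F: for every leaf L, the connected components of the part of L
   in the chart domain are the sets where coordinates p, ..., d-1 are constant.
   The tangent space of a leaf consists of the v with tail_zero p v. *)
Definition foliated_chart (R : realType) (m : nat) (X : manifold R m)
    (d p : nat) (N : set X) (F : set (set X)) (c : chart R m X) : Prop :=
  slice_chart d N c /\
  forall L y, F L -> L y -> cdom c y ->
    connected_component (L `&` cdom c) y = plaque p N c y.

Definition tail_invariant (R : realType) (m k : nat) (A : 'M[R]_m) : Prop :=
  forall v, tail_zero k v -> tail_zero k (v *m A).

(* F (the set of leaves) is a smooth foliation of the embedded submanifold N;
   J preserves the tangent spaces of N, so that N is an almost complex manifold,
   and the tangent spaces of the leaves. *)
Definition pseudo_holomorphic_foliation (R : realType) (m : nat)
    (X : manifold R m) (J : mxfield X) (N : set X) (F : set (set X)) : Prop :=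
  [/\ forall L, F L -> [/\ L !=set0, L `<=` N & connected L],
      forall L L', F L -> F L' -> L `&` L' !=set0 -> L = L',
      forall x, N x -> exists2 L, F L & L x &
      exists d p : nat, (p <= d <= m)%N /\
        forall x, N x -> exists c, [/\ cdom c x, foliated_chart d p N F c &
          forall y, N y -> cdom c y ->
            tail_invariant d (J c y) /\ tail_invariant p (J c y)]].

(* The derivative at z in the direction zeta of g, a map from C to X, in the
   chart c; C is identified with R^2 via z = t + i s. *)
Definition ddir (R : realType) (m : nat) (X : manifold R m) (g : R[i] -> X)
    (c : chart R m X) (z zeta : R[i]) : 'rV[R]_m :=
  'D_1 (fun h : R => cmap c (g (z + h%:C * zeta))) 0.

Definition smooth_map_on (R : realType) (m : nat) (X : manifold R m)
    (U : set R[i]) (g : R[i] -> X) : Prop :=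
  (forall z, U z -> {for z, continuous (g : R[i]^o -> X)}) /\
  forall c, @atlas R m X c ->
    smooth_on [set w : R * R | U (w.1 +i* w.2) /\ cdom c (g (w.1 +i* w.2))]
      (fun w => cmap c (g (w.1 +i* w.2))).

Definition pseudo_holomorphic_map (R : realType) (m : nat) (X : manifold R m)
    (J : mxfield X) (U : set R[i]) (g : R[i] -> X) : Prop :=
  smooth_map_on U g /\
  forall z c, U z -> atlas c -> cdom c (g z) -> forall zeta,
    ddir g c z ('i * zeta) = ddir g c z zeta *m J c (g z).

(* g is only relevant on the (nonempty, open, connected) set U. *)
Definition trajectory (R : realType) (m : nat) (X : manifold R m)
    (J : mxfield X) (Z : cvfield X) (U : set R[i]) (g : R[i] -> X) : Prop :=
  [/\ [/\ U !=set0, open (U : set R[i]^o) & connected (U : set R[i]^o)],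
      pseudo_holomorphic_map J U g &
      forall z c, U z -> atlas c -> cdom c (g z) ->
        2^-1 *: (toC (ddir g c z 1) - 'i *: toC (ddir g c z 'i)) = Z c (g z)].

(* Main.v *)
(* The fields V and W = J V are the Hamiltonian fields of H_R and - H_I. Since
   Omega_R(V, W) = 0, they preserve both functions, and closedness of Omega_R
   gives [V, W] = 0; at a regular point they are independent, and so are dH_R and
   dH_I. Picard iteration, smooth dependence on initial values and the inverse
   function theorem then give flow boxes: charts onto a ball in which V and W are
   the first two coordinate fields and H - E is the last pair of coordinates.

   The flows preserve the last coordinates of a flow box, so a leaf meets a box
   in a union of plaques (sets where all coordinates but the first two are
   constant). Moving only for rational times shows that there are countably many
   of them, and a connected set with countably many values of the transverse
   coordinates lies in a single plaque: the plaques are the components.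

   Writing Z = A - i B, the condition Z in T^(1,0) says B = A J, and the real part
   of the equation for Z gives 2 A = V. A trajectory therefore has partial
   derivatives V and W; in a flow box it is affine with values in one plaque, so
   the set of times at which it is in a given leaf is open and closed. *)

Require Import Defs.
From HB Require Import structures.
From mathcomp Require Import all_boot all_order all_algebra.
From mathcomp Require Import complex.
From mathcomp Require Import all_classical all_reals all_analysis.
From mathcomp Require Import ring lra.
Import numFieldNormedType.Exports.
Set Implicit Arguments.
Unset Strict Implicit.
Unset Printing Implicit Defensive.
Import Order.TTheory GRing.Theory Num.Theory.
Local Open Scope classical_set_scope.
Local Open Scope ring_scope.
Local Open Scope complex_scope.

(** * Maps of class C^k *)

(** One chart has to be a slice chart for the level and a foliated chart at the same time, so [V],
    [W] and [H - E] must be straightened together. This works because both fields lie in the kernel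
    of [dH]: exchanging the last pair of flow coordinates for [H - E] leaves the first two
    coordinate directions intact. Flow boxes exist only around points of the level, whereas a leaf
    is built from arbitrary local integral curves in [X]. The level is closed, which confines such
    curves to it, and in a box they are straight lines; uniqueness of integral curves on the
    manifold is deduced from this. A leaf may return to the same box infinitely often and accumulate
    on itself, so its plaques cannot be separated by open sets; this is why they have to be counted.
    Row vectors carry the sup norm. Balls are therefore cubes, in which one can move along one
    coordinate after the other without leaving the box. The price is paid in the differential
    inequalities, where a differentiable square has to replace the norm. *)

Section differential_epsilon.
Context {R : realType} {V W : normedModType R}.

Lemma diff_eps (f : V -> W) x : differentiable f x -> forall e, 0 < e ->
  \forall h \near (0 : V), `|f (h + x) - f x - 'd f x h| <= e * `|h|.
Proof.
move=> /diff_locallyP[_ /eqaddoP fE] e e0.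
apply: filterS (fE e e0) => h.
by rewrite -[X in `|X| <= _ -> _]/(f (h + x) - (f x + 'd f x h)) opprD addrA.
Qed.

Lemma diff_epsP (f : V -> W) x (L : {linear V -> W}) : continuous L ->
  (forall e, 0 < e ->
    \forall h \near (0 : V), `|f (h + x) - f x - L h| <= e * `|h|) ->
  differentiable f x /\ 'd f x = L :> (V -> W).
Proof.
move=> cL fL.
have fE : f \o shift x = cst (f x) + L +o_ (0 : V) id.
  apply/eqaddoP => e e0; near=> h.
  rewrite -[X in `|X|]/(f (h + x) - (f x + L h)) opprD addrA.
  by near: h; exact: fL.
have dE := diff_unique cL fE.
by split => //; apply/diff_locallyP; rewrite dE.
Unshelve. all: by end_near. Qed.

End differential_epsilon.

Section Ck_general.
Context {R : realType}.
Implicit Types V W : normedModType R.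

Lemma near_eq_differentiable V W (f g : V -> W) x :
  (\forall y \near x, f y = g y) -> differentiable f x -> differentiable g x.
Proof.
move=> fg fd; have fgx := nbhs_singleton fg.
have [] // := @diff_epsP _ _ _ g x ('d f x); first exact: diff_continuous.
move=> e e0.
have cx : (fun h : V => h + x) @ (0 : V) --> x.
  by rewrite -[X in _ --> X]add0r; apply: cvgD; [exact: cvg_id|exact: cvg_cst].
have fgh : \forall h \near (0 : V), f (h + x) = g (h + x) by exact: (cx _ fg).
by apply: filterS2 fgh (diff_eps fd e0) => h ->; rewrite fgx.
Qed.

(** On an open set, agreement at every point is agreement of germs, which is all that continuity and
    directional derivatives see. *)
Lemma Ck_congr k V W (A : set V) (f g : V -> W) : open A ->
  (forall p, A p -> f p = g p) -> Ck_on k A f -> Ck_on k A g.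
Proof.
move=> oA; elim: k f g => [|k IH] f g fg /=.
  move=> fC p Ap; have nfg : \forall x \near p, f x = g x.
    by apply: filterS (open_nbhs_nbhs (conj oA Ap)).
  have fp : f @ p --> f p := fC p Ap.
  apply: cvg_trans (_ : f @ p --> g p); first exact: near_eq_cvg.
  by rewrite -(fg p Ap).
move=> [fd fC].
have nfg p : A p -> \forall x \near p, f x = g x.
  by move=> Ap; apply: filterS (open_nbhs_nbhs (conj oA Ap)).
split=> [p Ap|v].
  by apply: near_eq_differentiable (nfg p Ap) (fd p Ap).
apply: IH (fC v) => p Ap; exact: near_eq_derive (nfg p Ap).
Qed.

Lemma Ck_sub k V W (A B : set V) (f : V -> W) :
  B `<=` A -> Ck_on k A f -> Ck_on k B f.
Proof.
move=> BA; elim: k f => [|k IH] f /=; first by move=> fC p /BA /fC.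
by move=> [fd fC]; split=> [p /BA /fd//|v]; apply: IH.
Qed.

Lemma CkW k V W (A : set V) (f : V -> W) : Ck_on k.+1 A f -> Ck_on k A f.
Proof.
elim: k f => [|k IH] f; first by move=> [fd _] p /fd /differentiable_continuous.
by move=> [fd fC]; split=> // v; apply: IH.
Qed.

Lemma Ck_cst k V W (A : set V) (a : W) : Ck_on k A (fun=> a).
Proof.
elim: k a => [|k IH] a /=; first by move=> p _; exact: cst_continuous.
split=> [p _|v]; first exact: differentiable_cst.
have -> : (fun p => 'D_v (fun=> a) p) = (fun=> 0) :> (V -> W).
  by apply/funext => p; exact: derive_cst.
exact: IH.
Qed.

Lemma Ck_lin k V W (A : set V) (L : {linear V -> W}) :
  continuous L -> Ck_on k A L.
Proof.
move=> cL; case: k => [|k] /=; first by move=> p _; exact: cL.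
split=> [p _|v]; first exact: linear_differentiable.
have -> : (fun p => 'D_v L p) = (fun=> L v) :> (V -> W).
  apply/funext => p; rewrite deriveE ?diff_lin //.
  exact: linear_differentiable.
exact: Ck_cst.
Qed.

Lemma CkD k V W (A : set V) (f g : V -> W) : open A ->
  Ck_on k A f -> Ck_on k A g -> Ck_on k A (fun x => f x + g x).
Proof.
move=> oA; elim: k f g => [|k IH] f g /=.
  by move=> fC gC p Ap; apply: cvgD; [exact: fC|exact: gC].
move=> [fd fC] [gd gC]; split=> [p Ap|v].
  by apply: differentiableD; [exact: fd|exact: gd].
apply: (Ck_congr oA _ (IH _ _ (fC v) (gC v))) => p Ap.
by rewrite deriveD //; apply: diff_derivable; [exact: fd|exact: gd].
Qed.

Lemma CkZc k V W (A : set V) (a : R) (f : V -> W) : open A ->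
  Ck_on k A f -> Ck_on k A (fun x => a *: f x).
Proof.
move=> oA; elim: k f => [|k IH] f /=.
  by move=> fC p Ap; apply: cvgZl_tmp; exact: fC.
move=> [fd fC]; split=> [p Ap|v].
  by apply: differentiableZ; exact: fd.
apply: (Ck_congr oA _ (IH _ (fC v))) => p Ap.
by rewrite deriveZ //; apply: diff_derivable; exact: fd.
Qed.

Lemma Ck_sum k V W (A : set V) (I : Type) (r : seq I) (P : pred I)
    (f : I -> V -> W) : open A ->
  (forall i, P i -> Ck_on k A (f i)) ->
  Ck_on k A (fun x => \sum_(i <- r | P i) f i x).
Proof.
move=> oA fC; elim: r => [|i r IH].
  rewrite (_ : (fun x => _) = fun=> 0); first exact: Ck_cst.
  by apply/funext => x; rewrite big_nil.
case: (boolP (P i)) => Pi.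
  rewrite (_ : (fun x => _) = fun x => f i x + \sum_(j <- r | P j) f j x).
    by apply: CkD => //; exact: fC.
  by apply/funext => x; rewrite big_cons Pi.
rewrite (_ : (fun x => _) = fun x => \sum_(j <- r | P j) f j x) //.
by apply/funext => x; rewrite big_cons (negbTE Pi).
Qed.

Lemma CkM k V (A : set V) (f g : V -> R) : open A ->
  Ck_on k A f -> Ck_on k A g -> Ck_on k A (fun x => f x * g x).
Proof.
move=> oA; elim: k f g => [|k IH] f g.
  by move=> fC gC p Ap; apply: cvgM; [exact: fC|exact: gC].
move=> fk gk; have [fd fC] := fk; have [gd gC] := gk; split=> [p Ap|v].
  by apply: differentiableM; [exact: fd|exact: gd].
apply: (Ck_congr oA _ (CkD oA (IH _ _ (CkW fk) (gC v)) (IH _ _ (CkW gk) (fC v)))).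
move=> p Ap.
by rewrite deriveM //; apply: diff_derivable; [exact: fd|exact: gd].
Qed.

Lemma Ck_prod k V (A : set V) (I : Type) (r : seq I) (P : pred I)
    (f : I -> V -> R) : open A ->
  (forall i, P i -> Ck_on k A (f i)) ->
  Ck_on k A (fun x => \prod_(i <- r | P i) f i x).
Proof.
move=> oA fC; elim: r => [|i r IH].
  rewrite (_ : (fun x => _) = fun=> 1); first exact: Ck_cst.
  by apply/funext => x; rewrite big_nil.
case: (boolP (P i)) => Pi.
  rewrite (_ : (fun x => _) = fun x => f i x * \prod_(j <- r | P j) f j x).
    by apply: CkM => //; exact: fC.
  by apply/funext => x; rewrite big_cons Pi.
rewrite (_ : (fun x => _) = fun x => \prod_(j <- r | P j) f j x) //.
by apply/funext => x; rewrite big_cons (negbTE Pi).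
Qed.

Lemma Ck_inv k V (A : set V) (f : V -> R) : open A ->
  (forall x, A x -> f x != 0) ->
  Ck_on k A f -> Ck_on k A (fun x => (f x)^-1).
Proof.
move=> oA f0; elim: k => [|k IH].
  by move=> fC p Ap; apply: cvgV; [exact: f0|exact: fC].
move=> fk; have [fd fC] := fk; split=> [p Ap|v].
  by apply: differentiableV; [exact: fd|exact: f0].
have := IH (CkW fk) => fVC.
apply: (Ck_congr oA _ (CkZc (-1) oA (CkM oA (CkM oA fVC fVC) (fC v)))) => p Ap.
rewrite deriveV; [|exact: f0|by apply: diff_derivable; exact: fd].
by rewrite -exprVn expr2 -[RHS]/(_ * _) -[LHS]/(_ * _) mulN1r mulNr.
Qed.

Lemma Ck_coord k V (A : set V) p q (f : V -> 'M[R]_(p, q)) i j : open A ->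
  Ck_on k A f -> Ck_on k A (fun x => f x i j).
Proof.
move=> oA; elim: k f => [|k IH] f.
  move=> fC x Ax; apply: (@continuous_comp _ _ _ f (fun M : 'M[R]_(p, q) => M i j)).
    exact: fC.
  exact: coord_continuous.
move=> [fd fC]; split=> [x Ax|v].
  apply: (@differentiable_comp _ _ _ _ f (fun M : 'M[R]_(p, q) => M i j)).
    exact: fd.
  exact: differentiable_coord.
apply: (Ck_congr oA _ (IH _ (fC v))) => x Ax.
by rewrite derive_mx ?mxE //; apply: diff_derivable; exact: fd.
Qed.

Lemma Ck_Zl k V W (A : set V) (a : V -> R) (w : W) : open A ->
  Ck_on k A a -> Ck_on k A (fun x => a x *: w).
Proof.
move=> oA; elim: k a => [|k IH] a.
  by move=> aC x Ax; apply: cvgZr_tmp; exact: aC.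
move=> [ad aC]; split=> [x Ax|v]; first by apply: differentiableZl; exact: ad.
apply: (Ck_congr oA _ (IH _ (aC v))) => x Ax.
rewrite [RHS]deriveE; last by apply: differentiableZl; exact: ad.
by rewrite diffZl ?deriveE //; exact: ad.
Qed.

Lemma Ck_mx k V (A : set V) p q (f : V -> 'M[R]_(p, q)) : open A ->
  (forall i j, Ck_on k A (fun x => f x i j)) -> Ck_on k A f.
Proof.
move=> oA fC.
have -> : f = fun x => \sum_i \sum_j f x i j *: delta_mx i j.
  by apply/funext => x; rewrite [LHS]matrix_sum_delta.
apply: Ck_sum => // i _; apply: Ck_sum => // j _.
exact: Ck_Zl.
Qed.

End Ck_general.

Section matrix_norm.
Context {R : realType}.

Lemma mx_entry_le p q (M : 'M[R]_(p, q)) i j : `|M i j| <= `|M|.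
Proof.
rewrite [leRHS]/Num.Def.normr /= mx_normrE.
exact: (le_bigmax _ (fun ij => `|M ij.1 ij.2|) (i, j)).
Qed.

Lemma mx_norm_le p q (M : 'M[R]_(p, q)) c : 0 <= c ->
  (forall i j, `|M i j| <= c) -> `|M| <= c.
Proof.
by move=> c0 Mc; rewrite /Num.Def.normr /= mx_normrE; apply: bigmax_le => // -[].
Qed.

Lemma mulmx_norm_le n p (v : 'rV[R]_n) (A : 'M[R]_(n, p)) :
  `|v *m A| <= n%:R * `|v| * `|A|.
Proof.
apply: mx_norm_le => [|i j]; first by rewrite !mulr_ge0.
rewrite mxE (le_trans (ler_norm_sum _ _ _)) //.
apply: le_trans (_ : \sum_(k < n) `|v| * `|A| <= _).
  by apply: ler_sum => k _; rewrite normrM ler_pM ?mx_entry_le.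
by rewrite sumr_const card_ord -mulrA mulr_natl.
Qed.

Lemma linear_rV_continuous n (W : normedModType R)
  (L : {linear 'rV[R]_n -> W}) : continuous L.
Proof.
have -> : (L : _ -> _) = fun v => \sum_i v 0 i *: L (delta_mx 0 i).
  apply/funext => v; rewrite {1}(row_sum_delta v) linear_sum.
  by apply: eq_bigr => i _; rewrite linearZ.
suff : Ck_on 0 setT (fun v : 'rV[R]_n => \sum_i v 0 i *: L (delta_mx 0 i)).
  by move=> LC v; exact: LC.
apply: Ck_sum => [|i _]; first exact: openT.
by apply: Ck_Zl => [|v _]; [exact: openT|exact: coord_continuous].
Qed.

Lemma derive_rV n (W : normedModType R) (f : 'rV[R]_n -> W) x v :
  differentiable f x -> 'D_v f x = \sum_i v 0 i *: 'D_(delta_mx 0 i) f x.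
Proof.
move=> fd; rewrite deriveE // {1}(row_sum_delta v) linear_sum.
by apply: eq_bigr => i _; rewrite linearZ /= deriveE.
Qed.

End matrix_norm.

Section smooth_composition.
Context {R : realType}.

(** By the chain rule the derivative of [f \o g] along [v] is a finite sum: the coordinates of
    ['D_v g] times the partial derivatives of [f] composed with [g]. Scalar values of [f] let [CkM]
    handle each term, and the induction hypothesis covers the composed partial derivatives. *)
Lemma Ck_comp_scalar k n (V : normedModType R) (A : set V) (B : set 'rV[R]_n)
    (f : 'rV[R]_n -> R) (g : V -> 'rV[R]_n) : open A ->
  (forall x, A x -> B (g x)) ->
  Ck_on k B f -> Ck_on k A g -> Ck_on k A (f \o g).
Proof.
move=> oA AB; elim: k f => [|k IH] f fk gk.
  by move=> p Ap; apply: continuous_comp; [exact: gk|exact/fk/AB].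
have [fd fC] := fk; have [gd gC] := gk; split=> [p Ap|v].
  by apply: differentiable_comp; [exact: gd|exact/fd/AB].
have Ck := Ck_sum (index_enum 'I_n) (P := predT) oA (fun i _ =>
  CkM oA (Ck_coord 0 i oA (gC v)) (IH _ (fC (delta_mx 0 i)) (CkW gk))).
apply: (Ck_congr oA _ Ck) => p Ap /=.
rewrite [RHS]deriveE; last by apply: differentiable_comp; [exact: gd|exact/fd/AB].
rewrite diff_comp /=; [|exact: gd|exact/fd/AB].
rewrite -deriveE ?[in RHS]derive_rV; [|exact/fd/AB|exact/fd/AB].
by apply: eq_bigr => i _; rewrite -deriveE //; exact: gd.
Qed.

Lemma Ck_comp k n p q (V : normedModType R) (A : set V) (B : set 'rV[R]_n)
    (f : 'rV[R]_n -> 'M[R]_(p, q)) (g : V -> 'rV[R]_n) : open A -> open B ->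
  (forall x, A x -> B (g x)) ->
  Ck_on k B f -> Ck_on k A g -> Ck_on k A (f \o g).
Proof.
move=> oA oB AB fk gk; apply: Ck_mx => // i j.
apply: (Ck_comp_scalar (f := fun y => f y i j) oA AB) => //.
exact: Ck_coord.
Qed.

Lemma Ck_mulmx k p q r (V : normedModType R) (A : set V)
    (f : V -> 'M[R]_(p, q)) (g : V -> 'M[R]_(q, r)) : open A ->
  Ck_on k A f -> Ck_on k A g -> Ck_on k A (fun x => f x *m g x).
Proof.
move=> oA fk gk; apply: Ck_mx => // i j.
rewrite (_ : (fun x => _) = fun x => \sum_l f x i l * g x l j); last first.
  by apply/funext => x; rewrite mxE.
by apply: Ck_sum => // l _; apply: CkM => //; exact: Ck_coord.
Qed.

Lemma CkZ k p q (V : normedModType R) (A : set V) (a : V -> R)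
    (f : V -> 'M[R]_(p, q)) : open A ->
  Ck_on k A a -> Ck_on k A f -> Ck_on k A (fun x => a x *: f x).
Proof.
move=> oA ak fk; apply: Ck_mx => // i j.
rewrite (_ : (fun x => _) = fun x => a x * f x i j).
  by apply: CkM => //; exact: Ck_coord.
by apply/funext => x; rewrite mxE.
Qed.

Lemma Ck_det k n (V : normedModType R) (A : set V) (f : V -> 'M[R]_n) :
  open A -> Ck_on k A f -> Ck_on k A (fun x => \det (f x)).
Proof.
move=> oA fk; apply: Ck_sum => // s _; apply: CkM => //; first exact: Ck_cst.
by apply: Ck_prod => // i _; exact: Ck_coord.
Qed.

(** Cramer's rule: every entry is a cofactor divided by the determinant. *)
Lemma Ck_invmx k n (V : normedModType R) (A : set V) (f : V -> 'M[R]_n) :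
  open A -> (forall x, A x -> f x \in unitmx) ->
  Ck_on k A f -> Ck_on k A (fun x => invmx (f x)).
Proof.
move=> oA fu fk; apply: Ck_mx => // i j.
apply: (Ck_congr (f := fun x => (\det (f x))^-1 * cofactor (f x) j i)) => //.
  by move=> x Ax; rewrite /invmx fu // !mxE.
apply: CkM => //.
  apply: Ck_inv => //; last exact: Ck_det.
  by move=> x Ax; rewrite -unitfE -unitmxE fu.
apply: CkM => //; first exact: Ck_cst.
apply: Ck_det => //; apply: Ck_mx => // a b.
under eq_fun do rewrite !mxE.
exact: Ck_coord.
Qed.

Lemma Ck_jacobian k n p (A : set 'rV[R]_n) (f : 'rV[R]_n -> 'rV[R]_p) :
  open A -> Ck_on k.+1 A f -> Ck_on k A (fun x => jacobian f x).
Proof.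
move=> oA [fd fC]; apply: Ck_mx => // i j.
apply: (Ck_congr oA _ (Ck_coord 0 j oA (fC (delta_mx 0 i)))) => x Ax.
by rewrite deriveEjacobian; [rewrite -rowE mxE|exact: fd].
Qed.

End smooth_composition.

Section mean_value.
Context {R : realType}.

Lemma mean_value_line (V : normedModType R) (f : V -> R) y v :
  (forall s : R, 0 <= s <= 1 -> differentiable f (y + s *: v)) ->
  exists2 s, 0 <= s <= 1 & f (y + v) - f y = 'D_v f (y + s *: v).
Proof.
move=> fd; pose g (s : R) := f (y + s *: v).
have gd (s : R) : 0 <= s <= 1 -> is_derive s (1 : R) g ('D_v f (y + s *: v)).
  move=> s01; have fds := fd s s01.
  have dl : is_diff s (fun s : R => y + s *: v) (fun h => h *: v).
    have -> : (fun h : R => h *: v) = 0 \+ *:%R^~ v.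
      by apply/funext => h /=; rewrite add0r.
    by apply: is_diffD.
  have dg : differentiable g s by apply: differentiable_comp.
  apply: DeriveDef; first exact: diff_derivable.
  by rewrite deriveE // diff_comp //= (diff_val (is_diff_def := dl)) scale1r deriveE.
have [|||s + gE] := @MVT_segment R g (fun s => 'D_v f (y + s *: v)) 0 1.
- by [].
- by move=> s; rewrite in_itv /= => /andP[s0 s1]; apply: gd; rewrite !ltW.
- apply: derivable_within_continuous => s; rewrite in_itv /= => s01.
  by have [] := gd s s01.
rewrite in_itv /= => s01; exists s => //.
by move: gE; rewrite /g scale1r scale0r addr0 subr0 mulr1.
Qed.

(** The mean value theorem is applied to each coordinate on the segment from [y] to [y'], where the
    Jacobian is close to the one at [x0]. One radius serves all pairs of points; this gives the
    contraction estimate of the inverse function theorem and the local Lipschitz bound for vector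
    fields. *)
Lemma strictly_differentiable n p (A : set 'rV[R]_n) (f : 'rV[R]_n -> 'rV[R]_p)
    x0 e : open A -> A x0 -> Ck_on 1 A f -> 0 < e ->
  exists2 r, 0 < r & ball x0 r `<=` A /\ forall y y', ball x0 r y -> ball x0 r y' ->
    `|f y' - f y - (y' - y) *m jacobian f x0| <= e * `|y' - y|.
Proof.
move=> oA Ax0 fC e0; have fd := fC.1.
have Jc : {for x0, continuous (fun x => jacobian f x)}.
  exact: (Ck_jacobian (k := 0) oA fC).
have [d d0 dJ] : exists2 d, 0 < d & forall z, ball x0 d z ->
    A z /\ `|jacobian f z - jacobian f x0| <= e / (n%:R + 1).
  (* In the sup norm, multiplying a row of length [n] by a matrix costs a factor [n]; the [+ 1]
     covers [n = 0]. *)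
  have e'0 : 0 < e / (n%:R + 1) by rewrite divr_gt0 // ltr_wpDl.
  have /nbhs_ballP[d d0 dJ] : nbhs x0 (fun z => A z /\
      `|jacobian f z - jacobian f x0| <= e / (n%:R + 1)).
    have nA : \forall z \near x0, A z by exact: open_nbhs_nbhs.
    have nJ : \forall z \near x0,
        `|jacobian f x0 - jacobian f z| <= e / (n%:R + 1).
      have cJ : (fun z => jacobian f z) @ x0 --> jacobian f x0 by [].
      by move/cvgrPdist_le : cJ => /(_ _ e'0).
    apply: filterS2 nA nJ => z Az Jz; split; first exact: Az.
    rewrite -normrN opprB.
    exact: Jz.
  by exists d.
exists d => //; split=> [z /dJ[]//|y y' yd yd'].
have seg (s : R) : 0 <= s <= 1 -> ball x0 d (y + s *: (y' - y)).
  move=> /andP[s0 s1]; move: yd yd'; rewrite -!ball_normE /= => yd yd'.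
  have -> : x0 - (y + s *: (y' - y)) = (1 - s) *: (x0 - y) + s *: (x0 - y').
    by apply/matrixP => i j; rewrite !mxE; ring.
  rewrite (le_lt_trans (ler_normD _ _)) // !normrZ (ger0_norm s0).
  rewrite ger0_norm ?subr_ge0 //.
  have : (1 - s) * `|x0 - y| + s * `|x0 - y'| < (1 - s) * d + s * d.
    have [->|s_neq0] := eqVneq s 0; first by rewrite subr0 !mul1r !mul0r !addr0.
    by rewrite ler_ltD ?ler_wpM2l ?subr_ge0 ?(ltW yd) // ltr_pM2l // lt0r s_neq0.
  by rewrite -mulrDl subrK mul1r.
apply: mx_norm_le => [|i j]; first by rewrite mulr_ge0 // ltW.
rewrite ord1.
have [s s01 fE] := @mean_value_line _ (fun z => f z 0 j) y (y' - y)
  (fun s s01 => differentiable_comp (fd _ (dJ _ (seg s s01)).1)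
                (@differentiable_coord R 1 p _ 0 j)).
have fdz := fd _ (dJ _ (seg s s01)).1.
have -> : (f y' - f y - (y' - y) *m jacobian f x0) 0 j =
    ((y' - y) *m (jacobian f (y + s *: (y' - y)) - jacobian f x0)) 0 j.
  rewrite mulmxBr [LHS]mxE [RHS]mxE; congr (_ + _).
  rewrite -deriveEjacobian // derive_mx; last exact: diff_derivable.
  by rewrite !mxE -fE (addrC y) subrK.
apply: le_trans (mx_entry_le _ _ _) _; apply: le_trans (mulmx_norm_le _ _) _.
have := (dJ _ (seg s s01)).2; set q := `|jacobian f _ - _| => qe.
apply: le_trans (_ : n%:R * `|y' - y| * (e / (n%:R + 1)) <= _).
  by rewrite ler_wpM2l // mulr_ge0.
rewrite mulrAC ler_wpM2r // mulrA ler_pdivrMr ?ltr_wpDl // mulrC.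
by rewrite ler_wpM2l ?(ltW e0) // lerDl.
Qed.

End mean_value.

(** * The inverse function theorem *)

(* The library has completeness and the norm of matrices, but not their join. *)
HB.instance Definition _ (R : realType) m n :=
  Uniform_isComplete.Build 'M[R]_(m, n) cauchy_cvg.

Section inverse_function.
Context {R : realType}.

(** The centre moves by at most [s / 2] and the contraction contributes another [s / 2], so the
    closed ball of radius [s] is mapped to itself and Banach's theorem applies there. *)
Lemma contraction_fixed_point n (x : 'rV[R]_n) s (k : 'rV[R]_n -> 'rV[R]_n) :
  0 < s ->
  (forall z z', `|x - z| <= s -> `|x - z'| <= s ->
     `|k z - k z'| <= 2^-1 * `|z - z'|) ->
  `|x - k x| <= s / 2 -> exists2 z, `|x - z| <= s & k z = z.
Proof.
move=> s0 kc kx; pose U : set 'rV[R]_n := closed_ball x s.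
have UE z : U z <-> `|x - z| <= s by rewrite /U closed_ballE.
have kU : {homo k : z / U z >-> U z}.
  move=> z /UE Uz; apply/UE.
  have -> : x - k z = (x - k x) + (k x - k z) by rewrite addrA subrK.
  rewrite (le_trans (ler_normD _ _)) // (splitr s) lerD //.
  have xx : `|x - x| <= s by rewrite subrr normr0 ltW.
  by apply: le_trans (kc _ _ xx Uz) _; rewrite mulrC ler_wpM2r ?invr_ge0.
pose k' : {fun U >-> U} := mkfun_fun kU.
have h0 : (0 : R) <= 2^-1 by rewrite invr_ge0.
have ck' : is_contraction k'.
  exists (NngNum h0); split => /=; first by rewrite invf_lt1 // ltr1n.
  by move=> [z z'] /= [/UE Uz /UE Uz']; exact: kc.
have [||z /UE Uz kz] := banach_fixed_point ck'.
- exact: closed_ball_closed.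
- by exists x; apply/UE; rewrite subrr normr0 ltW.
by exists z.
Qed.

(** Bootstrapping: the derivative of [g] is a smooth expression in [g] itself, so each order of
    regularity of [g] yields the next. *)
Lemma Ck_inverse k n (O O' : set 'rV[R]_n) (f g : 'rV[R]_n -> 'rV[R]_n) :
  open O -> open O' -> (forall w, O' w -> O (g w)) ->
  smooth_on O f -> (forall x, O x -> jacobian f x \in unitmx) ->
  (forall w, O' w -> differentiable g w) ->
  (forall w v, O' w -> 'D_v g w = v *m invmx (jacobian f (g w))) ->
  Ck_on k O' g.
Proof.
move=> oO oO' gO fS fu gd gD; elim: k => [|k IH].
  by move=> w /gd; exact: differentiable_continuous.
split=> // v.
apply: (Ck_congr (f := fun w => v *m invmx (jacobian f (g w)))) => //.
  by move=> w Ow; rewrite gD.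
apply: Ck_mulmx => //; first exact: Ck_cst.
apply: Ck_invmx => //; first by move=> w /gO; exact: fu.
apply: (Ck_comp oO' oO gO _ IH).
by apply: Ck_jacobian => //; exact: fS.
Qed.

Lemma inverse_function n (A : set 'rV[R]_n) (f : 'rV[R]_n -> 'rV[R]_n) x0 :
  open A -> A x0 -> smooth_on A f -> jacobian f x0 \in unitmx ->
  exists O g, [/\ [/\ open O, O x0 & O `<=` A], open (f @` O),
    forall x, O x -> g (f x) = x, smooth_on (f @` O) g &
    forall x, O x -> jacobian f x \in unitmx].
Proof.
move=> oA Ax0 fS f'u.
(* A solution of [f z = w] is a fixed point of the simplified Newton map [z - (f z - w) *m P]. The
   constant [C] bounds right multiplication by [P], so the precision [(2 * C)^-1] makes this map a
   contraction by 1/2. *)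
pose P := invmx (jacobian f x0).
pose C := n%:R * `|P| + 1.
have C0 : 0 < C by rewrite ltr_wpDl // mulr_ge0.
have PC (v : 'rV[R]_n) : `|v *m P| <= C * `|v|.
  apply: le_trans (mulmx_norm_le _ _) _.
  by rewrite mulrAC ler_wpM2r // lerDl.
have e0 : 0 < (2 * C)^-1 by rewrite invr_gt0 mulr_gt0.
have [r1 r10 [r1A fr1]] := strictly_differentiable oA Ax0 (fS 1) e0.
have [r2 /= r20 r2u] : exists2 r, 0 < r &
    forall x, ball x0 r x -> jacobian f x \in unitmx.
  have : {for x0, continuous (fun x => \det (jacobian f x))}.
    by apply: (Ck_det (k := 0) oA (Ck_jacobian oA (fS 1))).
  move/(_ [set z | z != 0]) => /=.
  have d0 : nbhs (\det (jacobian f x0)) [set z : R | z != 0].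
    apply: open_nbhs_nbhs; split; first exact: open_neq.
    by rewrite /= -unitfE -unitmxE.
  move=> /(_ d0) /nbhs_ballP[r2 r20 r2u].
  exists r2; first exact: r20.
  by move=> x xr; rewrite unitmxE unitfE; exact: (r2u x xr).
pose r := Num.min r1 r2.
have r0 : 0 < r by rewrite lt_min r10.
pose O := ball x0 r.
have O1 x : O x -> ball x0 r1 x by apply: le_ball; rewrite ge_min lexx.
have O2 x : O x -> jacobian f x \in unitmx.
  by move=> Ox; apply: r2u; apply: le_ball Ox; rewrite ge_min lexx orbT.
have oO : open O by exact: ball_open.
have Ox0 : O x0 by exact: ballxx.
clearbody O.
have fr y y' : O y -> O y' ->
    `|(f y' - f y) *m P - (y' - y)| <= 2^-1 * `|y' - y|.
  move=> Oy Oy'; have := fr1 y y' (O1 _ Oy) (O1 _ Oy').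
  rewrite -(ler_pM2l C0) mulrA; set q := C / _.
  have -> : q = 2^-1 by rewrite /q invfM mulrCA divff ?mulr1 ?gt_eqF.
  apply: le_trans; apply: le_trans (PC _).
  by rewrite [in leRHS]mulmxBl [in leRHS]/P mulmxK.
have finj y y' : O y -> O y' -> `|y' - y| <= 2 * C * `|f y' - f y|.
  move=> Oy Oy'; have := fr y y' Oy Oy'; have := PC (f y' - f y).
  set a := _ *m P; set b := y' - y => aC ab.
  have : `|b| <= `|a| + `|a - b|.
    by rewrite -{1}(subKr a b) (le_trans (ler_normB _ _)).
  by move: aC ab; move: `|a| `|a - b| `|b| `|f y' - f y| => *; lra.
have fsurj x s w : O x -> 0 < s -> (forall z, `|x - z| <= s -> O z) ->
    C * `|f x - w| <= s / 2 -> exists2 z, `|x - z| <= s & f z = w.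
  move=> Ox s0 sO ws.
  have [||z xz kz] :=
    @contraction_fixed_point n x s (fun z => z - (f z - w) *m P) s0.
  - move=> z z' xz xz'.
    have -> : z - (f z - w) *m P - (z' - (f z' - w) *m P) =
        - ((f z - f z') *m P - (z - z')).
      by rewrite !mulmxBl; apply/matrixP => i j; rewrite !mxE; ring.
    by rewrite normrN; apply: fr; exact: sO.
  - by rewrite opprB addrC subrK; exact: le_trans (PC _) ws.
  exists z => //; have : (f z - w) *m P = 0 by rewrite -[LHS](subKr z) kz subrr.
  move/(congr1 (mulmx^~ (jacobian f x0))); rewrite /P mulmxKV // mul0mx.
  by move/subr0_eq.
clear fr PC e0 fr1; clearbody C; clear P f'u.
have ofO : open (f @` O).
  rewrite openE => w [x Ox <-]; rewrite /interior.
  have /nbhs_ballP[s /= s0 sO] : nbhs x O by exact: open_nbhs_nbhs.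
  (* One half replaces the open ball of radius [s] by a closed ball inside it; the other half and
     [C] come from the hypothesis of [fsurj]. *)
  apply/nbhs_ballP; exists (s / 2 / 2 / C); first by rewrite /= !divr_gt0.
  move=> w'; rewrite -ball_normE /= ltr_pdivlMr // mulrC => ww'.
  have [|||z xz <-] := fsurj x (s / 2) w' Ox; last 1 first.
  - exists z => //; apply: sO; rewrite -ball_normE /=.
    by rewrite (le_lt_trans xz) // gtr_pMr // invf_lt1 // ltr1n.
  - by rewrite divr_gt0.
  - move=> z xz; apply: sO; rewrite -ball_normE /=.
    by rewrite (le_lt_trans xz) // gtr_pMr // invf_lt1 // ltr1n.
  - exact: ltW.
pose g w := xget 0 [set z | O z /\ f z = w].
have gP w : (f @` O) w -> O (g w) /\ f (g w) = w.
  move=> [z Oz zw].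
  by have := @xgetPex _ 0 [set z | O z /\ f z = w] (ex_intro _ z (conj Oz zw)).
clearbody g.
have gK x : O x -> g (f x) = x.
  move=> Ox; have [Og fg] := gP (f x) (ex_intro2 _ _ x Ox erefl).
  have := finj x (g (f x)) Ox Og; rewrite fg subrr normr0 mulr0 normr_le0.
  by move/eqP/subr0_eq.
have OA x : O x -> A x by move=> /O1; exact: r1A.
have gdiff w : (f @` O) w -> differentiable g w /\
    'd g w = mulmxr (invmx (jacobian f (g w))) :> (_ -> _).
  move=> fOw; have [Og fg] := gP w fOw; set x := g w in Og fg *.
  apply: diff_epsP => [|e e_gt0]; first exact: linear_rV_continuous.
  set Q := invmx _; pose D := n%:R * `|Q| + 1.
  have D0 : 0 < D by rewrite ltr_wpDl // mulr_ge0.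
  have C20 : 0 < 2 * C by rewrite mulr_gt0.
  (* The factor [2 * C] is the Lipschitz constant of the inverse, by [finj]; [D] bounds right
     multiplication by [Q]. *)
  have e'0 : 0 < e / (D * (2 * C)) by exact: divr_gt0 e_gt0 (mulr_gt0 D0 C20).
  have fdx : differentiable f x by exact/(fS 1).1/OA.
  have /nbhs_ballP[d /= d0 dP] := diff_eps fdx e'0.
  have /nbhs_ballP[d' /= d'0 d'P] : nbhs w (f @` O) by exact: open_nbhs_nbhs.
  apply/nbhs_ballP; exists (Num.min d' (d / (2 * C))).
    by rewrite /= lt_min d'0 divr_gt0 // mulr_gt0.
  move=> k; rewrite -ball_normE /= sub0r normrN lt_min => /andP[kd' kd].
  have [Ogk fgk] : O (g (k + w)) /\ f (g (k + w)) = k + w.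
    by apply: gP; apply: d'P; rewrite -ball_normE /= opprD addrCA subrr addr0 normrN.
  set h := g (k + w) - x.
  have hk : `|h| <= 2 * C * `|k|.
    by have := finj x (g (k + w)) Og Ogk; rewrite fgk fg addrK.
  have := dP h; rewrite -ball_normE /= sub0r normrN subrK fgk fg addrK.
  have hd : `|h| < d.
    by rewrite (le_lt_trans hk) // mulrC -ltr_pdivlMr // mulr_gt0.
  move=> /(_ hd).
  rewrite -deriveE // deriveEjacobian // => kh.
  rewrite -/x -/h.
  have -> : h - k *m Q = - ((k - h *m jacobian f x) *m Q).
    rewrite mulmxBl /Q mulmxK ?opprB //.
    exact: O2.
  rewrite normrN; apply: le_trans (mulmx_norm_le _ _) _.
  rewrite mulrAC; apply: le_trans (_ : D * (e / (D * (2 * C)) * `|h|) <= _).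
    by apply: ler_pM => //; rewrite /D lerDl.
  apply: le_trans (_ : D * (e / (D * (2 * C)) * (2 * C * `|k|)) <= _).
    by rewrite !ler_wpM2l // ltW.
  rewrite le_eqVlt; apply/orP; left; apply/eqP; field.
  by rewrite !gt_eqF.
exists O, g; split => //.
move=> k; apply: (@Ck_inverse k n O _ f) => //.
- by move=> w /gP[].
- by move=> l; apply: Ck_sub OA (fS l).
- by move=> w /gdiff[].
- by move=> w v /gdiff[gdw dE]; rewrite deriveE // dE.
Qed.

End inverse_function.

Lemma ler_dist_half (R : realFieldType) (a b c e : R) :
  `|c - b| <= e / 2 -> `|a - b| <= e / 2 -> `|a - c| <= e.
Proof.
move=> cb ab; rewrite -(subrKA b) (splitr e) (le_trans (ler_normD _ _)) //.
by rewrite lerD // distrC.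
Qed.

Lemma subrACA (R : zmodType) (a b c d : R) :
  a - b - (c - d) = a - c - (b - d).
Proof. by rewrite !opprB addrACA [RHS]addrACA (addrC (- b)). Qed.

(** * Symmetry of second derivatives *)

Section symmetry_of_second_derivatives.
Context {R : realType} {V : normedModType R}.

Lemma is_diff_shift (a q : V) : is_diff q (fun q => q + a) id.
Proof.
have : is_diff q (id + cst a) (id + 0) by exact: is_diffD.
by rewrite addr0.
Qed.

Lemma differentiable_shift (f : V -> R) a q :
  differentiable f (q + a) -> differentiable (fun q => f (q + a)) q.
Proof.
move=> fd; have sd := is_diff_shift a q.
apply: (@differentiable_comp _ _ _ _ (fun q => q + a) f); last exact: fd.
exact: ex_diff.
Qed.

Lemma derive_shift_arg (f : V -> R) a q u :
  differentiable f (q + a) -> 'D_u (fun q => f (q + a)) q = 'D_u f (q + a).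
Proof.
move=> fd; have sd := is_diff_shift a q.
rewrite !deriveE //; last exact: differentiable_shift.
have sdd : differentiable (fun q : V => q + a) q by exact: ex_diff.
have -> : (fun q => f (q + a)) = f \o (fun q => q + a) by [].
by rewrite diff_comp //= (diff_val (is_diff_def := sd)).
Qed.

(** The mean value theorem is used twice: along [u] for the increment of [f] in the direction [v],
    then along [v] for ['D_u f]. *)
Lemma second_difference (A : set V) (f : V -> R) p u v : Ck_on 2 A f ->
  (forall s s' : R, 0 <= s <= 1 -> 0 <= s' <= 1 -> A (p + s *: u + s' *: v)) ->
  exists s s' : R, [/\ 0 <= s <= 1, 0 <= s' <= 1 &
    f (p + u + v) - f (p + u) - (f (p + v) - f p) =
      'D_v (fun q => 'D_u f q) (p + s *: u + s' *: v)].
Proof.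
move=> [fd fC] sA.
have i0 : 0 <= (0 : R) <= 1 by rewrite lexx ler01.
have i1 : 0 <= (1 : R) <= 1 by rewrite lexx ler01.
pose g q := f (q + v) - f q.
have gd s : 0 <= s <= 1 ->
    differentiable g (p + s *: u) /\
    'D_u g (p + s *: u) = 'D_u f (p + s *: u + v) - 'D_u f (p + s *: u).
  move=> s01.
  have fs : differentiable f (p + s *: u).
    by have := fd _ (sA s 0 s01 i0); rewrite scale0r addr0.
  have fsv : differentiable f (p + s *: u + v).
    by have := fd _ (sA s 1 s01 i1); rewrite scale1r.
  have fsv' := differentiable_shift fsv.
  split; first exact: differentiableB.
  rewrite -[in RHS](derive_shift_arg u fsv) deriveB //.
    exact: diff_derivable.
  exact: diff_derivable.
have [s s01 gE] := mean_value_line (fun s s01 => (gd s s01).1).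
have [s' s'01 DE] := @mean_value_line _ _ (fun q => 'D_u f q) (p + s *: u) v
  (fun s' s'01 => (fC u).1 _ (sA s s' s01 s'01)).
exists s, s'; split=> //; rewrite -DE -(gd s s01).2 -gE /g.
by rewrite (addrAC p u v).
Qed.

(** The second difference over a parallelogram is symmetric in its sides. By [second_difference] it
    is [h * h] times each of the two mixed derivatives at some point near [p], and both are
    continuous at [p]. *)
Lemma derive_comm (A : set V) (f : V -> R) p u v : open A -> A p ->
  Ck_on 2 A f ->
  'D_u (fun q => 'D_v f q) p = 'D_v (fun q => 'D_u f q) p.
Proof.
move=> oA Ap f2; have [fd fC] := f2.
apply/eqP; rewrite -subr_eq0 -normr_le0; apply/ler_addgt0Pl => e e0.
rewrite addr0; have e20 : 0 < e / 2 by rewrite divr_gt0.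
have near_p (w w' : V) : \forall q \near p,
    `|'D_w (fun q => 'D_w' f q) p - 'D_w (fun q => 'D_w' f q) q| <= e / 2.
  have c : {for p, continuous (fun q => 'D_w (fun q => 'D_w' f q) q)}.
    exact: (fC w').2.
  have c' : (fun q => 'D_w (fun q => 'D_w' f q) q) @ p -->
    'D_w (fun q => 'D_w' f q) p by exact: c.
  by move/cvgrPdist_le : c' => /(_ _ e20).
have nA : \forall q \near p, A q by exact: open_nbhs_nbhs.
have nAp : \forall q \near p, A q /\
  (`|'D_u (fun q => 'D_v f q) p - 'D_u (fun q => 'D_v f q) q| <= e / 2 /\
   `|'D_v (fun q => 'D_u f q) p - 'D_v (fun q => 'D_u f q) q| <= e / 2).
  by apply: filterS3 nA (near_p u v) (near_p v u) => q.
have /nbhs_normP[r /= r0 rP] := nAp.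
(* The parallelogram with sides [h *: u] and [h *: v] has to fit into the ball of radius [r]; the
   [+ 1] covers [u = v = 0]. *)
have [h h0 hr0] : exists2 h, 0 < h & h * `|u| + h * `|v| < r.
  have n0 : 0 < `|u| + `|v| + 1 by rewrite ltr_wpDl // addr_ge0.
  exists (r / (`|u| + `|v| + 1)); first by rewrite divr_gt0.
  rewrite -mulrDr -mulrA gtr_pMr // mulrC ltr_pdivrMr // mul1r.
  by rewrite ltrDl.
have hr (s s' : R) : 0 <= s <= 1 -> 0 <= s' <= 1 ->
    `|p - (p + s *: (h *: u) + s' *: (h *: v))| < r.
  move=> /andP[s0 s1] /andP[s'0 s'1]; rewrite -addrA opprD addrA.
  rewrite subrr sub0r normrN (le_lt_trans (ler_normD _ _)) // !normrZ.
  rewrite (ger0_norm s0) (ger0_norm s'0) (gtr0_norm h0).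
  apply: le_lt_trans hr0.
  by apply: lerD; apply: ler_piMl => //; rewrite mulr_ge0 // ltW.
have DZ (w w' : V) (a : R) q : A q ->
    'D_(a *: w) (fun q => 'D_(a *: w') f q) q =
    a * a * 'D_w (fun q => 'D_w' f q) q.
  move=> Aq.
  have -> : 'D_(a *: w) (fun q => 'D_(a *: w') f q) q =
      'D_(a *: w) (fun q => a *: 'D_w' f q) q.
    apply: near_eq_derive; apply: filterS (open_nbhs_nbhs (conj oA Aq)) => z Az.
    by rewrite !deriveE ?linearZ //; exact: fd.
  have fd' := (fC w').1 q Aq.
  rewrite deriveZ; last exact: diff_derivable.
  by rewrite !deriveE // linearZ -mulrA.
have [s [s' [s01 s'01 E1]]] := second_difference f2
  (fun s s' s01 s'01 => (rP _ (hr s s' s01 s'01)).1).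
have hr' (s1 s1' : R) : 0 <= s1 <= 1 -> 0 <= s1' <= 1 ->
    `|p - (p + s1 *: (h *: v) + s1' *: (h *: u))| < r.
  by move=> s101 s1'01; rewrite (addrAC p); exact: hr.
have [t [t' [t01 t'01 E2]]] := second_difference f2
  (fun s s' s01 s'01 => (rP _ (hr' s s' s01 s'01)).1).
have [Aq [_ q1]] := rP _ (hr _ _ s01 s'01).
have [Aq' [q2 _]] := rP _ (hr' _ _ t01 t'01).
have h2 : h * h != 0 by rewrite mulf_neq0 // gt_eqF.
rewrite (DZ v u h _ Aq) in E1; rewrite (DZ u v h _ Aq') (addrAC p (h *: v)) in E2.
have E : 'D_v (fun q => 'D_u f q) (p + s *: (h *: u) + s' *: (h *: v)) =
    'D_u (fun q => 'D_v f q) (p + t *: (h *: v) + t' *: (h *: u)).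
  by apply: (mulfI h2); exact: etrans (etrans (esym E1) (subrACA _ _ _ _)) E2.
rewrite E in q1.
exact: ler_dist_half q1 q2.
Qed.

End symmetry_of_second_derivatives.

(** * Antiderivatives and the mean value inequality for curves *)

Section antiderivative.
Context {R : realType}.

Lemma derive_le_increment (g dg : R -> R) (a b : R) : a <= b ->
  (forall t : R, a <= t <= b -> is_derive t 1 g (dg t)) ->
  exists2 t, a <= t <= b & g b - g a = dg t * (b - a).
Proof.
move=> ab gd.
have [|||t + gE] := @MVT_segment R g dg a b => //.
- by move=> t; rewrite in_itv /= => /andP[at_ tb]; apply: gd; rewrite !ltW.
- apply: derivable_within_continuous => t; rewrite in_itv /= => tab.
  by have [] := gd t tab.
by rewrite in_itv /= => tab; exists t.
Qed.

Lemma antiderivative_local (g : R -> R) (N : R) : continuous g -> 0 < N ->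
  exists2 G : R -> R, G 0 = 0 & forall t : R, `|t| < N -> is_derive t 1 G (g t).
Proof.
move=> gc N0.
have [G GP] : exists G : R -> R,
    forall t : R, `|t| < N -> is_derive t 1 G (g t).
  exists (fun x => \int[lebesgue_measure]_(t in `[- N, x]) g t)%R => t.
  rewrite ltr_norml => /andP[Nt tN].
  have gi : lebesgue_measure.-integrable `[- N, N] (EFin \o g).
    apply: continuous_compact_integrable; first exact: segment_compact.
    exact: continuous_subspaceT.
  have [dG G'] := continuous_FTC1_closed tN gi Nt (gc t).
  apply: DeriveDef; first exact: dG.
  by rewrite -derive1E; exact: G'.
exists (fun t => G t - G 0); first by rewrite subrr.
move=> t /GP Gt; rewrite -[g t]subr0.
exact: is_deriveB.
Qed.

(** Antiderivatives on growing intervals, all vanishing at 0, agree wherever both are defined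
    because their difference has zero derivative; hence they glue to one on the whole line. *)
Lemma antiderivative (g : R -> R) : continuous g ->
  exists2 G : R -> R, G 0 = 0 & forall t : R, is_derive t 1 G (g t).
Proof.
move=> gc; have /choice[G GP] : forall k : nat, exists G : R -> R,
    G 0 = 0 /\ forall t : R, `|t| < k.+1%:R -> is_derive t 1 G (g t).
  move=> k; have [|G G0 GP] := antiderivative_local (N := k.+1%:R) gc => //.
  by exists G.
have G_le k l t : (k <= l)%N -> `|t| < k.+1%:R -> G k t = G l t.
  move=> kl tk; have kl' : k.+1%:R <= l.+1%:R :> R by rewrite ler_nat.
  pose H s := G k s - G l s.
  have H0 : H 0 = 0 by rewrite /H (GP k).1 (GP l).1 subrr.
  have Hd (s : R) : `|s| < k.+1%:R -> is_derive s 1 H ((fun=> 0) s).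
    move=> sk; have Gk := (GP k).2 s sk.
    have Gl := (GP l).2 s (lt_le_trans sk kl').
    by rewrite -(subrr (g s)); exact: is_deriveB.
  apply/eqP; rewrite -subr_eq0 -/(H t) -[H t]subr0 -[X in _ - X]H0.
  have [t0|t0] := leP 0 t.
    have Hs (s : R) : 0 <= s <= t -> is_derive s 1 H ((fun=> 0) s).
      move=> /andP[s0 st]; apply: Hd; rewrite ger0_norm // (le_lt_trans st) //.
      by rewrite -[t]ger0_norm.
    by have [s _ ->] := derive_le_increment t0 Hs; rewrite mul0r.
  rewrite -opprB oppr_eq0.
  have Hs (s : R) : t <= s <= 0 -> is_derive s 1 H ((fun=> 0) s).
    move=> /andP[ts s0]; apply: Hd; rewrite ler0_norm // (le_lt_trans _ tk) //.
    by rewrite ltr0_norm // lerN2.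
  by have [s _ ->] := derive_le_increment (ltW t0) Hs; rewrite mul0r.
pose k t := Num.truncn `|t : R|.
have kP t : `|t| < (k t).+1%:R by exact: truncnS_gt.
clearbody k.
exists (fun t => G (k t) t); first exact: (GP _).1.
move=> t.
have t1 : `|t| < (k t).+2%:R by rewrite (lt_le_trans (kP t)) // ler_nat.
apply: near_eq_is_derive ((GP (k t).+1).2 t t1).
have : \forall s \near t, `|s| < (k t).+1%:R.
  have nc : (fun s : R => `|s|) @ t --> `|t| by exact: norm_continuous.
  exact: (cvgr_lt _ nc).
apply: filterS => s sk; have [ks|ks] := leqP (k s) (k t).+1.
  by rewrite (G_le _ _ _ ks).
have sk' : `|s| < (k t).+2%:R by apply: lt_le_trans sk _; rewrite ler_nat.
exact: G_le (ltnW ks) sk'.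
Qed.

Lemma is_derive_rV n (u : R -> 'rV[R]_n) (t : R) du :
  is_derive t 1 u du <-> forall i, is_derive t 1 (fun s => u s 0 i) (du 0 i).
Proof.
split=> [[ud uE] i|ud].
  apply: DeriveDef; first exact: (derivable_mxP _ _ _).1.
  by rewrite -uE derive_mx // mxE.
have udd : derivable u t 1.
  by apply/derivable_mxP => i j; rewrite ord1; have [] := ud j.
apply: DeriveDef => //; rewrite derive_mx //.
by apply/matrixP => i j; rewrite mxE ord1; have [_ ->] := ud j.
Qed.

Lemma antiderivative_rV n (u : R -> 'rV[R]_n) x0 : continuous u ->
  exists2 G, G 0 = x0 & forall t : R, is_derive t 1 G (u t).
Proof.
move=> uc; have /choice[G GP] : forall i, exists G : R -> R,
    G 0 = 0 /\ forall t : R, is_derive t 1 G (u t 0 i).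
  move=> i; have [|G G0 GP] := @antiderivative (fun t => u t 0 i).
    move=> t; apply: (@continuous_comp _ _ _ u (fun v : 'rV_n => v 0 i)).
      exact: uc.
    exact: coord_continuous.
  by exists G.
exists (fun t => x0 + \row_i G i t).
  by apply/rowP => i; rewrite !mxE (GP i).1 addr0.
move=> t; apply/is_derive_rV => i.
have -> : (fun s => (x0 + \row_j G j s) 0 i) = cst (x0 0 i) \+ G i.
  by apply/funext => s; rewrite !mxE.
have Gi := (GP i).2 t; rewrite -[u t 0 i]add0r.
exact: is_deriveD.
Qed.

(** For each coordinate of [u], its sum with [g] and its difference from [g] have nonnegative
    derivatives. This replaces the mean value equality, which fails for vector values. *)
Lemma norm_le_of_derive n (u du : R -> 'rV[R]_n) (g dg : R -> R) a b : a <= b ->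
  (forall t : R, a <= t <= b -> is_derive t 1 u (du t)) ->
  (forall t : R, a <= t <= b -> is_derive t 1 g (dg t)) ->
  (forall t, a <= t <= b -> `|du t| <= dg t) ->
  `|u b - u a| <= g b - g a.
Proof.
move=> ab ud gd udg.
have dg0 t : a <= t <= b -> 0 <= dg t by move=> /udg; exact: le_trans.
apply: mx_norm_le => [|i j].
  have [t tab ->] := derive_le_increment ab gd.
  by rewrite mulr_ge0 ?subr_ge0 // dg0.
rewrite !mxE ord1.
have ujd (t : R) : a <= t <= b -> is_derive t 1 (fun s => u s 0 j) (du t 0 j).
  by move=> /ud /is_derive_rV.
rewrite ler_norml; apply/andP; split.
  have [t tab|t tab] := @derive_le_increment (g \+ (fun s => u s 0 j))
    (fun t => dg t + du t 0 j) a b ab.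
    by have ? := gd t tab; have ? := ujd t tab; exact: is_deriveD.
  move=> E; suff : 0 <= (dg t + du t 0 j) * (b - a) by rewrite -E /=; lra.
  rewrite mulr_ge0 ?subr_ge0 // -lerBlDl sub0r lerNl.
  rewrite (le_trans _ (udg t tab)) // (le_trans _ (mx_entry_le _ 0 j)) //.
  by rewrite -normrN ler_norm.
have [t tab|t tab] := @derive_le_increment (g \- (fun s => u s 0 j))
  (fun t => dg t - du t 0 j) a b ab.
  by have ? := gd t tab; have ? := ujd t tab; exact: is_deriveB.
move=> E; suff : 0 <= (dg t - du t 0 j) * (b - a) by rewrite -E /=; lra.
rewrite mulr_ge0 ?subr_ge0 // (le_trans _ (udg t tab)) //.
by rewrite (le_trans _ (mx_entry_le _ 0 j)) // ler_norm.
Qed.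

End antiderivative.

(** * Gronwall and Picard *)

Section gronwall.
Context {R : realType}.

(** The sup norm is not differentiable along a curve; the Gronwall argument differentiates the
    Euclidean square and converts with these bounds. *)
Lemma sum_sqr_bounds n (u : 'rV[R]_n) :
  `|u| ^+ 2 <= \sum_i u 0 i ^+ 2 /\ \sum_i u 0 i ^+ 2 <= n%:R * `|u| ^+ 2.
Proof.
have S0 : 0 <= \sum_i u 0 i ^+ 2 by apply: sumr_ge0 => i _; exact: sqr_ge0.
split.
  have [u0|/mx_norm_neq0[[i j] /= uE]] := eqVneq (mx_norm u) 0.
    by rewrite /Num.norm /= u0 expr0n.
  rewrite /Num.norm /= uE real_normK ?num_real // ord1 (bigD1 j) //=.
  by rewrite lerDl sumr_ge0 // => k _; exact: sqr_ge0.
apply: le_trans (_ : \sum_(i < n) `|u| ^+ 2 <= _).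
  apply: ler_sum => i _; rewrite -real_normK ?num_real //.
  by rewrite lerXn2r ?nnegrE // mx_entry_le.
by rewrite sumr_const card_ord mulr_natl.
Qed.

(* The function (|u|_2^2 + c^2) e^(-B t) is nonincreasing for B large. *)
Lemma gronwall n (L : R) : 0 <= L -> exists2 K, 0 < K &
  forall (u du : R -> 'rV[R]_n) b c, 0 <= b <= 1 -> 0 <= c ->
  (forall t : R, 0 <= t <= b -> is_derive t 1 u (du t)) ->
  (forall t, 0 <= t <= b -> `|du t| <= L * `|u t| + c) ->
  `|u b| <= K * (`|u 0| + c).
Proof.
move=> L0; pose N : R := n%:R; have N0 : 0 <= N by [].
(* Since [2 |u| c <= |u|^2 + c^2], the derivative of the Euclidean square is at most [2 N L + N]
   times that square plus [c^2]. The last 1 makes [B] positive. *)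
pose B := 2 * N * L + N + 1.
have B0 : 0 < B by rewrite /B ltr_wpDl // addr_ge0 // mulr_ge0 // mulr_ge0.
(* [expR B] undoes the weight on the unit interval, and [N + 1] absorbs [N |u 0|^2 + c^2] into a
   multiple of [(|u 0| + c)^2]. The estimate concerns squares; [1 <= K] permits passing from [K] to
   [K^2] before taking roots. *)
pose K := expR B * (N + 1).
have K1 : 1 <= K.
  by rewrite /K mulr_ege1 ?lerDr // -expR0 ler_expR ltW.
exists K => [|u du b c /andP[b0 b1] c0 ud duL].
  exact: lt_le_trans K1.
pose S t := \sum_i u t 0 i ^+ 2.
pose h t := (S t + c ^+ 2) * expR (- B * t).
pose dS t := \sum_i 2 * u t 0 i * du t 0 i.
have Sd (t : R) : 0 <= t <= b -> is_derive t 1 S (dS t).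
  move=> tb; have /is_derive_rV uid := ud t tb.
  have -> : S = \sum_(i < n) (fun s => u s 0 i ^+ 2).
    by apply/funext => s; rewrite fct_sumE.
  apply: (@is_derive_sum _ _ _ _ (fun i s => u s 0 i ^+ 2) t 1) => i.
  have ui := uid i.
  have := @is_deriveX _ _ (fun s => u s 0 i) 2 t 1 _ ui.
  by rewrite expr1.
have Ed (t : R) : is_derive t 1 (fun t => expR (- B * t)) (- B * expR (- B * t)).
  have ld : is_derive t 1 (fun t => - B * t) (- B).
    have := @is_deriveZ _ _ _ id (- B) t 1 1 (is_derive_id t 1).
    by rewrite [_ *: 1]mulr1.
  by rewrite mulrC; apply: (@is_derive1_comp _ expR (fun t => - B * t)); exact: is_derive_expR.
have hd (t : R) : 0 <= t <= b ->
    is_derive t 1 h ((dS t - B * (S t + c ^+ 2)) * expR (- B * t)).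
  move=> tb; have Sdt := Sd t tb.
  have Scd : is_derive t 1 (fun t => S t + c ^+ 2) (dS t).
    by rewrite -[dS t]addr0; exact: is_deriveD.
  have hE := @is_deriveM _ _ _ _ t 1 _ _ Scd (Ed t).
  rewrite (_ : _ * expR _ = (S t + c ^+ 2) *: (- B * expR (- B * t)) +
    expR (- B * t) *: dS t); first exact: hE.
  rewrite /GRing.scale /=; ring.
have [t tb hE] := derive_le_increment b0 hd.
have : h b - h 0 <= 0.
  rewrite hE subr0 mulr_le0_ge0 // mulr_le0_ge0 ?expR_ge0 // subr_le0.
  have [uS _] := sum_sqr_bounds (u t).
  apply: le_trans (_ : 2 * N * (`|u t| * (L * `|u t| + c)) <= _).
    apply: le_trans (_ : \sum_(i < n) 2 * (`|u t| * (L * `|u t| + c)) <= _).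
      apply: ler_sum => i _; rewrite -mulrA ler_pM2l //.
      rewrite (le_trans (ler_norm _)) // normrM ler_pM ?mx_entry_le //.
      by rewrite (le_trans (mx_entry_le _ _ _)) // duL.
    by rewrite sumr_const card_ord -(mulr_natl _ n) mulrCA mulrA.
  have uc : 2 * (`|u t| * c) <= `|u t| ^+ 2 + c ^+ 2.
    by have := sqr_ge0 (`|u t| - c); rewrite sqrrB -(mulr_natl _ 2); lra.
  have c2 := sqr_ge0 c.
  apply: le_trans (_ : 2 * N * L * (S t + c ^+ 2) + N * (S t + c ^+ 2) +
    (S t + c ^+ 2) <= _); last by rewrite /B (mulrDl (_ + N)) (mulrDl _ N) mul1r.
  have q0 : 0 <= S t + c ^+ 2 by rewrite addr_ge0 // (le_trans _ uS).
  apply: ler_wpDr => //.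
  have -> : 2 * N * (`|u t| * (L * `|u t| + c)) =
    2 * N * L * `|u t| ^+ 2 + N * (2 * (`|u t| * c)) by ring.
  apply: lerD; rewrite ler_wpM2l //.
  - by rewrite !mulr_ge0.
  - by rewrite (le_trans uS) // lerDl.
  - by rewrite (le_trans uc) // lerD2r.
rewrite subr_le0 /h mulr0 expR0 mulr1 => hb.
have [uSb _] := sum_sqr_bounds (u b); have [_ uS0] := sum_sqr_bounds (u 0).
have c2 := sqr_ge0 c.
have Sb : S b + c ^+ 2 <= expR B * (S 0 + c ^+ 2).
  move: hb; rewrite mulNr expRN ler_pdivrMr ?expR_gt0 // mulrC => /le_trans -> //.
  rewrite ler_wpM2r ?ler_expR //.
    by rewrite addr_ge0 // sumr_ge0 // => i _; exact: sqr_ge0.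
  by rewrite ger_pMr.
have uc0 : 0 <= `|u 0| + c by rewrite addr_ge0.
rewrite -(@ler_pXn2r _ 2) ?nnegrE //; last first.
  by rewrite mulr_ge0 // (le_trans _ K1).
apply: le_trans (_ : K * (`|u 0| + c) ^+ 2 <= _); last first.
  rewrite exprMn ler_wpM2r ?sqr_ge0 // expr2.
  by rewrite ler_peMl // (le_trans _ K1).
apply: le_trans uSb _; apply: le_trans (_ : S b + c ^+ 2 <= _); first by rewrite lerDl.
apply: le_trans Sb _; rewrite /K -mulrA ler_wpM2l ?expR_ge0 //.
apply: le_trans (_ : N * `|u 0| ^+ 2 + c ^+ 2 <= _); first by rewrite lerD2r.
rewrite mulrDl mul1r sqrrD; apply: lerD.
  by rewrite ler_wpM2l // -addrA lerDl addr_ge0 // mulrn_wge0 // mulr_ge0.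
by rewrite lerDr addr_ge0 ?sqr_ge0 // mulrn_wge0 // mulr_ge0.
Qed.

End gronwall.

Section picard.
Context {R : realType}.

(* Weighting by exp (2 L |t|) makes the Picard operator a contraction by 1/2 on
   the whole real line at once. *)
Lemma picard_weight n (L c : R) (u du : R -> 'rV[R]_n) : 0 < L -> 0 <= c ->
  u 0 = 0 -> (forall t : R, is_derive t 1 u (du t)) ->
  (forall t, `|du t| <= L * (c * expR (2 * L * `|t|))) ->
  forall t, `|u t| <= c / 2 * expR (2 * L * `|t|).
Proof.
move=> L0 c0 u0 ud duc t.
(* [g s] is a primitive of the bound on [du]; the signs [s = 1] and [s = -1] treat the two
   directions of time. *)
pose g (s t : R) := s * (c / 2 * expR (2 * L * (s * t))).
have gd s (r : R) : s * s = 1 ->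
    is_derive r 1 (g s) (L * (c * expR (2 * L * (s * r)))).
  move=> ss.
  have ld : is_derive r 1 (fun r => 2 * L * (s * r)) (2 * L * s).
    have := @is_deriveZ _ _ _ id (2 * L * s) r 1 1 (is_derive_id r 1).
    rewrite [_ *: 1]mulr1.
    have -> : (fun r => 2 * L * (s * r)) = (2 * L * s) \*: id :> (R -> R).
      by apply/funext => x /=; rewrite mulrA.
    by [].
  have Ed := @is_derive1_comp _ expR (fun r => 2 * L * (s * r)) r _ _
    (is_derive_expR _) ld.
  have := @is_deriveZ _ _ _ _ (s * (c / 2)) r 1 _ Ed.
  have -> : (s * (c / 2)) *: (expR (2 * L * (s * r)) * (2 * L * s)) =
      L * (c * expR (2 * L * (s * r))) :> R.
    rewrite /GRing.scale /=.
    transitivity (s * s * (L * (c * expR (2 * L * (s * r))))); last by rewrite ss mul1r.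
    by field.
  have -> : g s = (s * (c / 2)) \*: (expR \o (fun r => 2 * L * (s * r))).
    by apply/funext => x /=; rewrite /g mulrA.
  by [].
have [t0|/ltW t0] := leP 0 t.
  have dub r : 0 <= r <= t -> `|du r| <= L * (c * expR (2 * L * (1 * r))).
    by move=> /andP[r0 _]; rewrite mul1r -{2}(ger0_norm r0).
  have := norm_le_of_derive t0 (fun r _ => ud r)
    (fun r _ => gd 1 r (mulr1 1)) dub.
  rewrite u0 subr0 /g !mul1r mulr0 expR0 mulr1 ger0_norm // => H.
  by apply: le_trans H _; rewrite gerBl divr_ge0.
have ss : (-1 : R) * -1 = 1 by rewrite mulrNN mulr1.
have dub r : t <= r <= 0 -> `|du r| <= L * (c * expR (2 * L * (-1 * r))).
  by move=> /andP[_ r0]; rewrite mulN1r -(ler0_norm r0).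
have := norm_le_of_derive t0 (fun r _ => ud r) (fun r _ => gd (-1) r ss) dub.
rewrite u0 sub0r normrN /g !mulN1r oppr0 mulr0 expR0 mulr1 ler0_norm // => H.
by apply: le_trans H _; rewrite opprK addrC gerBl divr_ge0.
Qed.

Lemma is_derive_continuous n (u : R -> 'rV[R]_n) (t : R) du :
  is_derive t 1 u du -> {for t, continuous u}.
Proof. by case=> /derivable1_diffP ud _; exact: differentiable_continuous. Qed.

Lemma half_pow_small (e : R) : 0 < e -> exists k : nat, 2^-1 ^+ k < e.
Proof.
move=> e0; have [k _ kP] := near_infty_natSinv_expn_lt (PosNum e0).
by exists k; have := kP k (leqnn k); rewrite /= div1r exprVn.
Qed.

(** Consecutive Picard iterates differ by at most [M * 2^-k] times the weight. They converge
    pointwise, and uniformly for bounded times, so the limit is continuous and a further Picard step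
    can be applied to it. The bound on [F t x0] controls the first step. *)
Theorem picard_global n (F : R -> 'rV[R]_n -> 'rV[R]_n) (L : R) x0 :
  (forall u, continuous u -> continuous (fun t => F t (u t))) ->
  (forall t u v, `|F t u - F t v| <= L * `|u - v|) ->
  (exists M, forall t, `|F t x0| <= M) ->
  exists u : R -> 'rV[R]_n, u 0 = x0 /\
    forall t : R, is_derive t 1 u (F t (u t)).
Proof.
move=> Fc FL' [M' FM'].
(* A Lipschitz constant that is at least 1 also puts the bound on [F t x0] into the weighted form
   required by [picard_weight]. *)
pose L1 : R := `|L| + 1; have L0 : 0 < L1 by rewrite ltr_wpDl.
have FL t u v : `|F t u - F t v| <= L1 * `|u - v|.
  by rewrite (le_trans (FL' _ _ _)) // ler_wpM2r // (le_trans (ler_norm _)) // lerDl.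
pose M : R := `|M'|.
have M0 : 0 <= M by rewrite /M; exact: normr_ge0.
have FM t : `|F t x0| <= L1 * (M * expR (2 * L1 * `|t|)).
  rewrite (le_trans (FM' t)) // (le_trans (ler_norm M')) // mulrCA ler_peMr //.
  have L11 : 1 <= L1 by rewrite /L1 lerDr.
  rewrite mulr_ege1 // -expR0 ler_expR; apply: mulr_ge0 => //.
  by apply: mulr_ge0 => //; exact: ltW.
clearbody L1 M.
pose W (t : R) := expR (2 * L1 * `|t|).
have W0 t : 0 < W t by exact: expR_gt0.
have /choice[step stepP] : forall u : R -> 'rV[R]_n, exists G : R -> 'rV[R]_n,
    continuous u -> G 0 = x0 /\ forall t : R, is_derive t 1 G (F t (u t)).
  move=> u; have [uc|nuc] := pselect (continuous u); last by exists u.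
  by have [G G0 Gd] := antiderivative_rV x0 (Fc u uc); exists G.
pose v k := iter k step (fun=> x0).
have vc k : continuous (v k).
  elim: k => [|k IH]; first by move=> t; exact: cst_continuous.
  by move=> t; apply: is_derive_continuous ((stepP _ IH).2 t).
have v0 k : v k 0 = x0 by case: k => // k; exact: (stepP _ (vc k)).1.
have vd k (t : R) : is_derive t 1 (v k.+1) (F t (v k t)).
  exact: (stepP _ (vc k)).2.
have contr (u w : R -> 'rV[R]_n) (u' w' : R -> 'rV[R]_n) c : 0 <= c ->
    u 0 = x0 -> w 0 = x0 ->
    (forall t : R, is_derive t 1 u (F t (u' t))) ->
    (forall t : R, is_derive t 1 w (F t (w' t))) ->
    (forall t, `|u' t - w' t| <= c * W t) ->
    forall t, `|u t - w t| <= c / 2 * W t.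
  move=> c0 u0 w0 ud wd uwc t.
  apply: (@picard_weight n L1 c (u \- w) (fun t => F t (u' t) - F t (w' t))) => //.
  - by rewrite /= u0 w0 subrr.
  - by move=> s; rewrite (le_trans (FL _ _ _)) // ler_pM2l.
have vS k t : `|v k.+1 t - v k t| <= M * 2^-1 ^+ k * W t.
  elim: k t => [|k IH] t; last first.
    rewrite exprSr mulrA; apply: (contr _ _ (v k.+1) (v k)) => //.
    by rewrite mulr_ge0 // exprn_ge0 // invr_ge0.
  rewrite expr0 mulr1 (le_trans (_ : _ <= M / 2 * W t)) //.
    apply: (@picard_weight n L1 M (v 1 \- v 0) (fun t => F t x0)) => //.
      by rewrite -[LHS]/(v 1%N 0 - x0) v0 subrr.
    move=> s; have v1 := vd 0 s; rewrite -[F s x0]subr0.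
    exact: (@is_deriveB _ _ _ (v 1) (v 0) s 1 _ _ v1 (is_derive_cst x0 s 1)).
  by rewrite ler_wpM2r ?(ltW (W0 t)) // ler_pdivrMr // ler_peMr // ler1n.
have vD k j t : `|v (k + j)%N t - v k t| <= 2 * M * (2^-1 ^+ k - 2^-1 ^+ (k + j)) * W t.
  elim: j => [|j IH]; first by rewrite addn0 !subrr normr0 mulr0 mul0r.
  rewrite addnS -(subrKA (v (k + j)%N t)) (le_trans (ler_normD _ _)) //.
  apply: le_trans (lerD (vS (k + j)%N t) IH) _.
  rewrite -mulrDl ler_wpM2r ?(ltW (W0 t)) // (exprS _ (k + j)).
  by rewrite le_eqVlt; apply/orP; left; apply/eqP; field.
have vC k j t : (k <= j)%N -> `|v j t - v k t| <= 2 * M * 2^-1 ^+ k * W t.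
  move=> /subnKC <-; rewrite (le_trans (vD _ _ _)) // ler_wpM2r ?(ltW (W0 t)) //.
  by rewrite ler_wpM2l ?mulr_ge0 // gerBl exprn_ge0 // invr_ge0.
have small (C e : R) : 0 < e -> exists k : nat, C * 2^-1 ^+ k < e.
  move=> e0; have C0 : 0 < `|C| + 1 by rewrite ltr_wpDl.
  have [k kP] := half_pow_small (divr_gt0 e0 C0); exists k.
  move: kP; rewrite ltr_pdivlMr // mulrC; apply: le_lt_trans.
  rewrite ler_wpM2r ?exprn_ge0 ?invr_ge0 //.
  by rewrite (le_trans (ler_norm C)) // lerDl.
have vlim t : cvg (v k t @[k --> \oo]).
  apply: cauchy_cvg; apply: cauchy_exP => e e0.
  have [k kP] := small (2 * M * W t) e e0.
  exists (v k t); exists k => // j /= kj.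
  rewrite -ball_normE /= distrC (le_lt_trans (vC _ _ t kj)) //.
  by rewrite mulrAC.
pose u t := lim (v k t @[k --> \oo]).
have uv k t : `|u t - v k t| <= 2 * M * 2^-1 ^+ k * W t.
  apply/ler_addgt0Pr => e e0.
  have /cvgrPdist_lt /(_ e e0) [N _ NP] := vlim t.
  have := NP (maxn N k) (leq_maxl _ _); rewrite -/(u t) => uN.
  rewrite -(subrKA (v (maxn N k) t)) (le_trans (ler_normD _ _)) // addrC.
  by rewrite lerD // ?(ltW uN) // vC // leq_maxr.
have uc : continuous u.
  move=> t; apply/cvgrPdist_lt => e e0.
  have e3 : 0 < e / 3 by rewrite divr_gt0.
  have [k kP] := small (2 * M * expR (2 * L1 * (`|t| + 1))) (e / 3) e3.
  have ub s : `|s| <= `|t| + 1 -> `|u s - v k s| < e / 3.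
    move=> st; apply: le_lt_trans (uv k s) _; apply: le_lt_trans kP.
    rewrite [leRHS]mulrAC ler_wpM2l ?mulr_ge0 ?exprn_ge0 ?invr_ge0 //.
    by rewrite ler_expR ler_wpM2l // mulr_ge0 // ltW.
  have := vc k t; rewrite /continuous_at => /cvgrPdist_lt /(_ _ e3).
  have : \forall s \near t, `|s| < `|t| + 1.
    have nc : (fun s : R => `|s|) @ t --> `|t| by exact: norm_continuous.
    by apply: (cvgr_lt _ nc); rewrite ltrDl.
  apply: filterS2 => s /ltW st vts.
  have -> : u t - u s = (u t - v k t) + (v k t - v k s) - (u s - v k s).
    by apply/rowP => i; rewrite !mxE; ring.
  have -> : e = e / 3 + e / 3 + e / 3 by field.
  rewrite (le_lt_trans (ler_normB _ _)) // ltrD ?ub //.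
  by rewrite (le_lt_trans (ler_normD _ _)) // ltrD ?ub // lerDl.
have [G0 Gd] := stepP _ uc.
(* For every [k], both [step u] and [u] are within a multiple of [2^-k * W] of the iterate
   [v k.+1]. *)
suff E : step u = u by exists u; rewrite E in G0 Gd.
apply/funext => t; apply/eqP; rewrite -subr_eq0 -normr_le0.
apply/ler_addgt0Pr => e e0; rewrite add0r.
have [k kP] := small (2 * M * W t) e e0.
apply: le_trans (ltW kP).
have c0 : 0 <= 2 * M * 2^-1 ^+ k.
  by rewrite mulr_ge0 ?mulr_ge0 // exprn_ge0 // invr_ge0.
have Gv := contr _ _ u (v k) _ c0 G0 (v0 k.+1) Gd (vd k) (uv k) t.
rewrite -(subrKA (v k.+1 t)) (le_trans (ler_normD _ _)) //.
rewrite (distrC (v k.+1 t)) (le_trans (lerD Gv (uv k.+1 t))) // -mulrDl exprSr.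
by rewrite le_eqVlt; apply/orP; left; apply/eqP; field.
Qed.

End picard.

(** * Smooth dependence of flows on the initial point *)

Section real_induction.
Context {R : realType}.

(** Consider the supremum of the times up to which [P] holds throughout. The closure hypothesis
    gives [P] at the supremum, and the extension hypothesis passes beyond it unless it is 1. *)
Lemma real_induction (P : R -> Prop) : P 0 ->
  (forall t, 0 <= t < 1 -> (forall s, 0 <= s <= t -> P s) ->
     exists2 e, 0 < e & forall s, t <= s < t + e -> P s) ->
  (forall t, 0 < t <= 1 -> (forall s, 0 <= s < t -> P s) -> P t) ->
  forall t, 0 <= t <= 1 -> P t.
Proof.
move=> P0 Pext Pcl.
pose S := [set t : R | 0 <= t <= 1 /\ forall s, 0 <= s <= t -> P s].
have S0 : S 0.
  split; first by rewrite lexx ler01.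
  by move=> s; rewrite -eq_le => /eqP <-.
have Sub : ubound S 1 by move=> t [/andP[]].
have hS : has_sup S by split; [exists 0|exists 1].
pose m := sup S.
have m0 : 0 <= m by exact: (ub_le_sup hS.2).
have m1 : m <= 1 by apply: ge_sup => //; exists 0.
have Pm s : 0 <= s < m -> P s.
  rewrite -(subr_gt0 s) => /andP[s0 sm].
  have [t [_ tP] st] := sup_adherent sm hS.
  by apply: tP; rewrite s0 ltW // -(subKr m s).
have Pmm s : 0 <= s <= m -> P s.
  move=> /andP[s0]; rewrite le_eqVlt => /predU1P[->|sm].
    have [m_gt0|] := ltP 0 m; first by apply: Pcl Pm; rewrite m_gt0.
    by move=> m_le0; rewrite (_ : m = 0) //; apply/eqP; rewrite eq_le m_le0.
  by apply: Pm; rewrite s0.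
suff -> : 1 = m by [].
apply/eqP; rewrite eq_le m1 andbT leNgt; apply/negP => m_lt1.
have [|e e0 eP] := Pext m _ Pmm; first by rewrite m0.
pose s := Num.min 1 (m + e / 2).
have ms : m < s by rewrite /s lt_min m_lt1 ltrDl divr_gt0.
have : S s.
  split; first by rewrite (ltW (le_lt_trans m0 ms)) /s ge_min lexx.
  move=> r /andP[r0 rs]; have [rm|mr] := leP r m; first by apply: Pmm; rewrite r0.
  apply: eP; rewrite (ltW mr) (le_lt_trans rs) // /s gt_min ltrD2l.
  by rewrite gtr_pMr // invf_lt1 // ltr1n orbT.
by move/(ub_le_sup hS.2); rewrite leNgt ms.
Qed.

End real_induction.

Section flow_families.
Context {R : realType}.

(** Only the time-one map is differentiated; other times are reached by rescaling the field. The
    margin [eta] makes the derivatives at times 0 and 1 two-sided and leaves room to shrink when the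
    linearised equation is solved. *)
Definition flow_family n (A : set 'rV[R]_n) (f : 'rV[R]_n -> 'rV[R]_n) (eta : R)
    (B : set 'rV[R]_n) (phi : R -> 'rV[R]_n -> 'rV[R]_n) :=
  forall x, B x -> phi 0 x = x /\
    forall t : R, - eta < t < 1 + eta ->
      A (phi t x) /\ is_derive t 1 (phi^~ x) (f (phi t x)).

(** Linearising along a curve needs the Jacobian at the moving base point [y]: half of [e] pays for
    strict differentiability at [x0], half for the variation of the Jacobian. *)
Lemma strictly_differentiable_at n p (A : set 'rV[R]_n)
    (f : 'rV[R]_n -> 'rV[R]_p) x0 e : open A -> A x0 -> Ck_on 1 A f -> 0 < e ->
  exists2 r, 0 < r & ball x0 r `<=` A /\
    forall y y', ball x0 r y -> ball x0 r y' ->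
    `|f y' - f y - (y' - y) *m jacobian f y| <= e * `|y' - y|.
Proof.
move=> oA Ax0 fC e0; have e20 : 0 < e / 2 by rewrite divr_gt0.
have [r1 r10 [r1A r1P]] := strictly_differentiable oA Ax0 fC e20.
have n0 : 0 < n%:R + 1 :> R by rewrite ltr_wpDl.
have Jc : (fun x => jacobian f x) @ x0 --> jacobian f x0.
  exact: (Ck_jacobian (k := 0) oA fC).
have e'0 : 0 < e / 2 / (n%:R + 1) by rewrite divr_gt0.
move/cvgrPdist_le : Jc => /(_ _ e'0) /nbhs_ballP[r2 /= r20 r2P].
exists (Num.min r1 r2); first by rewrite lt_min r10.
split=> [y yr|y y' yr yr']; first by apply: r1A; apply: le_ball yr; rewrite ge_min lexx.
have yr1 : ball x0 r1 y by apply: le_ball yr; rewrite ge_min lexx.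
have yr1' : ball x0 r1 y' by apply: le_ball yr'; rewrite ge_min lexx.
have yr2 : ball x0 r2 y by apply: le_ball yr; rewrite ge_min lexx orbT.
have -> : f y' - f y - (y' - y) *m jacobian f y =
   (f y' - f y - (y' - y) *m jacobian f x0) +
   (y' - y) *m (jacobian f x0 - jacobian f y).
  by rewrite mulmxBr addrA subrK.
rewrite (splitr e) mulrDl (le_trans (ler_normD _ _)) // lerD ?r1P //.
rewrite (le_trans (mulmx_norm_le _ _)) //.
apply: le_trans (_ : n%:R * `|y' - y| * (e / 2 / (n%:R + 1)) <= _).
  by rewrite ler_wpM2l ?mulr_ge0 // r2P.
rewrite mulrAC ler_wpM2r // mulrA ler_pdivrMr // mulrC ler_wpM2l ?(ltW e20) //.
by rewrite lerDl.
Qed.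

(** Compactness of the unit interval turns the local radii of [strictly_differentiable_at] into a
    single radius along the whole curve. *)
Lemma tube n (A : set 'rV[R]_n) (f : 'rV[R]_n -> 'rV[R]_n) (c : R -> 'rV[R]_n) e :
  open A -> Ck_on 1 A f -> 0 < e ->
  (forall t, 0 <= t <= 1 -> A (c t) /\ {for t, continuous c}) ->
  exists2 r, 0 < r & forall t w, 0 <= t <= 1 -> `|w| < r -> A (c t + w) /\
    `|f (c t + w) - f (c t) - w *m jacobian f (c t)| <= e * `|w|.
Proof.
move=> oA fC e0 cA.
have cpt : compact (`[0, 1]%classic : set R) by exact: segment_compact.
have : \forall w \near (0 : 'rV[R]_n), `[0, 1]%classic `<=` [set t | A (c t + w) /\
    `|f (c t + w) - f (c t) - w *m jacobian f (c t)| <= e * `|w| ].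
  move/compact_near_coveringP : cpt => cov.
  apply: (cov _ (nbhs (0 : 'rV[R]_n)) (fun w t => A (c t + w) /\
    `|f (c t + w) - f (c t) - w *m jacobian f (c t)| <= e * `|w|)) => t0 /=.
  rewrite in_itv /= => t01; have [At0 ct0] := cA t0 t01.
  have [r r0 [rA rP]] := strictly_differentiable_at oA At0 fC e0.
  have r20 : 0 < r / 2 by rewrite divr_gt0.
  exists ([set t | `|c t0 - c t| < r / 2], ball (0 : 'rV[R]_n) (r / 2)).
    split; last by apply: nbhsx_ballx; exact: r20.
    have ct : c @ t0 --> c t0 by exact: ct0.
    by move/cvgrPdist_lt : ct => /(_ _ r20).
  move=> [t w] /= [ct' w0].
  have ct : ball (c t0) (r / 2) (c t) by rewrite -ball_normE.
  have b1 : ball (c t0) r (c t).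
    by apply: le_ball ct; rewrite ler_pdivrMr // ler_peMr ?ler1n // ltW.
  have b2 : ball (c t0) r (c t + w).
    rewrite (splitr r); apply: ball_triangle ct _; move: w0.
    by rewrite -!ball_normE /= sub0r opprD addrA subrr sub0r.
  have wE : c t + w - c t = w by rewrite addrC addKr.
  by split; [exact: rA|have := rP _ _ b1 b2; rewrite wE].
move=> /nbhs_normP[r /= r0 rP]; exists r => // t w t01 wr.
by apply: (rP w); rewrite /= ?sub0r ?normrN // in_itv.
Qed.

End flow_families.

Section lipschitz_dependence.
Context {R : realType}.

Lemma mx_curve_bounded n p (M : R -> 'M[R]_(n, p)) (a b : R) : a <= b ->
  (forall t, a <= t <= b -> {for t, continuous M}) ->
  exists2 L, 0 <= L & forall t, a <= t <= b -> `|M t| <= L.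
Proof.
move=> ab Mc.
have [|t0 _ t0P] := @EVT_max R (fun t => `|M t|) a b ab.
  apply: continuous_in_subspaceT => t; rewrite inE /= in_itv /= => tab.
  apply: (@continuous_comp _ _ _ M (fun N => `|N|)); first exact: Mc.
  exact: norm_continuous.
by exists `|M t0| => // t tab; apply: t0P; rewrite in_itv.
Qed.

(** Freezing [M] outside the interval, by clamping the time, gives coefficients that are continuous
    and bounded on the whole line, so [picard_global] applies. *)
Lemma linear_flow n (M : R -> 'M[R]_n) (a b : R) : a <= 0 <= b ->
  (forall t, a <= t <= b -> {for t, continuous M}) ->
  exists psi : R -> 'rV[R]_n -> 'rV[R]_n, forall v, psi 0 v = v /\
    forall t : R, a <= t <= b -> is_derive t 1 (psi^~ v) (psi t v *m M t).
Proof.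
move=> /andP[a0 b0] Mc; have ab := le_trans a0 b0.
have [L L0 ML] := mx_curve_bounded ab Mc.
pose cl t : R := Num.max a (Num.min b t).
have clab t : a <= cl t <= b.
  by rewrite /cl le_max lexx /= ge_max ab ge_min lexx.
have clK t : a <= t <= b -> cl t = t.
  by move=> /andP[at_ tb]; rewrite /cl (min_idPr tb) (max_idPr at_).
have clc : continuous cl.
  move=> t; apply: continuous_max; first exact: cst_continuous.
  apply: continuous_min; first exact: cst_continuous.
  exact: cvg_id.
have Mclc : continuous (M \o cl).
  by move=> t; apply: continuous_comp; [exact: clc|exact: Mc].
have /choice[psi psiP] : forall v : 'rV[R]_n, exists u : R -> 'rV[R]_n,
    u 0 = v /\ forall t : R, is_derive t 1 u (u t *m M (cl t)).
  move=> v; apply: (@picard_global _ _ (fun t u => u *m M (cl t)) (n%:R * L)).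
  - move=> u uc t.
    have : Ck_on 0 setT (fun t => u t *m M (cl t)).
      by apply: Ck_mulmx; [exact: openT|move=> s _; exact: uc|
                           move=> s _; exact: Mclc].
    exact.
  - move=> t u w; rewrite -mulmxBl (le_trans (mulmx_norm_le _ _)) //.
    by rewrite mulrAC ler_wpM2r // ler_wpM2l // ML.
  - exists (n%:R * `|v| * L) => t; rewrite (le_trans (mulmx_norm_le _ _)) //.
    by rewrite ler_wpM2l ?mulr_ge0 // ML.
exists (fun t v => psi v t) => v; split; first exact: (psiP v).1.
by move=> t tab; have := (psiP v).2 t; rewrite clK.
Qed.

Section flow.
Variables (n : nat) (A : set 'rV[R]_n) (f : 'rV[R]_n -> 'rV[R]_n) (eta : R).
Variables (B : set 'rV[R]_n) (phi : R -> 'rV[R]_n -> 'rV[R]_n).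
Hypotheses (oA : open A) (f1 : Ck_on 1 A f) (eta0 : 0 < eta).
Hypothesis flow_phi : flow_family A f eta B phi.

Lemma flow_domain01 t : 0 <= t <= 1 -> - eta < t < 1 + eta.
Proof.
move=> /andP[t0 t1]; rewrite (lt_le_trans _ t0) ?oppr_lt0 //=.
by rewrite (le_lt_trans t1) // ltrDl.
Qed.

Lemma flow_curve_continuous x t : B x -> - eta < t < 1 + eta ->
  {for t, continuous (phi^~ x)}.
Proof.
by move=> Bx te; have [_ /is_derive_continuous] := (flow_phi Bx).2 t te.
Qed.

Lemma flow_jacobian_continuous x t : B x -> - eta < t < 1 + eta ->
  {for t, continuous (fun t => jacobian f (phi t x))}.
Proof.
move=> Bx te; have [Ap _] := (flow_phi Bx).2 t te.
apply: (@continuous_comp _ _ _ (phi^~ x) (fun y => jacobian f y)).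
  exact: flow_curve_continuous.
exact: (Ck_jacobian (k := 0) oA f1).
Qed.

(** Gronwall bounds the distance of the two curves only while they stay within the tube radius [r],
    and the bound is then below [r / 2]. Real induction on the claim that the distance is at most
    [r / 2] removes the circularity. *)
Lemma flow_lipschitz x : B x -> exists2 C, 0 < C &
  \forall y \near x, B y ->
    forall t, 0 <= t <= 1 -> `|phi t y - phi t x| <= C * `|y - x|.
Proof.
move=> Bx.
have [L0 L00 L0P] := mx_curve_bounded ler01
  (fun t t01 => flow_jacobian_continuous Bx (flow_domain01 t01)).
have [r r0 rP] := tube oA f1 ltr01 (fun t t01 =>
  conj ((flow_phi Bx).2 t (flow_domain01 t01)).1
       (flow_curve_continuous Bx (flow_domain01 t01))).
pose L := 1 + n%:R * L0.
have Lge0 : 0 <= L by rewrite addr_ge0 // mulr_ge0.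
have rL t w : 0 <= t <= 1 -> `|w| < r ->
    `|f (phi t x + w) - f (phi t x)| <= L * `|w|.
  move=> t01 wr; have [_ fw] := rP t w t01 wr.
  rewrite -(subrK (w *m jacobian f (phi t x)) (_ - _)) (le_trans (ler_normD _ _)) //.
  rewrite /L mulrDl lerD // (le_trans (mulmx_norm_le _ _)) //.
  by rewrite mulrAC ler_wpM2r // ler_wpM2l // L0P.
have [K K0 KP] := @gronwall R n L Lge0.
exists K => //.
(* [r / 2] starts the induction at time 0; [r / (2 * K)] brings the Gronwall bound below [r / 2]. *)
pose del := Num.min (r / 2) (r / (2 * K)).
have r20 : 0 < r / 2 by rewrite divr_gt0.
have del0 : 0 < del by rewrite lt_min r20 divr_gt0 // mulr_gt0.
near=> y => By.
have yx : `|y - x| < del.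
  rewrite distrC; near: y.
  have xx : (fun y : 'rV[R]_n => y) @ x --> x by exact: cvg_id.
  by move/cvgrPdist_lt : xx => /(_ _ del0).
pose d (t : R) := phi t y - phi t x.
have d0 : d 0 = y - x by rewrite /d (flow_phi By).1 (flow_phi Bx).1.
have dd (t : R) : 0 <= t <= 1 -> is_derive t 1 d (f (phi t y) - f (phi t x)).
  move=> t01; have [_ dy] := (flow_phi By).2 t (flow_domain01 t01).
  have [_ dx] := (flow_phi Bx).2 t (flow_domain01 t01).
  exact: is_deriveB.
have Kd b : 0 <= b <= 1 -> (forall s, 0 <= s <= b -> `|d s| < r) ->
    `|d b| <= K * `|y - x|.
  move=> b01 dr; rewrite -[`|y - x|]addr0 -d0.
  have sb s : 0 <= s <= b -> 0 <= s <= 1.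
    by move=> /andP[-> sb]; case/andP: b01 => _; exact: le_trans.
  apply: (KP d (fun t => f (phi t y) - f (phi t x)) b 0) => //.
    by move=> t /sb; exact: dd.
  move=> t tb; rewrite addr0.
  have dE : phi t x + d t = phi t y by rewrite /d addrC subrK.
  by have := rL t (d t) (sb t tb) (dr t tb); rewrite dE.
have Kr : K * `|y - x| < r / 2.
  rewrite -ltr_pdivlMl // (lt_le_trans yx) // ge_min; apply/orP; right.
  by rewrite invfM mulrA (mulrC K^-1).
have dc (t : R) : 0 <= t <= 1 -> d @ t --> d t.
  by move=> t01; have := is_derive_continuous (dd t t01); exact.
have half_r : r / 2 < r by rewrite gtr_pMr // invf_lt1 // ltr1n.
suff dr (t : R) : 0 <= t <= 1 -> `|d t| <= r / 2.
  move=> t t01; apply: Kd => // s /andP[s0 st]; apply: le_lt_trans half_r.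
  by apply: dr; rewrite s0 (le_trans st) //; case/andP: t01.
apply: (@real_induction R (fun t => `|d t| <= r / 2)).
- by rewrite d0 ltW // (lt_le_trans yx) // ge_min lexx.
- move=> s /andP[s0 s1] sP; have s01 : 0 <= s <= 1 by rewrite s0 ltW.
  have ds : `|d s| < r / 2.
    apply: le_lt_trans Kr; apply: Kd => // s' /sP; move/le_lt_trans; exact.
  have nd : (fun t => `|d t|) @ s --> `|d s| by apply: cvg_norm; exact: dc.
  have nlt : \forall t \near s, `|d t| < r / 2 by exact: (cvgr_lt _ nd _ ds).
  move/nbhs_normP : nlt => [e /= e0 eP].
  exists e => // s' /andP[ss' s'e]; apply/ltW/eP.
  by rewrite /= distrC ger0_norm ?subr_ge0 // ltrBlDl.
- move=> s /andP[s0 s1] sP; rewrite leNgt; apply/negP => ds.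
  have s01 : 0 <= s <= 1 by rewrite s1 ltW.
  have nd : (fun t => `|d t|) @ s --> `|d s| by apply: cvg_norm; exact: dc.
  have ngt : \forall t \near s, r / 2 < `|d t| by exact: (cvgr_gt _ nd _ ds).
  move/nbhs_normP : ngt => [e /= e0 eP].
  pose s' := Num.max 0 (s - e / 2).
  have s's : 0 <= s' < s.
    by rewrite /s' le_max lexx gt_max s0 ltrBlDr ltrDl divr_gt0.
  have ss'e : `|s - s'| < e.
    case/andP: s's => _ s's; rewrite gtr0_norm ?subr_gt0 //.
    rewrite ltrBlDr -ltrBlDl (lt_le_trans (_ : _ < s - e / 2)) //.
      by rewrite ltrD2l ltrN2 gtr_pMr // invf_lt1 // ltr1n.
    by rewrite /s' le_max lexx orbT.
  by have := eP s' ss'e; rewrite /= ltNge (sP s' s's).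
Unshelve. all: by end_near. Qed.

End flow.

End lipschitz_dependence.

Section smooth_dependence.
Context {R : realType}.

Lemma near_shift0 (V : normedModType R) (x : V) (P : V -> Prop) :
  (\forall y \near x, P y) -> \forall h \near (0 : V), P (h + x).
Proof.
move=> Px; have cx : (fun h : V => h + x) @ (0 : V) --> x.
  by rewrite -[X in _ --> X]add0r; apply: cvgD; [exact: cvg_id|exact: cvg_cst].
exact: (cx _ Px).
Qed.

Lemma linear_ode_unique n (M : R -> 'M[R]_n) (u : R -> 'rV[R]_n) b : 0 <= b <= 1 ->
  (forall t, 0 <= t <= b -> {for t, continuous M}) ->
  (forall t : R, 0 <= t <= b -> is_derive t 1 u (u t *m M t)) ->
  u 0 = 0 -> u b = 0.
Proof.
move=> b01 Mc ud u0; have b0 : 0 <= b by case/andP: b01.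
have [L L0 ML] := mx_curve_bounded b0 Mc.
have [|K K0 KP] := @gronwall R n (n%:R * L); first by rewrite mulr_ge0.
have := KP u (fun t => u t *m M t) b 0 b01 (lexx 0) ud.
rewrite u0 normr0 addr0 mulr0 normr_le0 => uP; apply/eqP/uP => t tb.
rewrite addr0 (le_trans (mulmx_norm_le _ _)) // mulrAC ler_wpM2r //.
by rewrite ler_wpM2l // ML.
Qed.

(** [psi] solves the linearised equation along the curve of [x]. The remainder [th] satisfies the
    same equation up to the Taylor error of [f] on the tube, which [flow_lipschitz] bounds by
    [e / (K * C)] times [C * |h|]; Gronwall multiplies this by [K], leaving [e * |h|]. *)
Lemma flow_differentiable n (A : set 'rV[R]_n) (f : 'rV[R]_n -> 'rV[R]_n)
    (eta : R) (B : set 'rV[R]_n) (phi : R -> 'rV[R]_n -> 'rV[R]_n) x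
    (psi : R -> 'rV[R]_n -> 'rV[R]_n) :
  open A -> open B -> Ck_on 1 A f -> 0 < eta -> flow_family A f eta B phi ->
  B x ->
  (forall v, psi 0 v = v /\ forall t : R, 0 <= t <= 1 ->
     is_derive t 1 (psi^~ v) (psi t v *m jacobian f (phi t x))) ->
  differentiable (phi 1) x /\ forall v, 'D_v (phi 1) x = psi 1 v.
Proof.
move=> oA oB f1 eta0 flow_phi Bx psiP.
have i1 : 0 <= (1 : R) <= 1 by rewrite lexx ler01.
have dom t := @flow_domain01 R eta eta0 t.
have Jc t (t01 : 0 <= t <= 1) :=
  flow_jacobian_continuous oA f1 flow_phi Bx (dom t t01).
(* The defect of linearity solves the linearised equation with initial value 0. *)
have psi_lin : linear (psi 1).
  move=> a v w; apply/eqP; rewrite -subr_eq0; apply/eqP.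
  apply: (@linear_ode_unique n (fun t => jacobian f (phi t x))
    (fun t => psi t (a *: v + w) - (a *: psi t v + psi t w)) 1) => //; last first.
    by rewrite !(psiP _).1 subrr.
  move=> t t01; have Dv := (psiP v).2 t t01; have Dw := (psiP w).2 t t01.
  have Davw := (psiP (a *: v + w)).2 t t01.
  have DZ := is_deriveZ a Dv.
  have := is_deriveB Davw (is_deriveD DZ Dw).
  by rewrite mulmxBl mulmxDl scalemxAl.
pose L : {linear 'rV[R]_n -> 'rV[R]_n} :=
  HB.pack (psi 1) (GRing.isLinear.Build _ _ _ _ (psi 1) psi_lin).
suff [fd fE] : differentiable (phi 1) x /\ 'd (phi 1) x = L :> (_ -> _).
  by split=> // v; rewrite deriveE // fE.
apply: diff_epsP => [|e e0]; first exact: linear_rV_continuous.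
have [L0 L00 L0P] := mx_curve_bounded ler01 Jc.
have [|K K0 KP] := @gronwall R n (n%:R * L0); first by rewrite mulr_ge0.
have [C C0 CP] := flow_lipschitz oA f1 eta0 flow_phi Bx.
have e'0 : 0 < e / (K * C) by rewrite divr_gt0 // mulr_gt0.
have [r r0 rP] := tube oA f1 e'0 (fun t t01 =>
  conj ((flow_phi x Bx).2 t (dom t t01)).1
       (flow_curve_continuous flow_phi Bx (dom t t01))).
have nB : \forall y \near x, B y by exact: open_nbhs_nbhs.
have nBh := near_shift0 nB; have nCh := near_shift0 CP.
have nr : \forall h \near (0 : 'rV[R]_n), `|h| < C^-1 * r.
  by apply: nbhs0_lt; rewrite mulr_gt0 // invr_gt0.
near=> h.
have Bh : B (h + x) by near: h.
have dC t : 0 <= t <= 1 -> `|phi t (h + x) - phi t x| <= C * `|h|.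
  have : B (h + x) -> forall t, 0 <= t <= 1 ->
      `|phi t (h + x) - phi t x| <= C * `|h + x - x|.
    by near: h.
  by rewrite addrK => H; exact: H.
have hr : C * `|h| < r.
  by rewrite -ltr_pdivlMl //; near: h.
pose th t := phi t (h + x) - phi t x - psi t h.
have thd (t : R) : 0 <= t <= 1 -> is_derive t 1 th
    (f (phi t (h + x)) - f (phi t x) - psi t h *m jacobian f (phi t x)).
  move=> t01; have [_ dy] := (flow_phi _ Bh).2 t (dom t t01).
  have [_ dx] := (flow_phi _ Bx).2 t (dom t t01).
  exact: is_deriveB (is_deriveB dy dx) ((psiP h).2 t t01).
have := KP th _ 1 (e / (K * C) * (C * `|h|)) _ _ thd.
have -> : th 0 = 0.
  by rewrite /th (flow_phi _ Bh).1 (flow_phi _ Bx).1 (psiP h).1 addrK subrr.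
rewrite normr0 add0r.
have -> : K * (e / (K * C) * (C * `|h|)) = e * `|h|.
  by field; rewrite !gt_eqF.
apply => //.
- by rewrite mulr_ge0 ?(ltW e'0) // mulr_ge0 // ltW.
- move=> t t01; set d := phi t (h + x) - phi t x.
  have dE : phi t (h + x) = phi t x + d by rewrite /d addrCA subrr addr0.
  have dr : `|d| < r by rewrite (le_lt_trans (dC t t01)).
  have [_] := rP t d t01 dr; rewrite -dE => fd.
  have -> : f (phi t (h + x)) - f (phi t x) - psi t h *m jacobian f (phi t x) =
      (f (phi t (h + x)) - f (phi t x) - d *m jacobian f (phi t x)) +
      th t *m jacobian f (phi t x).
    have thE : psi t h = d - th t by rewrite /th opprB addrCA subrr addr0.
    by rewrite [in LHS]thE mulmxBl opprB addrA addrAC.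
  rewrite addrC (le_trans (ler_normD _ _)) // lerD //.
    rewrite (le_trans (mulmx_norm_le _ _)) // mulrAC ler_wpM2r //.
    by rewrite ler_wpM2l // L0P.
  by rewrite (le_trans fd) // ler_wpM2l ?(ltW e'0) // dC.
Unshelve. all: by end_near. Qed.

(** The linearised equation is solved on a compact interval, where its coefficients are bounded;
    hence the loss from [eta] to [eta / 2]. What remains is still a margin around the unit
    interval. *)
Lemma flow_derivative n (A : set 'rV[R]_n) (f : 'rV[R]_n -> 'rV[R]_n)
    (eta : R) (B : set 'rV[R]_n) (phi : R -> 'rV[R]_n -> 'rV[R]_n) :
  open A -> open B -> Ck_on 1 A f -> 0 < eta -> flow_family A f eta B phi ->
  exists psi : 'rV[R]_n -> R -> 'rV[R]_n -> 'rV[R]_n, forall x, B x -> [/\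
    forall v, psi x 0 v = v /\ forall t : R, - (eta / 2) <= t <= 1 + eta / 2 ->
      is_derive t 1 ((psi x)^~ v) (psi x t v *m jacobian f (phi t x)),
    differentiable (phi 1) x &
    forall v, 'D_v (phi 1) x = psi x 1 v].
Proof.
move=> oA oB f1 eta0 flow_phi.
have eta20 : 0 < eta / 2 by rewrite divr_gt0.
have eta2 : eta / 2 < eta by rewrite gtr_pMr // invf_lt1 // ltr1n.
suff /choice[psi psiP] : forall x, exists psi : R -> 'rV[R]_n -> 'rV[R]_n,
    B x -> [/\ forall v, psi 0 v = v /\
      forall t : R, - (eta / 2) <= t <= 1 + eta / 2 ->
        is_derive t 1 (psi^~ v) (psi t v *m jacobian f (phi t x)),
      differentiable (phi 1) x & forall v, 'D_v (phi 1) x = psi 1 v].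
  by exists psi.
move=> x; have [Bx|nBx] := pselect (B x); last by exists (fun _ _ => 0).
have [||psi psiP] := @linear_flow R n (fun t => jacobian f (phi t x))
  (- (eta / 2)) (1 + eta / 2).
- by rewrite oppr_le0 ltW //= addr_ge0 // ltW.
- move=> t /andP[t1 t2]; apply: (flow_jacobian_continuous oA f1 flow_phi Bx).
  by rewrite (lt_le_trans _ t1) ?ltrN2 //= (le_lt_trans t2) // ltrD2l.
exists psi => _.
have [|phid phiD] := flow_differentiable oA oB f1 eta0 flow_phi Bx (psi := psi).
  move=> v; split; first exact: (psiP v).1.
  move=> t /(flow_domain01 eta20) /andP[t1 t2]; apply: (psiP v).2.
  by rewrite !ltW.
by split.
Qed.

(** The complete lift of [f] to the tangent bundle: the second half is the linearised equation along
    the first, so its flow carries a point together with the derivative of the flow of [f]. *)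
Definition tangent_field n (f : 'rV[R]_n -> 'rV[R]_n) (y : 'rV[R]_(n + n)) :=
  row_mx (f (lsubmx y)) (rsubmx y *m jacobian f (lsubmx y)).

Lemma Ck_lsubmx k n p (D : set 'rV[R]_(n + p)) :
  Ck_on k D (fun y : 'rV[R]_(n + p) => lsubmx y).
Proof. exact: (Ck_lin (L := lsubmx) k D (@linear_rV_continuous _ _ _ _)). Qed.

Lemma Ck_rsubmx k n p (D : set 'rV[R]_(n + p)) :
  Ck_on k D (fun y : 'rV[R]_(n + p) => rsubmx y).
Proof. exact: (Ck_lin (L := rsubmx) k D (@linear_rV_continuous _ _ _ _)). Qed.

Lemma open_lsubmx n p (A : set 'rV[R]_n) : open A ->
  open [set y : 'rV[R]_(n + p) | A (lsubmx y)].
Proof.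
move=> oA; apply: (@open_comp _ _ (fun y : 'rV[R]_(n + p) => lsubmx y)) => // y _.
exact: (@Ck_lsubmx 0 _ _ setT).
Qed.

Lemma open_rsubmx n p (A : set 'rV[R]_p) : open A ->
  open [set y : 'rV[R]_(n + p) | A (rsubmx y)].
Proof.
move=> oA; apply: (@open_comp _ _ (fun y : 'rV[R]_(n + p) => rsubmx y)) => // y _.
exact: (@Ck_rsubmx 0 _ _ setT).
Qed.

Lemma Ck_row_mx k n p (V : normedModType R) (D : set V) (f : V -> 'rV[R]_n)
    (g : V -> 'rV[R]_p) : open D ->
  Ck_on k D f -> Ck_on k D g -> Ck_on k D (fun x => row_mx (f x) (g x)).
Proof.
move=> oD fk gk; apply: Ck_mx => // i j; rewrite -(fintype.splitK j).
case: (fintype.split j) => l /=.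
  under eq_fun do rewrite row_mxEl; exact: Ck_coord.
under eq_fun do rewrite row_mxEr; exact: Ck_coord.
Qed.

Lemma smooth_tangent_field n (A : set 'rV[R]_n) (f : 'rV[R]_n -> 'rV[R]_n) :
  open A -> smooth_on A f ->
  smooth_on [set y : 'rV[R]_(n + n) | A (lsubmx y)] (tangent_field f).
Proof.
move=> oA fS k; have oA' := @open_lsubmx n n A oA.
apply: Ck_row_mx => //.
  exact: (Ck_comp oA' oA _ (fS k) (@Ck_lsubmx k _ _ _)).
apply: Ck_mulmx => //; first exact: Ck_rsubmx.
apply: (Ck_comp oA' oA _ (Ck_jacobian oA (fS k.+1)) (@Ck_lsubmx k _ _ _)).
by [].
Qed.

Lemma is_derive_row_mx n p (u : R -> 'rV[R]_n) (v : R -> 'rV[R]_p) (t : R) du dv :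
  is_derive t 1 u du -> is_derive t 1 v dv ->
  is_derive t 1 (fun s => row_mx (u s) (v s)) (row_mx du dv).
Proof.
move=> /is_derive_rV ud /is_derive_rV vd; apply/is_derive_rV => i.
rewrite -(fintype.splitK i); case: (fintype.split i) => l /=.
  by under eq_fun do rewrite row_mxEl; rewrite row_mxEl.
by under eq_fun do rewrite row_mxEr; rewrite row_mxEr.
Qed.

(* Induction on k over all dimensions: the derivative of the flow of f is a
   component of the flow of its tangent field. *)
Theorem flow_Ck k n (A : set 'rV[R]_n) (f : 'rV[R]_n -> 'rV[R]_n)
    (eta : R) (B : set 'rV[R]_n) (phi : R -> 'rV[R]_n -> 'rV[R]_n) :
  open A -> open B -> smooth_on A f -> 0 < eta -> flow_family A f eta B phi ->
  Ck_on k B (phi 1).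
Proof.
elim: k n A f eta B phi => [|k IH] n A f eta B phi oA oB fS eta0 flow_phi.
  have [psi psiP] := flow_derivative oA oB (fS 1) eta0 flow_phi.
  by move=> x /psiP[_ xd _]; exact: differentiable_continuous.
have [psi psiP] := flow_derivative oA oB (fS 1) eta0 flow_phi.
have eta20 : 0 < eta / 2 by rewrite divr_gt0.
have eta2 : eta / 2 < eta by rewrite gtr_pMr // invf_lt1 // ltr1n.
split=> [x /psiP[]//|v].
pose B' := [set y : 'rV[R]_(n + n) | B (lsubmx y)].
pose Phi t (y : 'rV[R]_(n + n)) :=
  row_mx (phi t (lsubmx y)) (psi (lsubmx y) t (rsubmx y)).
have oB' : open B' by exact: open_lsubmx.
have PhiC : Ck_on k B' (Phi 1).
  apply: (IH _ [set y : 'rV[R]_(n + n) | A (lsubmx y)] (tangent_field f) (eta / 2)).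
  - exact: open_lsubmx.
  - exact: oB'.
  - exact: smooth_tangent_field.
  - exact: eta20.
  move=> y By; split.
    have [psiD _ _] := psiP _ By.
    by rewrite /Phi (flow_phi _ By).1 (psiD _).1 hsubmxK.
  move=> t /andP[t1 t2].
  have te : - eta < t < 1 + eta.
    by rewrite (lt_trans _ t1) ?ltrN2 //= (lt_trans t2) // ltrD2l.
  have te2 : - (eta / 2) <= t <= 1 + eta / 2 by rewrite !ltW.
  have [At dt] := (flow_phi _ By).2 t te.
  split; first by rewrite /= row_mxKl.
  rewrite /tangent_field row_mxKl row_mxKr.
  have [psiD _ _] := psiP _ By.
  exact: is_derive_row_mx dt ((psiD _).2 t te2).
(* The derivative of [phi 1] at [x] along [v] is the second half of [Phi 1] at the pair of [x] and
   [v]. *)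
have aff : Ck_on k B (fun x => row_mx x v).
  by apply: Ck_row_mx => //; [exact: (@Ck_lin R k _ _ B idfun (@linear_rV_continuous _ _ _ idfun))|exact: Ck_cst].
have rB x : B x -> B' (row_mx x v) by rewrite /B' /= row_mxKl.
have comp := Ck_comp oB oB' rB PhiC aff.
apply: (Ck_congr oB _ (Ck_comp oB openT (fun _ _ => I) (@Ck_rsubmx k _ _ setT) comp)).
move=> x Bx /=; rewrite /Phi row_mxKr row_mxKl row_mxKr.
by have [_ _ ->] := psiP x Bx.
Qed.

End smooth_dependence.

(** * Local flows, smooth jointly in time and initial point *)

Section local_flow.
Context {R : realType}.

Definition clamp (a rho s : R) := Num.max (a - rho) (Num.min (a + rho) s).

Lemma clamp_dist a rho s : 0 <= rho -> `|a - clamp a rho s| <= rho.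
Proof.
move=> rho0; rewrite /clamp /Num.max /Num.min ler_norml.
by case: ifPn => [|/negPf]; case: ifPn => [|/negPf]; rewrite ?ltNge => *; lra.
Qed.

Lemma clampK a rho s : `|a - s| <= rho -> clamp a rho s = s.
Proof.
rewrite ler_norml => /andP[h1 h2]; rewrite /clamp.
by rewrite (min_idPr _) ?(max_idPr _) //; lra.
Qed.

Lemma clamp_lipschitz a rho s t : 0 <= rho ->
  `|clamp a rho s - clamp a rho t| <= `|s - t|.
Proof.
move=> rho0; wlog st : s t / s <= t.
  move=> H; have [/H//|/ltW/H] := leP s t.
  by rewrite distrC (distrC t).
have mono : clamp a rho s <= clamp a rho t.
  rewrite /clamp ge_max !le_max lexx /= !le_min !ge_min lexx st /=.
  by rewrite !orbT.
rewrite !ler0_norm ?subr_le0 // !opprB; move: st; rewrite /clamp /Num.max /Num.min.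
case: (ltP (a + rho) s) => ?; case: (ltP (a + rho) t) => ?;
  by repeat (case: ifPn; rewrite -?leNgt => ?); lra.
Qed.

(** For the sup norm this is a retraction onto the closed ball of radius [rho] around [p] that does
    not increase distances, so composing with it turns a locally Lipschitz field into a globally
    Lipschitz one. *)
Definition box_clamp n (p : 'rV[R]_n) rho (x : 'rV[R]_n) : 'rV[R]_n :=
  \row_i clamp (p 0 i) rho (x 0 i).

Lemma box_clamp_dist n (p x : 'rV[R]_n) rho : 0 <= rho ->
  `|p - box_clamp p rho x| <= rho.
Proof.
by move=> rho0; apply: mx_norm_le => // i j; rewrite ord1 !mxE clamp_dist.
Qed.

Lemma box_clampK n (p x : 'rV[R]_n) rho : `|p - x| <= rho ->
  box_clamp p rho x = x.
Proof.
move=> px; apply/rowP => j; rewrite mxE clampK //.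
by apply: le_trans px; have := mx_entry_le (p - x) 0 j; rewrite !mxE.
Qed.

Lemma box_clamp_lipschitz n (p x y : 'rV[R]_n) rho : 0 <= rho ->
  `|box_clamp p rho x - box_clamp p rho y| <= `|x - y|.
Proof.
move=> rho0; apply: mx_norm_le => // i j; rewrite ord1 !mxE.
apply: le_trans (clamp_lipschitz _ _ _ rho0) _.
by have := mx_entry_le (x - y) 0 j; rewrite !mxE.
Qed.

(** Clamped to a small cube, the field is bounded and globally Lipschitz and has solutions for all
    times; those that start near [p0] remain in the cube for short times and there solve the
    original equation. *)
Lemma local_flow_family n (A : set 'rV[R]_n) (f : 'rV[R]_n -> 'rV[R]_n) p0 :
  open A -> A p0 -> Ck_on 1 A f ->
  exists tau r (phi : R -> 'rV[R]_n -> 'rV[R]_n), [/\ 0 < tau, 0 < r &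
    forall x, ball p0 r x -> phi 0 x = x /\ forall t : R, `|t| < tau ->
      A (phi t x) /\ is_derive t 1 (phi^~ x) (f (phi t x))].
Proof.
move=> oA Ap0 f1.
have [r1 r10 [r1A r1P]] := strictly_differentiable oA Ap0 f1 ltr01.
pose L := n%:R * `|jacobian f p0| + 1.
have L0 : 0 <= L by rewrite addr_ge0 // mulr_ge0.
have fL y y' : ball p0 r1 y -> ball p0 r1 y' -> `|f y' - f y| <= L * `|y' - y|.
  move=> yr yr'; have fyy' := r1P y y' yr yr'.
  rewrite -(subrK ((y' - y) *m jacobian f p0) (_ - _)) (le_trans (ler_normD _ _)) //.
  rewrite /L mulrDl addrC lerD // (le_trans (mulmx_norm_le _ _)) //.
  by rewrite mulrAC.
pose rho := r1 / 2; have rho0 : 0 < rho by rewrite divr_gt0.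
have rho1 : rho < r1 by rewrite gtr_pMr // invf_lt1 // ltr1n.
pose cl := box_clamp p0 rho.
have clr x : ball p0 r1 (cl x).
  by rewrite -ball_normE /= (le_lt_trans (box_clamp_dist _ _ _)) // ltW.
have fcL x y : `|f (cl x) - f (cl y)| <= L * `|x - y|.
  rewrite (le_trans (fL _ _ (clr y) (clr x))) // ler_wpM2l //.
  by rewrite box_clamp_lipschitz // ltW.
pose M := `|f p0| + L * rho + 1.
have M0 : 0 < M by rewrite ltr_wpDl // addr_ge0 // mulr_ge0 // ltW.
have fM x : `|f (cl x)| <= M.
  have pr : ball p0 r1 p0 by exact: ballxx.
  rewrite -(subrK (f p0) (f (cl x))) (le_trans (ler_normD _ _)) // addrC /M.
  rewrite -addrA lerD2l ler_wpDr // (le_trans (fL _ _ pr (clr x))) //.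
  by rewrite ler_wpM2l // distrC box_clamp_dist // ltW.
have /choice[phi phiP] : forall x, exists u : R -> 'rV[R]_n, u 0 = x /\
    forall t : R, is_derive t 1 u (f (cl (u t))).
  move=> x; apply: (@picard_global _ _ (fun _ u => f (cl u)) L) => //; last by exists M.
  move=> u uc t; apply/cvgrPdist_lt => e e0.
  have L10 : 0 < L + 1 by rewrite ltr_wpDl.
  have ut : u @ t --> u t by exact: uc.
  move/cvgrPdist_lt : ut => /(_ _ (divr_gt0 e0 L10)).
  apply: filterS => s; rewrite ltr_pdivlMr // mulrC => us.
  rewrite (le_lt_trans (fcL _ _)) // (le_lt_trans _ us) // ler_wpM2r //.
  by rewrite lerDl.
(* With speed at most [M], a point within [rho / 2] of [p0] stays within [rho] during this time,
   where the clamp is the identity. *)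
exists (rho / 2 / M), (rho / 2), (fun t x => phi x t).
split; rewrite ?divr_gt0 // => x; rewrite -ball_normE /= => xr.
split; first exact: (phiP x).1.
move=> t; rewrite ltr_pdivlMr // => tM.
have xt : `|phi x t - x| <= M * `|t|.
  have idd s (r : R) : is_derive r 1 (fun r => M * (s * r)) (M * s).
    have := @is_deriveZ _ _ _ id (M * s) r 1 1 (is_derive_id r 1).
    rewrite [_ *: 1]mulr1.
    have -> : (fun r => M * (s * r)) = (M * s) \*: id :> (R -> R).
      by apply/funext => z /=; rewrite mulrA.
    by [].
  have [t0|/ltW t0] := leP 0 t.
    have := norm_le_of_derive t0 (fun r _ => (phiP x).2 r) (fun r _ => idd 1 r)
      (fun r _ => le_trans (fM (phi x r)) (_ : M <= M * 1)).
    rewrite (phiP x).1 !mul1r mulr0 subr0 ger0_norm //; apply.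
    by rewrite mulr1.
  have := norm_le_of_derive t0 (fun r _ => (phiP x).2 r) (fun r _ => idd 1 r)
    (fun r _ => le_trans (fM (phi x r)) (_ : M <= M * 1)).
  rewrite (phiP x).1 !mul1r mulr0 sub0r distrC ler0_norm // mulrN; apply.
  by rewrite mulr1.
have pr : `|p0 - phi x t| <= rho.
  rewrite -(subrKA x) (splitr rho) (le_trans (ler_normD _ _)) // lerD ?(ltW xr) //.
  by rewrite distrC (le_trans xt) // mulrC ltW.
have := (phiP x).2 t; rewrite /cl box_clampK // => dt; split=> //.
by apply: r1A; rewrite -ball_normE /= (le_lt_trans pr).
Qed.

Theorem local_flow n (A : set 'rV[R]_n) (f : 'rV[R]_n -> 'rV[R]_n) p0 :
  open A -> A p0 -> smooth_on A f ->
  exists tau r (phi : R -> 'rV[R]_n -> 'rV[R]_n), [/\ 0 < tau, 0 < r,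
    forall x, ball p0 r x -> phi 0 x = x /\ forall t : R, `|t| < tau ->
      A (phi t x) /\ is_derive t 1 (phi^~ x) (f (phi t x)) &
    smooth_on [set y : 'rV[R]_(1 + n) | `|lsubmx y 0 0| < tau /\
                                        ball p0 r (rsubmx y)]
      (fun y : 'rV[R]_(1 + n) => phi (lsubmx y 0 0) (rsubmx y))].
Proof.
move=> oA Ap0 fS.
have [tau [r [phi [tau0 r0 phiP]]]] := local_flow_family oA Ap0 (fS 1).
have tau20 : 0 < tau / 2 by rewrite divr_gt0.
have tau2 : tau / 2 < tau by rewrite gtr_pMr // invf_lt1 // ltr1n.
(* Halving [tau] gives the rescaled flow the margin [eta = 1]: for [-1 < s < 2] and [|a| < tau / 2],
   the time [s * a] is below [tau] in absolute value. *)
exists (tau / 2), r, phi; split=> //.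
  move=> x /phiP[x0 xP]; split=> // t tt; apply: xP.
  exact: lt_trans tt tau2.
move=> k.
pose A' := [set y : 'rV[R]_(1 + n) | A (rsubmx y)].
have oA' : open A' by exact: open_rsubmx.
pose B' := [set y : 'rV[R]_(1 + n) | `|lsubmx y 0 0| < tau / 2 /\
                                     ball p0 r (rsubmx y)].
have oB' : open B'.
  apply: openI; last by apply: open_rsubmx; exact: ball_open.
  apply: (@open_lsubmx R 1 n [set v | `|v 0 0| < tau / 2]).
  apply: (@open_comp _ _ (fun v : 'rV[R]_1 => `|v 0 0|) [set s | s < tau / 2]).
    move=> v _; apply: (@continuous_comp _ _ _ (fun v : 'rV[R]_1 => v 0 0)).
      exact: coord_continuous.
    exact: norm_continuous.
  exact: open_lt.
(* Rescaling time turns the dependence on t into dependence on a parameter. *)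
pose f' (y : 'rV[R]_(1 + n)) : 'rV[R]_(1 + n) :=
  row_mx 0 (lsubmx y 0 0 *: f (rsubmx y)).
pose phi' (s : R) (y : 'rV[R]_(1 + n)) : 'rV[R]_(1 + n) :=
  row_mx (lsubmx y) (phi (s * lsubmx y 0 0) (rsubmx y)).
have f'S : smooth_on A' f'.
  move=> l; apply: Ck_row_mx => //; first exact: Ck_cst.
  apply: CkZ => //; first by apply: Ck_coord => //; exact: Ck_lsubmx.
  by apply: (Ck_comp oA' oA _ (fS l) (@Ck_rsubmx R l 1 n _)).
have flow_phi' : flow_family A' f' 1 B' phi'.
  move=> y [yt yr]; have [x0 xP] := phiP _ yr; split.
    by rewrite /phi' mul0r x0 hsubmxK.
  move=> s s1; set a := lsubmx y 0 0 in yt *.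
  have sa : `|s * a| < tau.
    rewrite normrM; apply: le_lt_trans (_ : 2 * `|a| < _).
      by rewrite ler_wpM2r // ler_norml; lra.
    by rewrite mulrC -ltr_pdivlMr.
  have [As ds] := xP _ sa; split; first by rewrite /A' /= row_mxKr.
  rewrite /f' /phi' row_mxKl row_mxKr -/a.
  suff d2 : is_derive s 1 (fun s => phi (s * a) (rsubmx y))
      (a *: f (phi (s * a) (rsubmx y))).
    exact: is_derive_row_mx (is_derive_cst (lsubmx y) s 1) d2.
  have ld : is_derive s 1 (fun s => s * a) a.
    have := @is_deriveZ _ _ _ id a s 1 1 (is_derive_id s 1).
    rewrite [_ *: 1]mulr1.
    have -> : a \*: id = (fun s => s * a) :> (R -> R).
      by apply/funext => z /=; rewrite /GRing.scale /= mulrC.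
    by [].
  apply/is_derive_rV => i; move/is_derive_rV : ds => /(_ i) di.
  rewrite mxE mulrC.
  exact: (@is_derive1_comp _ (fun t => phi t (rsubmx y) 0 i) (fun s => s * a)).
have := flow_Ck k oA' oB' f'S ltr01 flow_phi'.
move=> /(Ck_comp oB' openT (fun _ _ => I) (@Ck_rsubmx R k 1 n setT)).
apply: Ck_congr => // y _.
by rewrite /= /phi' row_mxKr mul1r.
Qed.

End local_flow.

(** * Commuting fields and the flow box *)

Section adapted_basis.
Context {F : fieldType}.

(** The rows of [U] lie in the kernel of [N]. They are completed by a basis of a complement inside
    this kernel, and then by rows [P] with [P *m N = 1%:M]. With the two fields as [U] and the
    differential of [h] as [N], this is the frame in which the flow box is built. *)
Lemma adapted_basis n (U : 'M[F]_(2, 2 + (n + 2))) (N : 'M[F]_(2 + (n + 2), 2)) :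
  row_free U -> row_full N -> U *m N = 0 ->
  exists M, [/\ M \in unitmx, usubmx M = U & M *m N = col_mx 0 (col_mx 0 1%:M)].
Proof.
move=> Uf Nf UN; pose K := kermx N; pose D := (K :\: U)%MS.
have rU : \rank U = 2 by apply/eqP.
have rK : \rank K = (n + 2)%N by rewrite mxrank_ker (eqP Nf) addKn.
have UK : (U <= K)%MS by apply/sub_kermxP.
have rD : \rank D = n.
  have := mxrank_cap_compl K U.
  by rewrite (capmx_idPr UK) rU rK addnC => /addIn.
have [C [CD rC]] : exists C : 'M[F]_(n, 2 + (n + 2)), (C :=: D)%MS /\ row_free C.
  move: (row_base D) (eq_row_base D) (row_base_free D).
  by rewrite rD => C CD Cf; exists C.
have CN : C *m N = 0 by apply/sub_kermxP; rewrite CD diffmxSl.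
have [P PN] : exists P, P *m N = 1%:M by exists (pinvmx N); exact: mulVpmx.
exists (col_mx U (col_mx C P)); split.
- rewrite -row_free_unit; apply: inj_row_free => x.
  have [x1 [x2 [x3 ->]]] : exists x1 x2 x3, x = row_mx x1 (row_mx x2 x3).
    by exists (lsubmx x), (lsubmx (rsubmx x)), (rsubmx (rsubmx x)); rewrite !hsubmxK.
  rewrite !mul_row_col => xM.
  have x30 : x3 = 0.
    have := congr1 (mulmx^~ N) xM.
    by rewrite /= !mulmxDl -!mulmxA UN CN PN !mulmx0 mulmx1 mul0mx !add0r.
  move: xM; rewrite x30 mul0mx addr0 => xM.
  have x1U : x1 *m U = 0.
    apply/eqP; rewrite -submx0 -(capmx_diff K U) sub_capmx submxMl andbT -/D.
    move/eqP: xM; rewrite addr_eq0 => /eqP ->.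
    by rewrite eqmx_opp -CD submxMl.
  have x10 : x1 = 0 by apply: (row_free_inj Uf); rewrite mul0mx.
  move: xM; rewrite x1U add0r => x2C.
  have x20 : x2 = 0 by apply: (row_free_inj rC); rewrite mul0mx.
  by rewrite x10 x20 !row_mx0.
- by rewrite col_mxKu.
- by rewrite !mul_col_mx UN CN PN.
Qed.

End adapted_basis.

Section chain_rule.
Context {R : realType}.

Lemma derive_comp (V W X : normedModType R) (f : V -> W) (g : W -> X) x v :
  differentiable f x -> differentiable g (f x) ->
  'D_v (g \o f) x = 'D_('D_v f x) g (f x).
Proof.
move=> fd gd; rewrite !deriveE //; last exact: differentiable_comp.
by rewrite diff_comp.
Qed.

Lemma derive_dirZ (V W : normedModType R) (f : V -> W) x a v :
  differentiable f x -> 'D_(a *: v) f x = a *: 'D_v f x.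
Proof. by move=> fd; rewrite !deriveE // linearZ. Qed.

Lemma derive_dirD (V W : normedModType R) (f : V -> W) x u v :
  differentiable f x -> 'D_(u + v) f x = 'D_u f x + 'D_v f x.
Proof. by move=> fd; rewrite !deriveE // linearD. Qed.

Lemma is_diff_line (V : normedModType R) (y v : V) (s : R) :
  is_diff s (fun s : R => y + s *: v) (fun h => h *: v).
Proof.
have -> : (fun h : R => h *: v) = 0 \+ *:%R^~ v.
  by apply/funext => h /=; rewrite add0r.
exact: is_diffD.
Qed.

Lemma is_derive_line (V W : normedModType R) (f : V -> W) (y v : V) (s : R) :
  differentiable f (y + s *: v) ->
  is_derive s 1 (fun s : R => f (y + s *: v)) ('D_v f (y + s *: v)).
Proof.
move=> fd; have dl := is_diff_line y v s.
have ld : differentiable (fun s : R => y + s *: v) s by exact: ex_diff.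
have dg : differentiable (f \o (fun s : R => y + s *: v)) s.
  exact: differentiable_comp.
apply: DeriveDef; first exact: diff_derivable.
rewrite -[LHS]/('D_1 (f \o (fun s : R => y + s *: v)) s) derive_comp //.
by rewrite [X in 'D_X f _]deriveE // (diff_val (is_diff_def := dl)) scale1r.
Qed.

Lemma derive_of_line (V W : normedModType R) (f : V -> W) (y v : V) d :
  differentiable f y -> is_derive (0 : R) 1 (fun s : R => f (y + s *: v)) d ->
  'D_v f y = d.
Proof.
move=> fd [_ <-].
have fd0 : differentiable f (y + 0 *: v) by rewrite scale0r addr0.
by have [_ ->] := is_derive_line fd0; rewrite scale0r addr0.
Qed.

Lemma open_setI_preimage (V W : topologicalType) (D : set V) (f : V -> W) (B : set W) :
  open D -> (forall x, D x -> {for x, continuous f}) -> open B ->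
  open [set x | D x /\ B (f x)].
Proof.
move=> oD fc oB; rewrite openE => x [Dx Bx]; rewrite /interior.
have nD : \forall y \near x, D y by exact: open_nbhs_nbhs.
have nB : \forall y \near x, B (f y) by apply: (fc x Dx); exact: open_nbhs_nbhs.
by apply: filterS2 nD nB => y.
Qed.

Lemma jacobian_rows n p (f : 'rV[R]_n -> 'rV[R]_p) x (M : 'M[R]_(n, p)) :
  differentiable f x -> (forall u, 'D_u f x = u *m M) -> jacobian f x = M.
Proof.
move=> fd fM; apply/row_matrixP => i.
by rewrite !rowE -deriveEjacobian // fM.
Qed.

End chain_rule.

Section commuting_flows.
Context {R : realType}.

Lemma is_derive_affine n (u : R -> 'rV[R]_n) (a b s : R) d :
  is_derive (a + s * b) 1 u d ->
  is_derive s 1 (fun s => u (a + s * b)) (b *: d).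
Proof.
move=> /is_derive_rV ud; apply/is_derive_rV => i.
have ld : is_derive s 1 (fun s : R => a + s *: b) (1 *: b).
  have [dl dlE] := differentiableP (ex_diff (is_diff_def := is_diff_line a b s)).
  apply: DeriveDef; first exact: diff_derivable.
  by rewrite deriveE // (diff_val (is_diff_def := is_diff_line a b s)).
rewrite scale1r in ld; rewrite mxE mulrC.
exact: (@is_derive1_comp _ (fun t => u t 0 i) (fun s => a + s * b)).
Qed.

Lemma derive_comm_rV n p (A : set 'rV[R]_n) (f : 'rV[R]_n -> 'rV[R]_p) x u v :
  open A -> A x -> Ck_on 2 A f ->
  'D_u (fun q => 'D_v f q) x = 'D_v (fun q => 'D_u f q) x.
Proof.
move=> oA Ax f2; have [fd fC] := f2.
have entry a b j : ('D_a (fun q => 'D_b f q) x) 0 j =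
    'D_a (fun q => 'D_b (fun q => f q 0 j) q) x.
  rewrite derive_mx; last by apply: diff_derivable; exact: (fC b).1.
  rewrite mxE; apply: near_eq_derive.
  apply: filterS (open_nbhs_nbhs (conj oA Ax)) => q Aq.
  by rewrite derive_mx ?mxE //; apply: diff_derivable; exact: fd.
apply/rowP => j; apply: etrans (entry u v j) (etrans _ (esym (entry v u j))).
exact: (derive_comm u v oA Ax (Ck_coord 0 j oA f2)).
Qed.

Definition flow_domain n (p0 : 'rV[R]_n) (tau r : R) :=
  [set y : 'rV[R]_(1 + n) | `|lsubmx y 0 0| < tau /\ ball p0 r (rsubmx y)].

Lemma open_flow_domain n (p0 : 'rV[R]_n) tau r : open (flow_domain p0 tau r).
Proof.
apply: openI; last by apply: open_rsubmx; exact: ball_open.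
apply: (@open_lsubmx R 1 n [set v | `|v 0 0| < tau]).
apply: (@open_comp _ _ (fun v : 'rV[R]_1 => `|v 0 0|) [set s | s < tau]).
  move=> v _; apply: (@continuous_comp _ _ _ (fun v : 'rV[R]_1 => v 0 0)).
    exact: coord_continuous.
  exact: norm_continuous.
exact: open_lt.
Qed.

Definition line0 n : 'rV[R]_(2 + (n + 2)) := row_mx (delta_mx 0 0) 0.
Definition line1 n : 'rV[R]_(2 + (n + 2)) := row_mx (delta_mx 0 1) 0.

Lemma row_decomposition n (u : 'rV[R]_(2 + (n + 2))) :
  u = lsubmx u 0 0 *: line0 n + lsubmx u 0 1 *: line1 n + row_mx 0 (rsubmx u).
Proof.
rewrite -{1}[u]hsubmxK !scale_row_mx !scaler0 !add_row_mx !addr0 add0r.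
congr row_mx; apply/rowP => i; rewrite !mxE.
by case: i => -[|[|//]] i2; rewrite /= ?mulr1 ?mulr0 ?addr0 ?add0r; congr (u 0 _); apply/val_inj.
Qed.

Section flows.
Variables (n : nat) (A : set 'rV[R]_(2 + (n + 2))).
Notation E := 'rV[R]_(2 + (n + 2)).
Variables (v w : E -> E) (p0 : E) (M : 'M[R]_(2 + (n + 2))).
Hypotheses (oA : open A) (vS : smooth_on A v) (wS : smooth_on A w).
Hypothesis commute : forall p, A p -> 'D_(v p) w p = 'D_(w p) v p.
Hypotheses (Mv : line0 n *m M = v p0) (Mw : line1 n *m M = w p0).
Variables (tauv rv tauw rw : R) (phiv phiw : R -> E -> E).
Hypotheses (tauv0 : 0 < tauv) (rv0 : 0 < rv) (tauw0 : 0 < tauw) (rw0 : 0 < rw).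
Hypothesis flowv : forall x, ball p0 rv x -> phiv 0 x = x /\
  forall t : R, `|t| < tauv -> A (phiv t x) /\ is_derive t 1 (phiv^~ x) (v (phiv t x)).
Hypothesis floww : forall x, ball p0 rw x -> phiw 0 x = x /\
  forall t : R, `|t| < tauw -> A (phiw t x) /\ is_derive t 1 (phiw^~ x) (w (phiw t x)).
Hypothesis phivS : smooth_on (flow_domain p0 tauv rv)
  (fun y : 'rV[R]_(1 + (2 + (n + 2))) => phiv (lsubmx y 0 0) (rsubmx y)).
Hypothesis phiwS : smooth_on (flow_domain p0 tauw rw)
  (fun y : 'rV[R]_(1 + (2 + (n + 2))) => phiw (lsubmx y 0 0) (rsubmx y)).

(** [sigma] parametrises an affine slice through [p0], spanned by the lower rows of [M]. [Psi]
    follows [w] from the slice for the second coordinate, and [Phi] then follows [v] for the first.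
    [Qw] and [Qv] feed these data to the joint flow maps; [Dw] and [D] are where they are
    admissible. *)
Let sigma (y : E) : E := p0 + row_mx 0 (rsubmx y) *m M.
Let Qw (y : E) : 'rV[R]_(1 + (2 + (n + 2))) :=
  row_mx (const_mx (lsubmx y 0 1)) (sigma y).
Let Dw := [set y : E | flow_domain p0 tauw rw (Qw y)].
Let Psi (y : E) := phiw (lsubmx y 0 1) (sigma y).
Let Qv (y : E) : 'rV[R]_(1 + (2 + (n + 2))) :=
  row_mx (const_mx (lsubmx y 0 0)) (Psi y).
Let D := [set y : E | Dw y /\ flow_domain p0 tauv rv (Qv y)].
Let Phi (y : E) := phiv (lsubmx y 0 0) (Psi y).

Let Ck_const k (B : set E) i : open B ->
  Ck_on k B (fun y : E => const_mx (lsubmx y 0 i) : 'rV[R]_1).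
Proof.
move=> oB; apply: Ck_mx => // i' j.
rewrite (_ : (fun x => _) = fun y : E => lsubmx y 0 i); last first.
  by apply/funext => y; rewrite mxE.
by apply: Ck_coord => //; exact: Ck_lsubmx.
Qed.

Let QwS : smooth_on setT Qw.
Proof.
move=> k; apply: Ck_row_mx; [exact: openT|apply: Ck_const; exact: openT|].
apply: CkD; [exact: openT|exact: Ck_cst|].
apply: Ck_mulmx; [exact: openT| |exact: Ck_cst].
by apply: Ck_row_mx; [exact: openT|exact: Ck_cst|exact: Ck_rsubmx].
Qed.

Let oDw : open Dw.
Proof.
apply: (@open_comp _ _ Qw); last exact: open_flow_domain.
by move=> y _; exact: (QwS 0).
Qed.

Let DwP y : Dw y <-> `|lsubmx y 0 1| < tauw /\ ball p0 rw (sigma y).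
Proof. by rewrite /Dw /flow_domain /= /Qw row_mxKl row_mxKr mxE. Qed.

Let PsiS : smooth_on Dw Psi.
Proof.
move=> k; have := Ck_comp oDw (@open_flow_domain _ p0 tauw rw) (fun _ Dy => Dy)
  (phiwS k) (Ck_sub (@subsetT _ _) (QwS k)).
by apply: Ck_congr => // y _; rewrite /= /Qw row_mxKl row_mxKr mxE.
Qed.

Let QvS : smooth_on Dw Qv.
Proof. by move=> k; apply: Ck_row_mx => //; exact: Ck_const. Qed.

Let oD : open D.
Proof.
apply: open_setI_preimage => //; last exact: open_flow_domain.
by move=> y Dy; exact: (QvS 0).
Qed.

Let DP y : D y <-> [/\ Dw y, `|lsubmx y 0 0| < tauv & ball p0 rv (Psi y)].
Proof.
rewrite /D /flow_domain /= /Qv row_mxKl row_mxKr mxE.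
by split=> [[? []]|[]].
Qed.

Let PhiS : smooth_on D Phi.
Proof.
move=> k; have DDw : D `<=` Dw by move=> y [].
have := Ck_comp oD (@open_flow_domain _ p0 tauv rv) (fun y Dy => Dy.2)
  (phivS k) (Ck_sub DDw (QvS k)).
by apply: Ck_congr => // y _; rewrite /= /Qv row_mxKl row_mxKr mxE.
Qed.

Let PhiA y : D y -> A (Phi y).
Proof. by move=> /DP[_ yt /flowv[_ /(_ _ yt)[]]]. Qed.

Let lsub_line (y : E) (s : R) (a : 'rV[R]_2) (b : 'rV[R]_(n + 2)) :
  lsubmx (y + s *: row_mx a b) = lsubmx y + s *: a.
Proof. by rewrite linearD linearZ /= row_mxKl. Qed.

Let rsub_line (y : E) (s : R) (a : 'rV[R]_2) (b : 'rV[R]_(n + 2)) :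
  rsubmx (y + s *: row_mx a b) = rsubmx y + s *: b.
Proof. by rewrite linearD linearZ /= row_mxKr. Qed.

Let Psi_line0 y s : Psi (y + s *: line0 n) = Psi y.
Proof.
by rewrite /Psi /sigma /line0 lsub_line rsub_line scaler0 addr0 !mxE /= mulr0 addr0.
Qed.

Let a0_line0 y s : lsubmx (y + s *: line0 n) 0 0 = lsubmx y 0 0 + s.
Proof. by rewrite /line0 lsub_line !mxE /= mulr1. Qed.

Let D_line0 y s : D y -> `|lsubmx y 0 0 + s| < tauv -> D (y + s *: line0 n).
Proof.
move=> /DP[/DwP[y1 ys] y0 yP] ts; apply/DP; rewrite Psi_line0 a0_line0; split=> //.
apply/DwP; move: y1 ys; rewrite /sigma /line0 lsub_line rsub_line.
by rewrite scaler0 addr0 !mxE /= mulr0 addr0.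
Qed.

Let Phid y : D y -> differentiable Phi y.
Proof. exact: (PhiS 1).1. Qed.

Let DPhi0 y : D y -> 'D_(line0 n) Phi y = v (Phi y).
Proof.
move=> Dy; apply: derive_of_line; first exact: Phid.
have /DP[_ yt /flowv[_ /(_ _ yt)[_ dv]]] := Dy.
have -> : (fun s : R => Phi (y + s *: line0 n)) =
    (fun s => phiv (lsubmx y 0 0 + s * 1) (Psi y)).
  by apply/funext => s; rewrite /Phi Psi_line0 a0_line0 mulr1.
rewrite -[v _]scale1r.
by apply: (@is_derive_affine _ (phiv^~ (Psi y))); rewrite mul0r addr0.
Qed.

Let near_line (y u : E) : D y -> \forall s \near (0 : R), D (y + s *: u).
Proof.
move=> Dy; have lc : (fun s : R => y + s *: u) @ (0 : R) --> y.
  have lc : (fun s : R => y + s *: u) @ (0 : R) --> y + 0 *: u.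
    exact: differentiable_continuous (ex_diff (is_diff_def := is_diff_line y u 0)).
  by rewrite scale0r addr0 in lc.
by apply: lc; exact: open_nbhs_nbhs.
Qed.

Let DPhi1_0 y : D y -> lsubmx y 0 0 = 0 -> 'D_(line1 n) Phi y = w (Phi y).
Proof.
move=> Dy y00; apply: derive_of_line; first exact: Phid.
have PhiPsi z : D z -> lsubmx z 0 0 = 0 -> Phi z = Psi z.
  by move=> /DP[_ _ /flowv[zP _]] z0; rewrite /Phi z0.
have a0 s : lsubmx (y + s *: line1 n) 0 0 = 0.
  by rewrite /line1 lsub_line !mxE /= mulr0 addr0 -[RHS]y00 mxE.
have /DP[/DwP[yt ys] _ _] := Dy.
have [_ /(_ _ yt)[_ dw]] := floww ys.
have PsiE s : Psi (y + s *: line1 n) = phiw (lsubmx y 0 1 + s * 1) (sigma y).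
  by rewrite /Psi /sigma /line1 lsub_line rsub_line scaler0 addr0 !mxE.
have dn : is_derive (0 : R) 1 (fun s => phiw (lsubmx y 0 1 + s * 1) (sigma y))
    (w (Psi y)).
  rewrite -[w _]scale1r.
  by apply: (@is_derive_affine _ (phiw^~ (sigma y))); rewrite mul0r addr0.
have nE : \forall s \near (0 : R), phiw (lsubmx y 0 1 + s * 1) (sigma y) =
    Phi (y + s *: line1 n).
  apply: filterS (near_line (line1 n) Dy) => s Ds.
  by rewrite -PsiE PhiPsi.
rewrite (PhiPsi y Dy y00).
exact: near_eq_is_derive nE dn.
Qed.

(** By [DPhi1_0] the claim holds where the first coordinate is 0. Along the segment [c] from there
    to [y], both ['D_(line1 n) Phi] and [w \o Phi] solve the same linear equation with coefficient
    [a *: jacobian v]: the former by symmetry of second derivatives, the latter by [commute]. Their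
    difference starts at 0 and so vanishes. *)
Let DPhi1 y : D y -> 'D_(line1 n) Phi y = w (Phi y).
Proof.
move=> Dy; set a := lsubmx y 0 0.
pose base := y - a *: line0 n; pose c (s : R) := base + s *: (a *: line0 n).
have cE s : c s = y + ((s - 1) * a) *: line0 n.
  by rewrite /c /base scalerA mulrBl mul1r scalerBl -addrA (addrC (- _)) .
have c1 : c 1 = y by rewrite /c /base scale1r subrK.
have Dc s : 0 <= s <= 1 -> D (c s).
  move=> /andP[s0 s1]; rewrite cE; apply: D_line0 => //.
  have /DP[_ yt _] := Dy; rewrite mulrBl mul1r addrCA subrr addr0 normrM.
  by rewrite (le_lt_trans _ yt) // ger0_norm // ler_piMl.
have DPhi0' z : D z -> 'D_(a *: line0 n) Phi z = a *: v (Phi z).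
  by move=> Dz; rewrite derive_dirZ ?DPhi0 //; exact: Phid.
have vd z : D z -> differentiable v (Phi z) by move=> /PhiA; exact: (vS 1).1.
have wd z : D z -> differentiable w (Phi z) by move=> /PhiA; exact: (wS 1).1.
have z0 : lsubmx (c 0) 0 0 = 0.
  by rewrite cE sub0r mulN1r a0_line0 subrr.
pose u s := 'D_(line1 n) Phi (c s) - w (Phi (c s)).
have ud (s : R) : 0 <= s <= 1 ->
    is_derive s 1 u (u s *m (a *: jacobian v (Phi (c s)))).
  move=> s01; have Dcs := Dc s s01.
  have d1 : is_derive s 1 (fun s => 'D_(line1 n) Phi (c s))
      ('D_(line1 n) Phi (c s) *m (a *: jacobian v (Phi (c s)))).
    have := @is_derive_line _ _ _ (fun z => 'D_(line1 n) Phi z) base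
      (a *: line0 n) s (((PhiS 2).2 _).1 _ Dcs).
    congr is_derive; rewrite -/(c s) (derive_comm_rV _ _ oD Dcs (PhiS 2)).
    transitivity ('D_(line1 n) (fun q => a *: v (Phi q)) (c s)).
      apply: near_eq_derive; apply: filterS (open_nbhs_nbhs (conj oD Dcs)) => z.
      exact: DPhi0'.
    have vPd : differentiable (v \o Phi) (c s).
      by apply: differentiable_comp; [exact: Phid|exact: vd].
    rewrite -scalemxAr -deriveEjacobian; last exact: vd.
    rewrite -derive_comp; [|exact: Phid|exact: vd].
    by rewrite deriveZ //; exact: diff_derivable.
  have d2 : is_derive s 1 (fun s => w (Phi (c s)))
      (w (Phi (c s)) *m (a *: jacobian v (Phi (c s)))).
    have wPd : differentiable (w \o Phi) (c s).
      by apply: differentiable_comp; [exact: Phid|exact: wd].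
    have := is_derive_line wPd; congr is_derive; rewrite -/(c s).
    rewrite derive_comp; [|exact: Phid|exact: wd].
    rewrite DPhi0' // -scalemxAr -deriveEjacobian; last exact: vd.
    rewrite -commute; last exact: PhiA.
    by rewrite derive_dirZ //; exact: wd.
  by rewrite /u mulmxBl; exact: is_deriveB.
suff : u 1 = 0 by rewrite /u c1 => /subr0_eq.
apply: (@linear_ode_unique _ _ (fun s => a *: jacobian v (Phi (c s))) u 1 _ _ ud).
- by rewrite lexx ler01.
- move=> s s01; apply: cvgZl_tmp.
  have Dcs := Dc s s01.
  apply: (@continuous_comp _ _ _ c (fun z => jacobian v (Phi z))).
    exact: differentiable_continuous (ex_diff (is_diff_def := is_diff_line _ _ _)).
  apply: (@continuous_comp _ _ _ Phi (fun z => jacobian v z)).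
    exact: differentiable_continuous (Phid Dcs).
  have J0 := Ck_jacobian (k := 0) oA (vS 1).
  exact: (J0 (Phi (c s)) (PhiA Dcs)).
- by rewrite /u DPhi1_0 ?subrr //; apply: Dc; rewrite lexx ler01.
Qed.

Let sigma0 : sigma 0 = p0.
Proof. by rewrite /sigma linear0 row_mx0 mul0mx addr0. Qed.

Let Psi0 : Psi 0 = p0.
Proof.
rewrite /Psi sigma0 linear0 mxE.
by have [] := floww (ballxx p0 rw0).
Qed.

Let D0 : D 0.
Proof.
apply/DP; rewrite Psi0 linear0 mxE normr0; split=> //; last exact: ballxx.
by apply/DwP; rewrite sigma0 linear0 mxE normr0; split=> //; exact: ballxx.
Qed.

Let Phi0 : Phi 0 = p0.
Proof.
rewrite /Phi Psi0 linear0 mxE.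
by have [] := flowv (ballxx p0 rv0).
Qed.

Let jacobian_Phi0 : jacobian Phi 0 = M.
Proof.
apply: jacobian_rows => [|u]; first exact: Phid.
rewrite [in RHS](row_decomposition u) !mulmxDl -!scalemxAl Mv Mw.
have Pd := Phid D0.
rewrite [in LHS](row_decomposition u) !derive_dirD // !derive_dirZ //.
rewrite DPhi0 // DPhi1 // Phi0; congr (_ + _).
apply: derive_of_line => //.
set r := row_mx 0 _.
have nE : \forall s \near (0 : R), (p0 + s *: (r *m M)) = Phi (0 + s *: r).
  apply: filterS (near_line r D0) => s /DP[/DwP[_ ys] _ yP].
  have l0 : lsubmx (0 + s *: r) = 0 by rewrite /r lsub_line scaler0 addr0 linear0.
  rewrite /Phi l0 mxE; have [-> _] := flowv yP.
  rewrite /Psi l0 mxE; have [-> _] := floww ys.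
  by rewrite /sigma /r rsub_line linear0 add0r scalemxAl scale_row_mx scaler0.
apply: near_eq_is_derive nE _.
have := @is_diff_line _ _ p0 (r *m M) 0 => dl.
apply: DeriveDef; first by apply: diff_derivable; exact: ex_diff.
rewrite deriveE; last exact: ex_diff.
by rewrite (diff_val (is_diff_def := dl)) scale1r.
Qed.

Lemma flow_parametrization : exists (O : set E) (F : E -> E),
  [/\ [/\ open O, O 0 & smooth_on O F], F 0 = p0, jacobian F 0 = M &
    forall y, O y -> [/\ A (F y), 'D_(line0 n) F y = v (F y) &
                         'D_(line1 n) F y = w (F y)]].
Proof.
exists D, Phi; split=> // y Dy.
by split; [exact: PhiA|exact: DPhi0|exact: DPhi1].
Qed.

End flows.

End commuting_flows.

(** * Straightening two commuting fields together with their first integrals *)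

Section flow_box.
Context {R : realType}.

Theorem flow_box n (A : set 'rV[R]_(2 + (n + 2)))
    (v w : 'rV[R]_(2 + (n + 2)) -> 'rV[R]_(2 + (n + 2)))
    (h : 'rV[R]_(2 + (n + 2)) -> 'rV[R]_2) p0 :
  open A -> A p0 -> smooth_on A v -> smooth_on A w -> smooth_on A h ->
  (forall p, A p -> 'D_(v p) w p = 'D_(w p) v p) ->
  (forall p, A p -> 'D_(v p) h p = 0 /\ 'D_(w p) h p = 0) ->
  h p0 = 0 -> row_free (col_mx (v p0) (w p0)) -> row_full (jacobian h p0) ->
  exists (O : set 'rV[R]_(2 + (n + 2)))
    (th et : 'rV[R]_(2 + (n + 2)) -> 'rV[R]_(2 + (n + 2))) (e : R),
  [/\ [/\ 0 < e, open O, O p0 & O `<=` A],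
      th @` O = ball 0 e /\ (forall p, O p -> et (th p) = p),
      smooth_on O th /\ smooth_on (ball 0 e) et &
      forall p, O p -> [/\ 'D_(v p) th p = line0 n, 'D_(w p) th p = line1 n &
                           rsubmx (rsubmx (th p)) = h p]].
Proof.
move=> oA Ap0 vS wS hS comm hinv h0 Ufree Nfull.
have hd p : A p -> differentiable h p by exact: (hS 1).1.
have UN : col_mx (v p0) (w p0) *m jacobian h p0 = 0.
  have [hv hw] := hinv p0 Ap0; have hd0 := hd p0 Ap0.
  by rewrite mul_col_mx -!deriveEjacobian // hv hw col_mx0.
have [M [Mu MU MN]] :=
  @adapted_basis R n (col_mx (v p0) (w p0)) (jacobian h p0) Ufree Nfull UN.
have Mline (a : 'rV[R]_2) : row_mx a 0 *m M = a *m (col_mx (v p0) (w p0) : 'M[R]_(2, 2 + (n + 2))).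
  by rewrite -[M]vsubmxK mul_row_col mul0mx addr0 MU.
have Mv : line0 n *m M = v p0.
  rewrite Mline -rowE; apply/rowP => j; rewrite !mxE.
  by case: splitP => k; rewrite !ord1.
have Mw : line1 n *m M = w p0.
  rewrite Mline -rowE; apply/rowP => j; rewrite !mxE.
  by case: splitP => k; rewrite !ord1.
have [tv [rv [phv [tv0 rv0 phvP phvS]]]] := local_flow oA Ap0 vS.
have [tw [rw [phw [tw0 rw0 phwP phwS]]]] := local_flow oA Ap0 wS.
have [Q1 [F [[openQ1 Q10 FS] F0 JF FP]]] := flow_parametrization oA vS wS comm
  Mv Mw tv0 rv0 tw0 rw0 phvP phwP phvS phwS.
have Fu : jacobian F 0 \in unitmx by rewrite JF.
have Fd y : Q1 y -> differentiable F y by exact: (FS 1).1.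
have [Q2 [g [[openQ2 Q20 Q21] oF gK gS _]]] := inverse_function openQ1 Q10 FS Fu.
(* The last pair of flow coordinates gives way to [h] itself. By the choice of [M], the derivative
   of [h \o F] at 0 is already the projection to that pair, so the Jacobian of [G] at 0 is the
   identity. *)
pose G (y : 'rV[R]_(2 + (n + 2))) : 'rV[R]_(2 + (n + 2)) :=
  row_mx (lsubmx y) (row_mx (lsubmx (rsubmx y)) (h (F y))).
have FA y : Q2 y -> A (F y) by move=> /Q21/FP[].
have hFS : smooth_on Q2 (h \o F).
  by move=> k; apply: (Ck_comp openQ2 oA FA (hS k)); exact: Ck_sub Q21 (FS k).
have GS : smooth_on Q2 G.
  move=> k; apply: Ck_row_mx => //; first exact: Ck_lsubmx.
  apply: (Ck_row_mx openQ2 _ (hFS k)).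
  apply: (Ck_comp openQ2 openT (fun _ _ => I) (Ck_lsubmx k _)); exact: Ck_rsubmx.
have DG y u : Q2 y -> 'D_u G y =
    row_mx (lsubmx u) (row_mx (lsubmx (rsubmx u)) ('D_('D_u F y) h (F y))).
  move=> Oy; have Gd : differentiable G y by exact: (GS 1).1.
  apply: derive_of_line => //.
  have hFd : differentiable (h \o F) y by exact: (hFS 1).1.
  have hl : is_derive (0 : R) 1 (fun s : R => h (F (y + s *: u))) ('D_('D_u F y) h (F y)).
    have hl0 : differentiable (h \o F) (y + 0 *: u) by rewrite scale0r addr0.
    have := is_derive_line hl0; rewrite scale0r addr0 derive_comp //.
      exact/Fd/Q21.
    exact/hd/FA.
  have ll p q (f : {linear 'rV[R]_p -> 'rV[R]_q}) (a b : 'rV[R]_p) :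
      is_derive (0 : R) 1 (fun s : R => f (a + s *: b)) (f b).
    have fd : differentiable f (a + 0 *: b).
      exact: linear_differentiable (@linear_rV_continuous _ _ _ f).
    have := is_derive_line fd; rewrite deriveE // diff_lin //.
    exact: linear_rV_continuous.
  have l1 := ll _ _ lsubmx y u.
  have l2 := ll _ _ (lsubmx \o rsubmx) y u.
  exact: is_derive_row_mx l1 (is_derive_row_mx l2 hl).
have G0 : G 0 = 0 by rewrite /G F0 h0 !linear0 !row_mx0.
have JG : jacobian G 0 = 1%:M.
  apply: jacobian_rows => [|u]; first exact: (GS 1).1.
  have hdF0 : differentiable h (F 0) by exact/hd/FA.
  have FdF0 : differentiable F 0 by exact/Fd.
  rewrite DG // [in 'D_u F 0]deriveEjacobian // JF deriveEjacobian // F0 -mulmxA MN.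
  rewrite -{3}[u]hsubmxK -{2}[rsubmx u]hsubmxK mulmx1.
  by rewrite !mul_row_col !mulmx0 mulmx1 !add0r !hsubmxK.
have Gu : jacobian G 0 \in unitmx by rewrite JG unitmx1.
have [Q3 [g' [[openQ3 Q30 Q32] oG g'K g'S _]]] := inverse_function openQ2 Q20 GS Gu.
have /nbhs_ballP[e /= e0 eG] : nbhs (0 : 'rV[R]_(2 + (n + 2))) (G @` Q3).
  by apply: open_nbhs_nbhs; split => //; exists 0.
have Q3F y : Q3 y -> (F @` Q2) (F y) by move=> Q3y; exists y => //; exact: Q32.
pose B : set 'rV[R]_(2 + (n + 2)) := ball 0 e.
have oB : open B by exact: ball_open.
(* The condition on [G] makes the image of the new coordinates exactly the cube [B]. *)
pose O := [set p | (F @` Q2) p /\ [set y | Q3 y /\ B (G y)] (g p)].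
have oO : open O.
  apply: open_setI_preimage => //; first by move=> p Fp; exact: (gS 0).
  by apply: open_setI_preimage => // y /Q32; exact: (GS 0).
have OP p : O p -> exists y, [/\ Q3 y, B (G y), g p = y & F y = p].
  move=> [[y Q2y <-] [Q3g BG]]; exists (g (F y)); split=> //.
  by rewrite gK.
have OF y : Q3 y -> B (G y) -> O (F y).
  by move=> Q3y By; split; [exact: Q3F|rewrite /= gK //; exact: Q32].
have gO p : O p -> Q2 (g p) by move=> /OP[y [/Q32 ? _ -> _]].
have thS : smooth_on O (G \o g).
  move=> k; apply: (Ck_comp oO openQ2 gO (GS k)).
  by apply: Ck_sub (gS k) => p [].
exists O, (G \o g), (F \o g'), e; split.
- split=> //; last by move=> p /OP[y [/Q32/FA + _ _ <-]].
  rewrite -F0; apply: OF; first exact: Q30.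
  by rewrite G0; exact: ballxx.
- split.
    apply/seteqP; split=> [q [p /OP[y [_ By gy _]] <-] /=|q Bq]; first by rewrite gy.
    have [y Q3y Gy] := eG q Bq.
    have By : B (G y) by rewrite Gy.
    exists (F y); first exact: OF.
    by rewrite /= gK //; exact: Q32.
  by move=> p /OP[y [Q3y _ gy <-]]; rewrite /= gK ?g'K //; exact: Q32.
- split=> // k.
  apply: (Ck_comp oB openQ1 _ (FS k)); last exact: Ck_sub eG (g'S k).
  by move=> q /eG[y Q3y <-]; rewrite g'K //; exact/Q21/Q32.
- move=> p Op; have [y [Q3y By gy Fy]] := OP p Op.
  have Q2y := Q32 _ Q3y; have [_ Fv Fw] := FP y (Q21 _ Q2y).
  have Ap : A p by rewrite -Fy; exact: FA.
  have thd : differentiable (G \o g) (F y) by rewrite Fy; exact: (thS 1).1.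
  have thE u : 'D_('D_u F y) (G \o g) p = 'D_u G y.
    rewrite -{1}Fy -derive_comp //; last exact/Fd/Q21.
    apply: near_eq_derive.
    apply: filterS (open_nbhs_nbhs (conj openQ2 Q2y)) => z Q2z.
    by rewrite /= gK.
  have [hv hw] := hinv p Ap.
  have vE : v p = 'D_(line0 n) F y by rewrite Fv Fy.
  have wE : w p = 'D_(line1 n) F y by rewrite Fw Fy.
  split.
  + by rewrite vE thE DG // -vE Fy hv /line0 row_mxKl row_mxKr linear0 row_mx0.
  + by rewrite wE thE DG // -wE Fy hw /line1 row_mxKl row_mxKr linear0 row_mx0.
  + by rewrite /= gy /G !row_mxKr Fy.
Qed.

End flow_box.

(** * Charts and pseudo-holomorphic Hamiltonian systems *)

Section charts.
Context {R : realType} {m : nat}.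

Lemma open_chart_image (X : topologicalType) (c : chart R m X) (U : set X) :
  open U -> open (cmap c @` (cdom c `&` U)).
Proof.
move=> oU; have -> : cmap c @` (cdom c `&` U) =
    [set p | (cmap c @` cdom c) p /\ U (cinv c p)].
  apply/seteqP; split=> [p [x [cx Ux] <-]|p [[x cx <-]]].
    by split; [exists x|rewrite cmapK].
  by rewrite cmapK // => Ux; exists x.
apply: open_setI_preimage => //; first exact: img_open.
exact: cinv_cont.
Qed.

Lemma cinv_dom (X : topologicalType) (c : chart R m X) p :
  (cmap c @` cdom c) p -> cdom c (cinv c p) /\ cmap c (cinv c p) = p.
Proof. by move=> [x cx <-]; rewrite cmapK. Qed.

Lemma near_cdom (X : topologicalType) (c : chart R m X) (u : R -> X) (t : R) :
  {for t, continuous u} -> cdom c (u t) -> \forall s \near t, cdom c (u s).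
Proof.
move=> uc cu; apply: uc; apply: open_nbhs_nbhs; split=> //; exact: cdom_open.
Qed.

Section refined_chart.
Variables (X : topologicalType) (c : chart R m X).
Variables (O B : set 'rV[R]_m) (th et : 'rV[R]_m -> 'rV[R]_m).
Hypotheses (oO : open O) (oB : open B) (Oc : O `<=` cmap c @` cdom c).
Hypotheses (thO : th @` O = B) (etK : forall p, O p -> et (th p) = p).
Hypotheses (thS : smooth_on O th) (etS : smooth_on B et).

Let dom := [set x | cdom c x /\ O (cmap c x)].

Let BO p : B p -> O (et p) /\ th (et p) = p.
Proof. by rewrite -thO => -[q Oq <-]; rewrite etK. Qed.

Let img : (th \o cmap c) @` dom = B.
Proof.
apply/seteqP; split=> [p [x [_ Ox] <-]|p Bp]; first by rewrite -thO; exists (cmap c x).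
have [Op pE] := BO Bp; have [cx xE] := cinv_dom (Oc Op).
by exists (cinv c (et p)); rewrite /dom /= xE.
Qed.

Let dom_open : open dom.
Proof.
apply: open_setI_preimage => //; [exact: cdom_open|exact: cmap_cont].
Qed.

Let img_open' : open ((th \o cmap c) @` dom).
Proof. by rewrite img. Qed.

Let mapK x : dom x -> (cinv c \o et) ((th \o cmap c) x) = x.
Proof. by move=> [cx Ox]; rewrite /= etK // cmapK. Qed.

Let map_cont x : dom x -> {for x, continuous (th \o cmap c)}.
Proof.
move=> [cx Ox]; apply: continuous_comp; first exact: cmap_cont.
exact: (thS 0).
Qed.

Let inv_cont p : ((th \o cmap c) @` dom) p -> {for p, continuous (cinv c \o et)}.
Proof.
rewrite img => Bp; have [Op _] := BO Bp.
by apply: continuous_comp; [exact: (etS 0)|apply: cinv_cont; exact: Oc].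
Qed.

Definition refined_chart : chart R m X :=
  Chart dom_open img_open' mapK map_cont inv_cont.

Lemma refined_chart_img : cmap refined_chart @` cdom refined_chart = B.
Proof. exact: img. Qed.

Lemma refined_chart_smooth (c' : chart R m X) :
  transition_smooth c c' -> transition_smooth c' c ->
  transition_smooth refined_chart c' /\ transition_smooth c' refined_chart.
Proof.
move=> cc' c'c; split=> k.
  have oS := (@open_chart_image _ refined_chart _) (cdom_open c').
  have oS' := (@open_chart_image _ c _) (cdom_open c').
  have SB : cmap refined_chart @` (cdom refined_chart `&` cdom c') `<=` B.
    by rewrite -refined_chart_img => p [x [cx _] <-]; exists x.
  apply: (Ck_comp oS oS' _ (cc' k) (Ck_sub SB (etS k))).
  by move=> p [x [[cx Ox] c'x] <-]; rewrite /= etK //; exists x.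
have oS := (@open_chart_image _ c' _) (cdom_open refined_chart).
have SS' : cmap c' @` (cdom c' `&` cdom refined_chart) `<=`
    cmap c' @` (cdom c' `&` cdom c).
  by move=> p [x [c'x [cx _]] <-]; exists x.
apply: (Ck_comp oS oO _ (thS k) (Ck_sub SS' (c'c k))).
by move=> p [x [c'x [cx Ox]] <-]; rewrite /= cmapK.
Qed.

End refined_chart.

(** Transition maps of the refined chart are those of [c] composed with [th] or [et]; maximality of
    the atlas then admits it. *)
Lemma refined_chart_atlas (X : manifold R m) (c : chart R m X) (O B : set 'rV[R]_m)
    (th et : 'rV[R]_m -> 'rV[R]_m) (oO : open O) (oB : open B)
    (Oc : O `<=` cmap c @` cdom c) (thO : th @` O = B)
    (etK : forall p, O p -> et (th p) = p) (thS : smooth_on O th)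
    (etS : smooth_on B et) :
  atlas c -> atlas (refined_chart oO oB Oc thO etK thS etS).
Proof.
move=> ac; apply: atlas_max => c' ac'.
by apply: refined_chart_smooth; apply: atlas_compat.
Qed.

Lemma derive_dtrans (X : manifold R m) (c c' : chart R m X) x v :
  atlas c -> atlas c' -> cdom c x -> cdom c' x ->
  differentiable (cmap c' \o cinv c) (cmap c x) /\
  dtrans c c' x v = 'D_v (cmap c' \o cinv c) (cmap c x).
Proof.
move=> ac ac' cx c'x.
have td : differentiable (cmap c' \o cinv c) (cmap c x).
  by apply: (atlas_compat ac ac' 1).1; exists x.
by split=> //; rewrite /dtrans -deriveE.
Qed.

Lemma is_derive_comp_rV n p (u : R -> 'rV[R]_n) (f : 'rV[R]_n -> 'rV[R]_p)
    (t : R) d :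
  is_derive t 1 u d -> differentiable f (u t) ->
  is_derive t 1 (f \o u) ('D_d f (u t)).
Proof.
move=> [ud <-] fd; have ud' := (derivable1_diffP _ _).1 ud.
apply: DeriveDef; first by apply: diff_derivable; exact: differentiable_comp.
exact: derive_comp.
Qed.

(** [integral_curve] asks for the derivative in every chart around the point; the transformation law
    of [V] and the chain rule reduce this to one chart. *)
Lemma is_derive_change_chart (X : manifold R m) (V : vfield X) (c c' : chart R m X)
    (u : R -> X) (t : R) :
  smooth_vfield V -> atlas c -> atlas c' -> {for t, continuous u} ->
  cdom c (u t) -> cdom c' (u t) ->
  is_derive t 1 (cmap c \o u) (V c (u t)) ->
  is_derive t 1 (cmap c' \o u) (V c' (u t)).
Proof.
move=> [_ VT] ac ac' uc cu c'u ud.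
have [td tE] := derive_dtrans (V c (u t)) ac ac' cu c'u.
rewrite (VT c c') // tE.
have := is_derive_comp_rV ud td; apply: near_eq_is_derive.
by apply: filterS (near_cdom uc cu) => s cus; rewrite /= cmapK.
Qed.

End charts.

(** * Bilinear forms and commutation of Hamiltonian fields *)

Section bilinear.
Context {R : realType} {m : nat}.
Implicit Types (B : 'M[R]_m) (v w u : 'rV[R]_m).

Lemma bilDl B u v w : bil B (u + v) w = bil B u w + bil B v w.
Proof. by rewrite /bil !mulmxDl mxE. Qed.

Lemma bilNl B v w : bil B (- v) w = - bil B v w.
Proof. by rewrite /bil !mulNmx mxE. Qed.

Lemma bilBl B u v w : bil B (u - v) w = bil B u w - bil B v w.
Proof. by rewrite bilDl bilNl. Qed.

Lemma bilZl B a v w : bil B (a *: v) w = a * bil B v w.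
Proof. by rewrite /bil -!scalemxAl mxE. Qed.

Lemma bilNr B v w : bil B v (- w) = - bil B v w.
Proof. by rewrite /bil linearN mulmxN mxE. Qed.

Lemma bil_tr B v w : bil B v w = bil B^T w v.
Proof. by rewrite /bil -[v *m B *m w^T]trmxK [in LHS]mxE !trmx_mul trmxK mulmxA. Qed.

Lemma bil_skew B v w : B^T = - B -> bil B v w = - bil B w v.
Proof. by move=> BT; rewrite bil_tr BT /bil mulmxN mulNmx mxE. Qed.

Lemma bil_nondegenerate B v : B \in unitmx -> (forall w, bil B v w = 0) -> v = 0.
Proof.
move=> Bu v0; suff : v *m B = 0.
  by move/(congr1 (mulmx^~ (invmx B))); rewrite /= mulmxK // mul0mx.
apply/rowP => j; have := v0 (delta_mx 0 j).
by rewrite /bil trmx_delta -colE mxE => ->; rewrite mxE.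
Qed.

Lemma bil_sum B v w : bil B v w = \sum_i \sum_j v 0 i * B i j * w 0 j.
Proof.
rewrite /bil mxE exchange_big /=; apply: eq_bigr => j _.
by rewrite !mxE big_distrl.
Qed.

Lemma Ck_bil k (V : normedModType R) (A : set V) (f : V -> 'M[R]_m)
    (x y : V -> 'rV[R]_m) : open A ->
  Ck_on k A f -> Ck_on k A x -> Ck_on k A y ->
  Ck_on k A (fun q => bil (f q) (x q) (y q)).
Proof.
move=> oA fk xk yk.
rewrite (_ : (fun q => _) = fun q => \sum_i \sum_j x q 0 i * f q i j * y q 0 j).
  apply: Ck_sum => // i _; apply: Ck_sum => // j _.
  by apply: CkM => //; [apply: CkM => //|]; exact: Ck_coord.
by apply/funext => q; rewrite bil_sum.
Qed.

Lemma derive_mul3 (V : normedModType R) (f g h : V -> R) (p a : V) :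
  derivable f p a -> derivable g p a -> derivable h p a ->
  'D_a (fun q => f q * g q * h q) p =
    'D_a f p * g p * h p + f p * 'D_a g p * h p + f p * g p * 'D_a h p.
Proof.
move=> fd gd hd; rewrite (deriveM (derivableM fd gd) hd) (deriveM fd gd).
rewrite -![_ *: _]/(_ * _) -[(f * g) p]/(f p * g p); ring.
Qed.

Lemma derive_entry (V : normedModType R) p q (M : V -> 'M[R]_(p, q)) (x a : V) i j :
  derivable M x a -> 'D_a (fun y => M y i j) x = ('D_a M x) i j.
Proof. by move=> Md; rewrite (derive_mx Md) mxE. Qed.

Lemma derive_bil (V : normedModType R) (f : V -> 'M[R]_m)
    (x y : V -> 'rV[R]_m) (p a : V) :
  derivable f p a -> derivable x p a -> derivable y p a ->
  'D_a (fun q => bil (f q) (x q) (y q)) p =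
    bil ('D_a f p) (x p) (y p) + bil (f p) ('D_a x p) (y p) +
    bil (f p) (x p) ('D_a y p).
Proof.
move=> fd xd yd; rewrite !bil_sum -!big_split /=.
rewrite (_ : (fun q => _) = \sum_i \sum_j
    (fun q => x q 0 i * f q i j * y q 0 j)); last first.
  by apply/funext => q; rewrite bil_sum fct_sumE; apply: eq_bigr => i _; rewrite fct_sumE.
have xi i := (derivable_mxP _ _ _).1 xd 0 i.
have yi i := (derivable_mxP _ _ _).1 yd 0 i.
have fi := (derivable_mxP _ _ _).1 fd.
have d3 i j := derivableM (derivableM (xi i) (fi i j)) (yi j).
rewrite (derive_sum (fun i => derivable_sum (d3 i))).
apply: eq_bigr => i _; rewrite (derive_sum (d3 i)) -!big_split /=.
apply: eq_bigr => j _; apply: etrans (derive_mul3 (xi i) (fi i j) (yi j)) _.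
rewrite (derive_entry _ _ xd) (derive_entry _ _ fd) (derive_entry _ _ yd).
by rewrite (addrC (_ * _ * _) (_ * _ * _)).
Qed.

End bilinear.

(** The [t] terms are derivatives of the form, the [b] terms are the form applied to derivatives of
    the fields, and a prime swaps the two arguments of the form. The first hypothesis is closedness,
    the next two are the symmetry of the Hessians of [g] and [f], and the fourth is the derivative
    of the vanishing pairing of [v] and [w]. *)
Lemma bracket_cancel (R : realFieldType) (t1 t2 t3 t2' t3' b1 b2 b3 b4 b4' : R) :
  t1 + t2' + t3 = 0 -> t1 + b1 = t3' + b4' -> t2 + b2 = t3 + b3 ->
  t3 + b3 + b4 = 0 -> t2' = - t2 -> t3' = - t3 -> b4' = - b4 -> b1 - b2 = 0.
Proof. by lra. Qed.

(* With Omega(v, .) = - df, Omega(w, .) = dg and Omega(v, w) = 0, closedness of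
   Omega and the symmetry of the Hessians of f and g give Omega([v, w], .) = 0. *)
Lemma hamiltonian_fields_commute (R : realType) m (A : set 'rV[R]_m)
    (Om : 'rV[R]_m -> 'M[R]_m) (v w : 'rV[R]_m -> 'rV[R]_m) (f g : 'rV[R]_m -> R) :
  open A -> Ck_on 1 A Om -> Ck_on 1 A v -> Ck_on 1 A w -> Ck_on 2 A f -> Ck_on 2 A g ->
  (forall p, A p -> (Om p)^T = - Om p /\ Om p \in unitmx) ->
  (forall p u, A p -> bil (Om p) (v p) u = - 'D_u f p) ->
  (forall p u, A p -> bil (Om p) (w p) u = 'D_u g p) ->
  (forall p, A p -> bil (Om p) (v p) (w p) = 0) ->
  (forall p a b c, A p -> 'D_a (fun q => bil (Om q) b c) p +
     'D_b (fun q => bil (Om q) c a) p + 'D_c (fun q => bil (Om q) a b) p = 0) ->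
  forall p, A p -> 'D_(v p) w p = 'D_(w p) v p.
Proof.
move=> oA Om1 v1 w1 f2 g2 OmP vf wg vw closed p Ap.
have [OmT Omu] := OmP p Ap.
have Od a : derivable Om p a by apply: diff_derivable; exact: Om1.1.
have vd a : derivable v p a by apply: diff_derivable; exact: v1.1.
have wd a : derivable w p a by apply: diff_derivable; exact: w1.1.
have cd (c a : 'rV[R]_m) : derivable (fun _ : 'rV[R]_m => c) p a by exact: derivable_cst.
have nA : \forall q \near p, A q by exact: open_nbhs_nbhs.
have bil0 B (c : 'rV[R]_m) : bil B c 0 = 0 by rewrite /bil trmx0 mulmx0 mxE.
have bil0l B (c : 'rV[R]_m) : bil B 0 c = 0 by rewrite /bil !mul0mx mxE.
have T a b c : 'D_a (fun q => bil (Om q) b c) p = bil ('D_a Om p) b c.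
  by rewrite derive_bil // !derive_cst bil0 bil0l !addr0.
have Tskew a b c : bil ('D_a Om p) b c = - bil ('D_a Om p) c b.
  rewrite -!T -deriveN; last first.
    by apply: diff_derivable; apply: (Ck_bil oA Om1 (Ck_cst _ _ _) (Ck_cst _ _ _)).1.
  apply: near_eq_derive; apply: filterS nA => q Aq.
  by apply: bil_skew; have [] := OmP q Aq.
have Dv a x : bil ('D_a Om p) (v p) x + bil (Om p) ('D_a v p) x =
    - 'D_a (fun q => 'D_x f q) p.
  rewrite -deriveN; last by apply: diff_derivable; exact: (f2.2 x).1.
  transitivity ('D_a (fun q => bil (Om q) (v q) x) p).
    by rewrite derive_bil // derive_cst bil0 addr0.
  by apply: near_eq_derive; apply: filterS nA => q Aq; exact: vf.
have Dw a x : bil ('D_a Om p) (w p) x + bil (Om p) ('D_a w p) x =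
    'D_a (fun q => 'D_x g q) p.
  transitivity ('D_a (fun q => bil (Om q) (w q) x) p).
    by rewrite derive_bil // derive_cst bil0 addr0.
  by apply: near_eq_derive; apply: filterS nA => q Aq; exact: wg.
have Dvw x : bil ('D_x Om p) (v p) (w p) + bil (Om p) ('D_x v p) (w p) +
    bil (Om p) (v p) ('D_x w p) = 0.
  rewrite -derive_bil // -[RHS](derive_cst 0 p x).
  by apply: near_eq_derive; apply: filterS nA => q Aq; rewrite vw.
apply/subr0_eq/(bil_nondegenerate Omu) => x; rewrite bilBl.
have C0 := closed p (v p) (w p) x Ap.
have C1 := etrans (esym (congr2 +%R (congr2 +%R (T _ _ _) (T _ _ _)) (T _ _ _))) C0.
have E1 := etrans (Dw (v p) x) (etrans (derive_comm _ _ oA Ap g2) (esym (Dw x (v p)))).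
have E2 := etrans (Dv (w p) x) (etrans (congr1 -%R (derive_comm _ _ oA Ap f2))
  (esym (Dv x (w p)))).
exact: bracket_cancel C1 E1 E2 (Dvw x) (Tskew (w p) x (v p)) (Tskew x (w p) (v p))
  (bil_skew ('D_x w p) (v p) OmT).
Qed.

(** * Pointwise algebra of [V], [J V] and [dH] *)

Section phhs.
Context {R : realType} {m : nat} (X : manifold R m) (J om : mxfield X).
Variables (HR HI : X -> R) (V : vfield X).
Hypotheses (hX : phhs J om HR) (hV : hamiltonian_vf om HR V).
Hypothesis hHI : is_primitive (interior_prod om (Jvf J V)) HI.
Local Notation W := (Jvf J V).

Lemma phhs_bilJ c x : atlas c -> cdom c x -> forall v w,
  bil (om c x) (v *m J c x) w = bil (om c x) v (w *m J c x).
Proof.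
move=> ac cx v w; have JJ := (phhs_almost_complex hX).2 c x ac cx.
have := phhs_anti hX ac cx v (w *m J c x).
by rewrite -mulmxA JJ mulmxN mulmx1 bilNr => /oppr_inj.
Qed.

Lemma phhs_dHR c x u : atlas c -> cdom c x ->
  bil (om c x) (V c x) u = - dfun HR c x u.
Proof. by move=> ac cx; exact: hV.2. Qed.

Lemma phhs_dHI c x u : atlas c -> cdom c x ->
  bil (om c x) (W c x) u = dfun HI c x u.
Proof. by move=> ac cx; rewrite hHI.2. Qed.

Lemma phhs_skew c x v w : atlas c -> cdom c x ->
  bil (om c x) v w = - bil (om c x) w v.
Proof.
by move=> ac cx; apply: bil_skew; have [_ /(_ c x ac cx)[]] := phhs_symplectic hX.
Qed.

(** [J] is self-adjoint for a skew form, so the pairing of [V] with [J V] is its own negative. *)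
Lemma phhs_bilVW c x : atlas c -> cdom c x -> bil (om c x) (V c x) (W c x) = 0.
Proof.
move=> ac cx; have := phhs_skew (V c x) (W c x) ac cx.
by rewrite {2}/Jvf phhs_bilJ // -/(W c x); lra.
Qed.

Lemma phhs_invariant c x : atlas c -> cdom c x ->
  [/\ dfun HR c x (V c x) = 0, dfun HI c x (V c x) = 0,
      dfun HR c x (W c x) = 0 & dfun HI c x (W c x) = 0].
Proof.
move=> ac cx; have VW := phhs_bilVW ac cx.
have := phhs_dHR (V c x) ac cx; have := phhs_dHR (W c x) ac cx.
rewrite -!phhs_dHI // (phhs_skew (W c x) (V c x) ac cx) VW.
have := phhs_skew (V c x) (V c x) ac cx; have := phhs_skew (W c x) (W c x) ac cx.
by split; lra.
Qed.

Lemma Jvf_smooth : smooth_vfield W.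
Proof.
have [VS VT] := hV.1; have [[JS JT] _] := phhs_almost_complex hX; split.
  move=> c ac k; apply: Ck_mulmx; [exact: img_open|exact: VS|exact: JS].
by move=> c c' x ac ac' cx c'x; rewrite /Jvf (VT c c') // JT.
Qed.

Lemma J_invariant_plane c x (a b : R) : atlas c -> cdom c x ->
  (a *: V c x + b *: W c x) *m J c x = - b *: V c x + a *: W c x.
Proof.
move=> ac cx; have JJ := (phhs_almost_complex hX).2 c x ac cx.
rewrite mulmxDl -!scalemxAl {2}/Jvf -mulmxA JJ mulmxN mulmx1 scalerN -scaleNr.
by rewrite addrC.
Qed.

(** With [phhs_dHI_J] these are the Cauchy-Riemann equations of [HR + i HI]; they make the kernel of
    [dH], the tangent space of the level, invariant under [J]. *)
Lemma phhs_dHR_J c x u : atlas c -> cdom c x ->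
  dfun HR c x (u *m J c x) = - dfun HI c x u.
Proof.
move=> ac cx; have := phhs_dHR (u *m J c x) ac cx.
by rewrite -phhs_bilJ // phhs_dHI // => ->; rewrite opprK.
Qed.

Lemma phhs_dHI_J c x u : atlas c -> cdom c x ->
  dfun HI c x (u *m J c x) = dfun HR c x u.
Proof.
move=> ac cx; have JJ := (phhs_almost_complex hX).2 c x ac cx.
rewrite -phhs_dHI // -phhs_bilJ // /Jvf -mulmxA JJ mulmxN mulmx1 bilNl phhs_dHR //.
by rewrite opprK.
Qed.

Section regular_point.
Variables (c : chart R m X) (x : X).
Hypotheses (ac : atlas c) (cx : cdom c x).
Hypothesis reg : exists v, dhamC HR HI c x v <> 0.

Lemma phhs_V_neq0 : V c x != 0.
Proof.
apply/eqP => V0; have [v] := reg; apply.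
rewrite /dhamC -phhs_dHI // /Jvf -[dfun HR c x v]opprK -phhs_dHR // V0 mul0mx.
have b0 : bil (om c x) 0 v = 0 by rewrite /bil !mul0mx mxE.
by rewrite b0 oppr0.
Qed.

(** Applying [J] to the relation gives a second one; combining them with coefficients [a] and [- b]
    eliminates [W] and leaves [(a^2 + b^2) V = 0]. *)
Lemma phhs_independent (a b : R) : a *: V c x + b *: W c x = 0 -> a = 0 /\ b = 0.
Proof.
move=> ab; have := congr1 (mulmx^~ (J c x)) ab.
rewrite /= J_invariant_plane // mul0mx => ba.
have : (a ^+ 2 + b ^+ 2) *: V c x = 0.
  have := congr2 (fun y z => a *: y - b *: z) ab ba; rewrite /= !scaler0 subr0.
  by move=> <-; apply/rowP => i; rewrite !mxE; ring.
move/eqP; rewrite scaler_eq0 (negbTE phhs_V_neq0) orbF.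
by rewrite paddr_eq0 ?sqr_ge0 // !sqrf_eq0 => /andP[/eqP -> /eqP ->].
Qed.

Lemma phhs_row_free : row_free (col_mx (V c x) (W c x)).
Proof.
apply: inj_row_free => a.
rewrite -[a]hsubmxK mul_row_col [lsubmx a]mx11_scalar [rsubmx a]mx11_scalar.
rewrite !mul_scalar_mx => /phhs_independent[-> ->].
by rewrite !raddf0 row_mx0.
Qed.

(** The symplectic form turns a linear relation between the two differentials into one between [V]
    and [W], which are independent. *)
Lemma phhs_row_full (N : 'M[R]_(m, 2)) :
  (forall u, u *m N = \row_j (if j == 0 then dfun HR c x u else dfun HI c x u)) ->
  row_full N.
Proof.
move=> NE; rewrite /row_full -mxrank_tr -/(row_free N^T).
apply: inj_row_free => b bN.
have bu u : - b 0 0 * bil (om c x) (V c x) u + b 0 1 * bil (om c x) (W c x) u = 0.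
  have : (b *m N^T *m u^T) 0 0 = 0 by rewrite bN mul0mx mxE.
  rewrite -mulmxA -trmx_mul NE mxE big_ord_recl big_ord1 !mxE /=.
  by rewrite phhs_dHR // phhs_dHI // mulrNN (_ : lift ord0 ord0 = 1) //; apply/val_inj.
have [_ /(_ c x ac cx)[_ omu] _] := phhs_symplectic hX.
have /phhs_independent[b0 b1] : - b 0 0 *: V c x + b 0 1 *: W c x = 0.
  by apply: (bil_nondegenerate omu) => u; rewrite bilDl !bilZl.
apply/rowP => j; rewrite mxE.
have [->|] := eqVneq j 0; first by apply/eqP; rewrite -oppr_eq0 b0.
case: j => -[|[|//]] j2 // _; rewrite -[RHS]b1; congr (b 0 _); exact/val_inj.
Qed.

End regular_point.

End phhs.

Section flow_box_charts.
Context {R : realType}.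

Section coordinates.
Context {m : nat} (X : manifold R m) (J om : mxfield X).
Variables (HR HI : X -> R) (V : vfield X) (E : R[i]).
Hypotheses (hX : phhs J om HR) (hV : hamiltonian_vf om HR V).
Hypothesis hHI : is_primitive (interior_prod om (Jvf J V)) HI.
Variables (c : chart R m X) (ac : atlas c).
Local Notation W := (Jvf J V).
Let A := cmap c @` cdom c.

Definition energy (x : X) : 'rV[R]_2 :=
  \row_j (if j == 0 then HR x - complex.Re E else HI x - complex.Im E).

Lemma energy_levelP x : energy_level HR HI E x <-> energy x = 0.
Proof.
have EE : E = complex.Re E +i* complex.Im E by case: E.
rewrite /energy_level /hamC /=; split=> [eq_E|/rowP e].
  by apply/rowP => j; rewrite !mxE -eq_E /= !subrr; case: ifP.
rewrite EE; have := e 0; have := e 1; rewrite !mxE /=.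
by move=> /subr0_eq -> /subr0_eq ->.
Qed.

Lemma energy_smooth : smooth_on A (fun p => energy (cinv c p)).
Proof.
move=> k; apply: Ck_mx => [|i j]; first exact: img_open.
have Hk (f : X -> R) (e : R) : smooth_fun f -> Ck_on k A (fun p => f (cinv c p) - e).
  by move=> fS; apply: CkD; [exact: img_open|exact: fS|exact: Ck_cst].
case: (eqVneq j 0) => [->|j0].
  rewrite (_ : (fun x => _) = fun p => HR (cinv c p) - complex.Re E).
    by apply: Hk; exact: phhs_smooth hX.
  by apply/funext => p; rewrite mxE.
rewrite (_ : (fun x => _) = fun p => HI (cinv c p) - complex.Im E).
  by apply: Hk; exact: hHI.1.
by apply/funext => p; rewrite mxE (negbTE j0).
Qed.

Lemma derive_energy x u : cdom c x ->
  'D_u (fun p => energy (cinv c p)) (cmap c x) =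
  \row_j (if j == 0 then dfun HR c x u else dfun HI c x u).
Proof.
move=> cx; have Ax : A (cmap c x) by exists x.
have dE : derivable (fun p => energy (cinv c p)) (cmap c x) u.
  by apply: diff_derivable; exact: (energy_smooth 1).1.
have dH (f : X -> R) (e : R) : smooth_fun f ->
    'D_u (fun p => f (cinv c p) - e) (cmap c x) = dfun f c x u.
  move=> fS; rewrite -[RHS]subr0 -(derive_cst e (cmap c x) u) -deriveB //.
  by apply: diff_derivable; exact: (fS c ac 1).1.
apply/rowP => j; rewrite -(derive_entry 0 j dE) mxE.
case: (eqVneq j 0) => [->|j0].
  have -> : (fun y => energy (cinv c y) 0 0) =
      (fun p => HR (cinv c p) - complex.Re E).
    by apply/funext => p; rewrite mxE.
  exact: dH (phhs_smooth hX).
have -> : (fun y => energy (cinv c y) 0 j) = (fun p => HI (cinv c p) - complex.Im E).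
  by apply/funext => p; rewrite mxE (negbTE j0).
exact: dH hHI.1.
Qed.

Lemma fields_commute p : A p ->
  'D_(V c (cinv c p)) (fun q => W c (cinv c q)) p =
  'D_(W c (cinv c p)) (fun q => V c (cinv c q)) p.
Proof.
have cA q : A q -> cdom c (cinv c q) /\ cmap c (cinv c q) = q by exact: cinv_dom.
have [[omS _] omP closed] := phhs_symplectic hX.
apply: (@hamiltonian_fields_commute R m A (fun q => om c (cinv c q))
  (fun q => V c (cinv c q)) (fun q => W c (cinv c q))
  (fun q => HR (cinv c q)) (fun q => HI (cinv c q))).
- exact: img_open.
- exact: (omS c ac 1).
- exact: (hV.1.1 c ac 1).
- exact: ((Jvf_smooth hX hV).1 c ac 1).
- exact: (phhs_smooth hX ac 2).
- exact: (hHI.1 c ac 2).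
- by move=> q /cA[cq _]; exact: omP.
- by move=> q u /cA[cq qE]; rewrite (phhs_dHR hV) // /dfun qE.
- by move=> q u /cA[cq qE]; rewrite (phhs_dHI hHI) // /dfun qE.
- by move=> q /cA[cq _]; exact: (phhs_bilVW V hX).
- move=> q a b d /cA[cq qE]; have := closed c (cinv c q) ac cq a b d.
  by rewrite qE.
Qed.

End coordinates.

Theorem flow_box_chart n (X : manifold R (2 + (n + 2))) (J om : mxfield X)
    (HR HI : X -> R) (V : vfield X) (E : R[i]) x :
  phhs J om HR -> hamiltonian_vf om HR V ->
  is_primitive (interior_prod om (Jvf J V)) HI -> regular_value HR HI E ->
  energy_level HR HI E x ->
  exists (c : chart R (2 + (n + 2)) X) (e : R),
  [/\ atlas c, cdom c x, 0 < e, cmap c @` cdom c = ball 0 e &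
    forall y, cdom c y -> [/\ V c y = line0 n, Jvf J V c y = line1 n &
      rsubmx (rsubmx (cmap c y)) = energy HR HI E y]].
Proof.
move=> hX hV hHI hE Ex.
have [c ac cx] := atlas_cover x.
have reg := hE x Ex c ac cx.
have xK : cinv c (cmap c x) = x by rewrite cmapK.
have Ap0 : (cmap c @` cdom c) (cmap c x) by exists x.
pose h p := energy HR HI E (cinv c p).
have hd : differentiable h (cmap c x) by exact: (energy_smooth E hX hHI ac 1).1.
have [|||||||||| Q [th [et [e [[e0 oQ Qx QA] [thQ etK] [thS etS] QP]]]]] :=
  @flow_box R n (cmap c @` cdom c) (fun p => V c (cinv c p))
  (fun p => Jvf J V c (cinv c p)) h (cmap c x).
- exact: img_open.
- exact: Ap0.
- exact: (hV.1.1 c ac).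
- exact: ((Jvf_smooth hX hV).1 c ac).
- exact: (energy_smooth E hX hHI ac).
- by move=> p Ap; exact: (fields_commute hX hV hHI ac Ap).
- move=> p /cinv_dom[cp pE]; have := derive_energy E hX hHI ac _ cp.
  rewrite pE -/h => hE'; rewrite !hE'.
  have [-> -> -> ->] := phhs_invariant hX hV hHI ac cp.
  by split; apply/rowP => j; rewrite !mxE; case: ifP.
- by rewrite /h xK; apply/energy_levelP.
- by rewrite xK; exact: (phhs_row_free hX hV hHI ac cx reg).
- apply: (phhs_row_full hX hV hHI ac cx reg) => u.
  by rewrite -deriveEjacobian // (derive_energy E hX hHI ac).
have oB : open (ball (0 : 'rV[R]_(2 + (n + 2))) e) by exact: ball_open.
pose c' := refined_chart oQ oB QA thQ etK thS etS.
have ac' : atlas c' by exact: refined_chart_atlas.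
exists c', e; split=> //; first exact: refined_chart_img.
move=> y [cy Qy]; have [Vy Wy hy] := QP _ Qy.
have c'y : cdom c' y by [].
have dT u : dtrans c c' y u = 'D_u th (cmap c y).
  have [_ ->] := derive_dtrans u ac ac' cy c'y.
  apply: near_eq_derive; apply: filterS (open_nbhs_nbhs (conj oQ Qy)) => p Qp.
  by have [_ pE] := cinv_dom (QA _ Qp); rewrite /= pE.
rewrite cmapK // in Vy Wy; split.
- by rewrite (hV.1.2 c c' y ac ac' cy c'y) dT.
- by rewrite ((Jvf_smooth hX hV).2 c c' y ac ac' cy c'y) dT.
- by rewrite -[LHS]/(rsubmx (rsubmx (th (cmap c y)))) hy /h cmapK.
Qed.

End flow_box_charts.

(** * Leaves *)

Section curves.
Context {R : realType}.

(** Real induction along the affine path from [s] to [t], which treats both orders of the two times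
    at once. *)
Lemma interval_const (a b : R) (P : R -> Prop) :
  (forall t, a < t < b -> \forall s \near t, P s <-> P t) ->
  forall s t, a < s < b -> a < t < b -> P s -> P t.
Proof.
move=> Ploc s t /andP[as_ sb] /andP[at_ tb] Ps.
pose c (r : R) := s + r *: (t - s).
have cab r : 0 <= r <= 1 -> a < c r < b.
  move=> /andP[r0 r1]; rewrite /c /GRing.scale /=.
  have -> : s + r * (t - s) = (1 - r) * s + r * t by ring.
  have r1' : 0 <= 1 - r by rewrite subr_ge0.
  have al : a < Num.min s t by rewrite lt_min as_.
  have lb : Num.max s t < b by rewrite gt_max sb.
  have ls : 0 <= s - Num.min s t by rewrite subr_ge0 ge_min lexx.
  have lt : 0 <= t - Num.min s t by rewrite subr_ge0 ge_min lexx orbT.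
  have us : 0 <= Num.max s t - s by rewrite subr_ge0 le_max lexx.
  have ut : 0 <= Num.max s t - t by rewrite subr_ge0 le_max lexx orbT.
  have := mulr_ge0 r1' ls; have := mulr_ge0 r0 lt.
  have := mulr_ge0 r1' us; have := mulr_ge0 r0 ut.
  by move: al lb; move: (Num.min s t) (Num.max s t) => l u *; apply/andP; split; lra.
have cc (r : R) : c @ r --> c r.
  exact: differentiable_continuous (ex_diff (is_diff_def := is_diff_line _ _ _)).
have loc r : 0 <= r <= 1 ->
    exists2 e, 0 < e & forall r', `|r - r'| < e -> P (c r') <-> P (c r).
  move=> /cab /Ploc nP; have /nbhs_normP[e /= e0 eP] := cc r _ nP.
  by exists e.
suff : forall r, 0 <= r <= 1 -> P (c r).
  by move=> /(_ 1); rewrite /c scale1r addrC subrK; apply; rewrite lexx ler01.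
apply: real_induction.
- by rewrite /c scale0r addr0.
- move=> r /andP[r0 r1] rP.
  have [|e e0 eP] := loc r; first by rewrite r0 ltW.
  exists e => // r' /andP[rr' r'e]; apply/eP; last by apply: rP; rewrite r0 lexx.
  by rewrite distrC ger0_norm ?subr_ge0 // ltrBlDl.
- move=> r /andP[r0 r1] rP; have [|e e0 eP] := loc r; first by rewrite r1 ltW.
  pose r' := Num.max 0 (r - e / 2).
  have r'r : 0 <= r' < r.
    by rewrite /r' le_max lexx gt_max r0 ltrBlDr ltrDl divr_gt0.
  apply/(eP r'); last exact: rP.
  case/andP: r'r => _ r'r; rewrite gtr0_norm ?subr_gt0 //.
  rewrite ltrBlDr -ltrBlDl (lt_le_trans (_ : _ < r - e / 2)) //.
    by rewrite ltrD2l ltrN2 gtr_pMr // invf_lt1 // ltr1n.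
  by rewrite /r' le_max lexx orbT.
Qed.

Lemma curve_affine n (u : R -> 'rV[R]_n) d (a b s t : R) :
  (forall r, a < r < b -> is_derive r 1 u d) -> a < s < b -> a < t < b ->
  u t = u s + (t - s) *: d.
Proof.
move=> ud; wlog st : s t / s <= t => [H sab tab|].
  have [st|/ltW ts] := leP s t; first exact: H.
  by rewrite (H t s ts tab sab) -opprB scaleNr subrK.
move=> /andP[as_ sb] /andP[at_ tb].
pose w (r : R) := u r - r *: d.
have wd (r : R) : s <= r <= t -> is_derive r 1 w 0.
  move=> /andP[sr rt]; have ur : is_derive r 1 u d.
    by apply: ud; rewrite (lt_le_trans as_ sr) (le_lt_trans rt).
  have dl := @is_diff_line _ _ 0 d r.
  have ld : is_derive r 1 (fun r : R => r *: d) d.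
    have -> : (fun r : R => r *: d) = (fun r => 0 + r *: d).
      by apply/funext => z; rewrite add0r.
    apply: DeriveDef; first by apply: diff_derivable; exact: ex_diff.
    rewrite deriveE; last exact: ex_diff.
    by rewrite (diff_val (is_diff_def := dl)) scale1r.
  by rewrite -[0](subrr d); exact: is_deriveB.
have z0 (r : R) : s <= r <= t -> is_derive r 1 (fun _ : R => 0 : R) 0.
  by move=> _; exact: is_derive_cst.
have n0 (r : R) : s <= r <= t -> `|0 : 'rV[R]_n| <= 0 by rewrite normr0.
have := @norm_le_of_derive _ _ w (fun=> 0) (fun=> 0) (fun=> 0) s t st wd z0 n0.
rewrite subrr normr_le0 => /eqP/subr0_eq E.
have : u t = w t + t *: d by rewrite /w subrK.
rewrite E /w => ->; rewrite scalerBl addrAC -addrA.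
by rewrite addrA addrAC.
Qed.

Lemma mx_norm_lt p q (M : 'M[R]_(p, q)) (e : R) : 0 < e ->
  (forall i j, `|M i j| < e) -> `|M| < e.
Proof.
move=> e0 Me; have [M0|/mx_norm_neq0[[i j] /= ME]] := eqVneq (mx_norm M) 0.
  by rewrite /Num.norm /= M0.
by rewrite /Num.norm /= ME.
Qed.

(** A connected set with two points contains a nondegenerate interval, which has positive Lebesgue
    measure, while countable sets are null. *)
Lemma countable_connected_eq (K : set R) : countable K -> connected K ->
  forall x y, K x -> K y -> x = y.
Proof.
move=> cK /connected_intervalP iK x y Kx Ky.
wlog xy : x y Kx Ky / x <= y.
  move=> H; have [|/ltW] := leP x y; first exact: H.
  by move=> yx; apply/esym; exact: H.
apply/eqP; rewrite eq_le xy /= leNgt; apply/negP => x_lt_y.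
have : lebesgue_measure ([set` `[x, y]] : set R) = 0.
  apply: countable_lebesgue_measure0; apply: sub_countable cK.
  apply: subset_card_le => z /=; rewrite in_itv /= => zxy.
  exact: iK zxy.
rewrite lebesgue_measure_itv /= lte_fin x_lt_y => /eqP.
by rewrite -EFinB eqe subr_eq0 gt_eqF.
Qed.

End curves.

Section box_coordinates.
Context {R : realType} {n : nat}.
Implicit Types p : 'rV[R]_(2 + (n + 2)).

Definition line (k : 'I_2) : 'rV[R]_(2 + (n + 2)) := row_mx (delta_mx 0 k) 0.

Lemma rsubmx_line p s k : rsubmx (p + s *: line k) = rsubmx p.
Proof. by rewrite linearD linearZ /= row_mxKr scaler0 addr0. Qed.

Lemma lsubmx_line p s k j :
  lsubmx (p + s *: line k) 0 j = lsubmx p 0 j + s * (j == k)%:R.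
Proof. by rewrite linearD linearZ /= row_mxKl !mxE. Qed.

Lemma ball0P p e : ball 0 e p <-> `|p| < e.
Proof. by rewrite -ball_normE /= sub0r normrN. Qed.

Lemma box_norm_lt p (e : R) : 0 < e -> (forall j, `|lsubmx p 0 j| < e) ->
  `|rsubmx p| < e -> `|p| < e.
Proof.
move=> e0 pl pr; apply: mx_norm_lt => // i j.
rewrite ord1 -[p]hsubmxK -(fintype.splitK j); case: (fintype.split j) => l /=.
  by rewrite row_mxEl.
by rewrite row_mxEr (le_lt_trans (mx_entry_le _ _ _)).
Qed.

Lemma box_norm_le p : (forall j, `|lsubmx p 0 j| <= `|p|) /\ `|rsubmx p| <= `|p|.
Proof.
split=> [j|]; first by rewrite mxE mx_entry_le.
by apply: mx_norm_le => // i j; rewrite mxE mx_entry_le.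
Qed.

Lemma rsubmx_eq_line p q : rsubmx p = rsubmx q ->
  q = p + (lsubmx q 0 0 - lsubmx p 0 0) *: line 0 +
          (lsubmx q 0 1 - lsubmx p 0 1) *: line 1.
Proof.
move=> pq; rewrite -[LHS]hsubmxK -[RHS]hsubmxK !rsubmx_line -pq; congr row_mx.
apply/rowP => j; rewrite !lsubmx_line -!/(lsubmx _ _ _).
have [->|] := eqVneq j 0; first by rewrite (_ : 0 == 1 = false) //= mulr1 mulr0; ring.
case: j => -[|[|//]] j2 // _.
have -> : Ordinal j2 = 1 by exact/val_inj.
by rewrite eqxx mulr1 mulr0; ring.
Qed.

End box_coordinates.

(** * Integral curves inside flow boxes *)

Section straightened_flows.
Context {R : realType} {n : nat} (X : manifold R (2 + (n + 2))).
Variables (V W : vfield X) (N : set X).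
Hypotheses (VS : smooth_vfield V) (WS : smooth_vfield W) (clN : closed N).

(** This retains from the Hamiltonian system only what the study of leaves uses: two coordinate
    fields, and the level as the zero set of the last pair of coordinates. *)
Definition is_flow_box (c : chart R (2 + (n + 2)) X) (e : R) :=
  [/\ atlas c, 0 < e, cmap c @` cdom c = ball 0 e &
    forall y, cdom c y -> [/\ V c y = line 0, W c y = line 1 &
      N y <-> rsubmx (rsubmx (cmap c y)) = 0]].

Hypothesis boxes : forall x, N x -> exists c e, is_flow_box c e /\ cdom c x.

Lemma box_mem c e p : is_flow_box c e -> `|p| < e ->
  cdom c (cinv c p) /\ cmap c (cinv c p) = p.
Proof. by move=> [_ _ img _] pe; apply: cinv_dom; rewrite img; exact/ball0P. Qed.

Lemma box_cmap_lt c e y : is_flow_box c e -> cdom c y -> `|cmap c y| < e.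
Proof. by move=> [_ _ img _] cy; apply/ball0P; rewrite -img; exists y. Qed.

Lemma box_N c e y z : is_flow_box c e -> cdom c y -> cdom c z ->
  rsubmx (cmap c y) = rsubmx (cmap c z) -> N y -> N z.
Proof.
move=> [_ _ _ cP] cy cz yz; have [_ _ Ny] := cP y cy; have [_ _ Nz] := cP z cz.
by move/Ny => y0; apply/Nz; rewrite -yz.
Qed.

(** An index [k] lets [V] and [W] share all arguments about a single flow. *)
Definition line_field (F : vfield X) k := smooth_vfield F /\
  forall c e y, is_flow_box c e -> cdom c y -> F c y = line k.

Lemma line_fieldV : line_field V 0.
Proof. by split=> // c e y [_ _ _ cP] /cP[]. Qed.

Lemma line_fieldW : line_field W 1.
Proof. by split=> // c e y [_ _ _ cP] /cP[]. Qed.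

(** The straight line in the direction [line k] is the integral curve. Since the box is a cube, the
    times at which it stays inside depend on the [k]-th coordinate alone and form the interval from
    [- e - pk] to [e - pk]. *)
Lemma box_flow F k c e y t : line_field F k -> is_flow_box c e -> cdom c y ->
  `|cmap c y + t *: line k| < e ->
  flow F t y (cinv c (cmap c y + t *: line k)).
Proof.
move=> [FS FP] cb cy te; have [ac e0 _ _] := cb; set p := cmap c y.
pose pk := lsubmx p 0 k.
have [pl pr] := box_norm_le p; have pe := box_cmap_lt cb cy.
have itv (s : R) : - e - pk < s < e - pk -> `|p + s *: line k| < e.
  rewrite ltrBlDl ltrBrDl => se; apply: box_norm_lt => // [j|].
    rewrite lsubmx_line; have [->|_] := eqVneq j k; last first.
      by rewrite mulr0 addr0 (le_lt_trans (pl j)).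
    by rewrite mulr1 ltr_norml.
  by rewrite rsubmx_line (le_lt_trans pr).
have vti (s : R) : `|p + s *: line k| < e -> - e - pk < s < e - pk.
  move=> se; have [/(_ k) sl _] := box_norm_le (p + s *: line k).
  have := le_lt_trans sl se; rewrite lsubmx_line eqxx mulr1 ltr_norml.
  by rewrite ltrBlDl ltrBrDl.
exists (- e - pk), (e - pk), (fun s => cinv c (p + s *: line k)); split.
- by apply: vti; rewrite scale0r addr0.
- exact: vti.
- move=> s sab; have [cs sE] := box_mem cb (itv s sab).
  have lc : (fun s : R => p + s *: line k) @ s --> p + s *: line k.
    exact: differentiable_continuous (ex_diff (is_diff_def := is_diff_line _ _ _)).
  have us : {for s, continuous (fun s : R => cinv c (p + s *: line k))}.
    apply: (@continuous_comp _ _ _ (fun s : R => p + s *: line k) (cinv c)); first exact: lc.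
    by apply: cinv_cont; exists (cinv c (p + s *: line k)).
  split=> // c' ac' c's; apply: (is_derive_change_chart FS ac ac' us cs c's).
  rewrite (FP c e) //.
  have dl := @is_diff_line _ _ p (line k) s.
  have ld : is_derive s 1 (fun s : R => p + s *: line k) (line k).
    apply: DeriveDef; first by apply: diff_derivable; exact: ex_diff.
    rewrite deriveE; last exact: ex_diff.
    by rewrite (diff_val (is_diff_def := dl)) scale1r.
  apply: near_eq_is_derive ld.
  have nN : nbhs (p + s *: line k) [set q | `|q| < e].
    apply: open_nbhs_nbhs; split; last exact: itv.
    apply: (@open_comp _ _ (fun q : 'rV[R]_(2 + (n + 2)) => `|q|) [set z | z < e]).
      by move=> q _; exact: norm_continuous.
    exact: open_lt.
  have nr : \forall r \near s, `|p + r *: line k| < e by exact: (lc _ nN).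
  apply: filterS nr => r re.
  by have [_ rE] := box_mem cb re; rewrite /= rE.
- by rewrite scale0r addr0 cmapK.
- by [].
Qed.

(** The corner of the path mixes coordinates of [y] and [z], so it lies in the cube again. *)
Lemma box_flow2 c e y z : is_flow_box c e -> cdom c y -> cdom c z ->
  rsubmx (cmap c y) = rsubmx (cmap c z) ->
  exists2 q, flow W (lsubmx (cmap c z) 0 1 - lsubmx (cmap c y) 0 1) y q &
             flow V (lsubmx (cmap c z) 0 0 - lsubmx (cmap c y) 0 0) q z.
Proof.
move=> cb cy cz yz; have [_ e0 _ _] := cb.
set b := _ 0 1 - _; set a := _ 0 0 - _.
have ye := box_cmap_lt cb cy; have ze := box_cmap_lt cb cz.
have [yl yr] := box_norm_le (cmap c y); have [zl _] := box_norm_le (cmap c z).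
have qe : `|cmap c y + b *: line 1| < e.
  apply: box_norm_lt => // [j|]; last by rewrite rsubmx_line (le_lt_trans yr).
  rewrite lsubmx_line /b; have [->|_] := eqVneq j 1.
    by rewrite mulr1 addrCA subrr addr0 (le_lt_trans (zl 1)).
  by rewrite mulr0 addr0 (le_lt_trans (yl j)).
have [cq qE] := box_mem cb qe.
have zE : cmap c z = cmap c (cinv c (cmap c y + b *: line 1)) + a *: line 0.
  by rewrite qE addrAC; exact: rsubmx_eq_line.
exists (cinv c (cmap c y + b *: line 1)).
  exact: box_flow line_fieldW cb cy qe.
rewrite -[X in flow _ _ _ X](cmapK cz) zE; apply: (box_flow line_fieldV cb cq).
by rewrite -zE.
Qed.

Lemma near_itv (a b t : R) : a < t < b -> \forall s \near t, a < s < b.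
Proof.
move=> /andP[at_ tb]; have ids : (fun s : R => s) @ t --> t by exact: cvg_id.
have n1 : \forall s \near t, a < s by exact: (cvgr_gt _ ids _ at_).
have n2 : \forall s \near t, s < b by exact: (cvgr_lt _ ids _ tb).
by apply: filterS2 n1 n2 => s -> ->.
Qed.

Lemma curve_in_box F k a b u t c e : line_field F k -> integral_curve F a b u ->
  a < t < b -> is_flow_box c e -> cdom c (u t) ->
  \forall s \near t, cdom c (u s) /\ cmap c (u s) = cmap c (u t) + (s - t) *: line k.
Proof.
move=> [FS FP] ui tab cb cu; have [ac _ _ _] := cb.
have [uc _] := ui t tab.
have nd := near_cdom uc cu; have nab := near_itv tab.
have [d /= d0 dP] : exists2 d, 0 < d & forall s, `|t - s| < d -> cdom c (u s) /\ a < s < b.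
  have nn : \forall s \near t, cdom c (u s) /\ a < s < b by apply: filterS2 nd nab.
  by move/nbhs_normP : nn => [d /= d0 dP]; exists d.
have dist s : t - d < s < t + d -> `|t - s| < d.
  by move=> /andP[s1 s2]; rewrite distrC ltr_norml; apply/andP; split; lra.
have ud (s : R) : t - d < s < t + d -> is_derive s 1 (cmap c \o u) (line k).
  move=> /dist /dP[cs sab]; have [_ /(_ c ac cs)] := ui s sab.
  by rewrite (FP c e).
have : \forall s \near t, t - d < s < t + d.
  by apply: near_itv; rewrite ltrBlDr !ltrDl d0.
apply: filterS => s sd; have [cs _] := dP s (dist s sd); split=> //.
apply: (curve_affine ud) => //.
by rewrite ltrBlDr !ltrDl d0.
Qed.

End straightened_flows.

Section leaves.
Context {R : realType} {n : nat} (X : manifold R (2 + (n + 2))).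
Variables (V W : vfield X) (N : set X).
Hypotheses (VS : smooth_vfield V) (WS : smooth_vfield W) (clN : closed N).
Local Notation flow_box_at := (is_flow_box V W N).
Local Notation straight := (line_field V W N).
Hypothesis boxes : forall x, N x -> exists c e, flow_box_at c e /\ cdom c x.

(** Membership in [N] is locally constant in time: off [N] because [N] is closed, on [N] because the
    coordinates that cut it out are constant along the curve in a box. *)
Lemma curve_N F k a b u s t : straight F k -> integral_curve F a b u ->
  a < s < b -> a < t < b -> N (u s) -> N (u t).
Proof.
move=> Fl ui; apply: (interval_const (P := fun t => N (u t))) => {s t} t tab.
have [uc _] := ui t tab.
have [Nu|nNu] := pselect (N (u t)); last first.
  have oN : open (~` N) by exact: closed_openC.
  have nn : \forall s \near t, (~` N) (u s) by apply: uc; exact: open_nbhs_nbhs.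
  by apply: filterS nn => s nNs; split.
have [c [e [cb cu]]] := boxes Nu.
apply: filterS (curve_in_box Fl ui tab cb cu) => s [cs sE].
split=> // _; apply: (box_N cb cu cs) => //.
by rewrite sE rsubmx_line.
Qed.

(** Agreement is locally constant in time: where the curves differ, Hausdorff separation keeps them
    apart; where they agree, both are the same straight line in a box, available because [curve_N]
    keeps the curve in [N]. *)
Lemma curve_unique F k a b u a' b' u' t : straight F k ->
  integral_curve F a b u -> integral_curve F a' b' u' ->
  a < 0 < b -> a' < 0 < b' -> a < t < b -> a' < t < b' ->
  N (u 0) -> u 0 = u' 0 -> u t = u' t.
Proof.
move=> Fl ui u'i /andP[a0 b0] /andP[a'0 b'0] /andP[at_ tb] /andP[a't tb'] N0 uu'.
have I s : Num.max a a' < s < Num.min b b' -> (a < s < b) /\ (a' < s < b').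
  by rewrite gt_max lt_min => /andP[/andP[-> ->] /andP[-> ->]].
apply: (@interval_const R (Num.max a a') (Num.min b b') (fun s => u s = u' s) _ 0 t).
- move=> s /I[sab sab']; have [uc _] := ui s sab; have [u'c _] := u'i s sab'.
  have Ns : N (u s) by apply: (curve_N Fl ui _ sab N0); rewrite a0.
  have [E|nE] := pselect (u s = u' s); last first.
    have hT := @manifold_hausdorff _ _ X; rewrite open_hausdorff in hT.
    have [[P Q] /= [Pu Qu] [oP oQ /eqP PQ]] := hT _ _ (introN eqP nE).
    have nP : \forall r \near s, P (u r).
      by apply: uc; apply: open_nbhs_nbhs; split=> //; exact: set_mem.
    have nQ : \forall r \near s, Q (u' r).
      by apply: u'c; apply: open_nbhs_nbhs; split=> //; exact: set_mem.
    apply: filterS2 nP nQ => r Pr Qr; split=> // E.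
    have : (P `&` Q) (u r) by split=> //; rewrite E.
    by rewrite PQ.
  have [c [e [cb cu]]] := boxes Ns.
  have cu' : cdom c (u' s) by rewrite -E.
  apply: filterS2 (curve_in_box Fl ui sab cb cu) (curve_in_box Fl u'i sab' cb cu').
  move=> r [cr rE] [cr' rE']; split=> // _.
  by rewrite -(cmapK cr) -(cmapK cr') rE rE' E.
- by rewrite gt_max lt_min a0 b0 a'0.
- by rewrite gt_max lt_min at_ tb a't.
- exact: uu'.
Qed.

Lemma flow_N F k t x y : straight F k -> flow F t x y -> N x -> N y.
Proof.
move=> Fl [a [b [u [ab0 abt ui <- <-]]]].
exact: (curve_N Fl ui ab0 abt).
Qed.

Lemma flow_unique F k t x y z : straight F k -> N x ->
  flow F t x y -> flow F t x z -> y = z.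
Proof.
move=> Fl Nx [a [b [u [ab0 abt ui u0 <-]]]] [a' [b' [u' [ab0' abt' ui' u0' <-]]]].
by apply: (curve_unique Fl ui ui') => //; rewrite u0.
Qed.

Lemma flow_sym (F : vfield X) t x y : flow F t x y -> flow F (- t) y x.
Proof.
move=> [a [b [u [/andP[a0 b0] /andP[at_ tb] ui u0 ut]]]].
exists (a - t), (b - t), (fun s => u (t + s * 1)); split.
- by apply/andP; split; lra.
- by apply/andP; split; lra.
- move=> s /andP[as_ sb].
  have tab : a < t + s * 1 < b by apply/andP; split; lra.
  have [uc ud] := ui _ tab.
  have sc : (fun s : R => t + s * 1) @ s --> t + s * 1.
    exact: differentiable_continuous (ex_diff (is_diff_def := is_diff_line t (1 : R) s)).
  split; first exact: (@continuous_comp _ _ _ (fun s : R => t + s * 1) u).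
  move=> c ac cu; have := @is_derive_affine _ _ (fun s => cmap c (u s)) t 1 s _ (ud c ac cu).
  by rewrite scale1r.
- by rewrite mul0r addr0.
- by rewrite mulr1 subrr.
Qed.

Lemma flow_refl F k x : straight F k -> N x -> flow F 0 x x.
Proof.
move=> Fl Nx; have [c [e [cb cx]]] := boxes Nx.
have := @box_flow _ _ X V W N F k c e x 0 Fl cb cx.
by rewrite scale0r addr0 (cmapK cx); apply; exact: box_cmap_lt cb cx.
Qed.

Let lV := @line_fieldV _ _ _ V W N VS.
Let lW := @line_fieldW _ _ _ V W N WS.

Definition leaf (x : X) : set X := [set y | exists ts, flow_comp V W ts x y].

Lemma flow_comp_cat ts ts' x y z : flow_comp V W ts x y -> flow_comp V W ts' y z ->
  flow_comp V W (ts' ++ ts) x z.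
Proof.
move=> xy; elim: ts' z => [|[t s] ts' IH] z /=; first by move=> ->.
by move=> [p [q [/IH xp pq qz]]]; exists p, q.
Qed.

Lemma flow_comp_N ts x y : flow_comp V W ts x y -> N x -> N y.
Proof.
elim: ts y => [|[t s] ts IH] y /=; first by move=> ->.
move=> [p [q [/IH xp pq qy]]] Nx.
exact: (flow_N lV qy (flow_N lW pq (xp Nx))).
Qed.

Lemma leaf_refl x : leaf x x.
Proof. by exists [::]. Qed.

Lemma leaf_trans x y z : leaf x y -> leaf y z -> leaf x z.
Proof.
by move=> [ts xy] [ts' yz]; exists (ts' ++ ts); exact: flow_comp_cat xy yz.
Qed.

Lemma leaf_N x : N x -> leaf x `<=` N.
Proof. by move=> Nx y [ts xy]; exact: flow_comp_N xy Nx. Qed.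

Lemma leaf_sym x y : N x -> leaf x y -> leaf y x.
Proof.
move=> Nx [ts]; elim: ts y => [|[t s] ts IH] y /=; first by move=> ->; exact: leaf_refl.
move=> [p [q [xp pq qy]]]; have Np := flow_comp_N xp Nx.
have Nq := flow_N lW pq Np; have Ny := flow_N lV qy Nq.
(* Every pair of times flows along [W] before [V], so inverting a pair takes two pairs, padded with
   flows of time 0. *)
apply: leaf_trans (IH p xp); exists [:: (0, - s); (- t, 0)].
exists q, p; split; [|exact: flow_sym pq|exact: flow_refl lV Np].
by exists y, y; split; [|exact: flow_refl lW Ny|exact: flow_sym qy].
Qed.

Lemma leaf_eq x y : N x -> leaf x y -> leaf x = leaf y.
Proof.
move=> Nx xy; have yx := leaf_sym Nx xy.
by apply/seteqP; split=> z; exact: leaf_trans.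
Qed.

Lemma box_leaf c e y z : flow_box_at c e -> cdom c y -> cdom c z ->
  rsubmx (cmap c y) = rsubmx (cmap c z) -> leaf y z.
Proof.
move=> cb cy cz yz; have [q yq qz] := box_flow2 VS WS cb cy cz yz.
by exists [:: (lsubmx (cmap c z) 0 0 - lsubmx (cmap c y) 0 0,
  lsubmx (cmap c z) 0 1 - lsubmx (cmap c y) 0 1)]; exists y, q.
Qed.

(** Nearby points of an integral curve share a plaque, so [P], transported along plaques in both
    directions, is locally constant in time; the flows of the list are then chained. *)
Lemma leaf_induction (P : X -> Prop) :
  (forall x, N x -> exists c e, [/\ flow_box_at c e, cdom c x &
    forall y z, cdom c y -> cdom c z -> N y ->
      rsubmx (cmap c y) = rsubmx (cmap c z) -> P y -> P z]) ->
  forall x, N x -> P x -> forall y, leaf x y -> P y.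
Proof.
move=> Ploc x Nx Px.
have step F k t y z : straight F k -> flow F t y z -> N y -> P y -> P z.
  move=> Fl [a [b [u [ab0 abt ui <- <-]]]] N0 P0.
  apply: (@interval_const R a b (fun s => P (u s)) _ 0 t) => // s sab.
  have Ns := curve_N Fl ui ab0 sab N0.
  have [c [e [cb cs cP]]] := Ploc _ Ns.
  apply: filterS (curve_in_box Fl ui sab cb cs) => r [cr rE].
  have rs : rsubmx (cmap c (u r)) = rsubmx (cmap c (u s)) by rewrite rE rsubmx_line.
  split; last by apply: cP => //; rewrite rs.
  by apply: cP => //; apply: box_N cb cs cr _ Ns; rewrite rs.
move=> y [ts]; elim: ts y => [|[t s] ts IH] y /=; first by move=> ->.
move=> [p [q [xp pq qy]]]; have Np := flow_comp_N xp Nx.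
apply: (step _ _ _ _ _ lV qy); first exact: flow_N lW pq Np.
exact: (step _ _ _ _ _ lW pq Np (IH p xp)).
Qed.

End leaves.

Section tails.
Context {R : realType}.

Lemma tail_zero_rsubmx k p (v : 'rV[R]_(k + p)) : tail_zero k v <-> rsubmx v = 0.
Proof.
split=> [v0|v0 j kj]; first by apply/rowP => i; rewrite !mxE v0 //= leq_addr.
case: (splitP j) => i ji; first by move: kj; rewrite ji leqNgt ltn_ord.
have -> : j = rshift k i by exact/val_inj.
by have := congr1 (fun w : 'rV[R]_p => w 0 i) v0; rewrite !mxE.
Qed.

Lemma tail_zero_rsubmx2 k l p (v : 'rV[R]_(k + (l + p))) :
  tail_zero (k + l) v <-> rsubmx (rsubmx v) = 0.
Proof.
split=> [v0|v0 j kj].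
  by apply/rowP => i; rewrite !mxE v0 //= leq_add2l leq_addr.
case: (splitP j) => i ji.
  by move: kj; rewrite ji leqNgt (leq_trans (ltn_ord i)) // leq_addr.
case: (splitP i) => r ir; first by move: kj; rewrite ji ir leq_add2l leqNgt ltn_ord.
have -> : j = rshift k (rshift l r) by apply/val_inj; rewrite /= -ir.
by have := congr1 (fun w : 'rV[R]_p => w 0 r) v0; rewrite !mxE.
Qed.

End tails.

(** * Connected components of a leaf in a flow box *)

Section leaf_components.
Context {R : realType} {n : nat} (X : manifold R (2 + (n + 2))).
Variables (V W : vfield X) (N : set X).
Hypotheses (VS : smooth_vfield V) (WS : smooth_vfield W) (clN : closed N).
Local Notation flow_box_at := (is_flow_box V W N).
Local Notation straight := (line_field V W N).
Hypothesis boxes : forall x, N x -> exists c e, flow_box_at c e /\ cdom c x.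
Let lV := @line_fieldV _ _ _ V W N VS.
Let lW := @line_fieldW _ _ _ V W N WS.
Local Notation leaf := (leaf V W).

Lemma flow_comp_unique ts x y z : N x ->
  flow_comp V W ts x y -> flow_comp V W ts x z -> y = z.
Proof.
move=> Nx; elim: ts y z => [|[t s] ts IH] y z /=; first by move=> -> ->.
move=> [p [q [xp pq qy]]] [p' [q' [xp' pq' qz]]].
have Np := flow_comp_N VS WS clN boxes xp Nx.
rewrite -(IH _ _ xp xp') in pq'; rewrite -(flow_unique clN boxes lW Np pq pq') in qz.
exact: (flow_unique clN boxes lV (flow_N clN boxes lW pq Np) qy qz).
Qed.

(* By uniqueness of flows there are only countably many of these points, yet
   every plaque of the leaf contains one. *)
Definition rational_leaf (x : X) : set X := [set y | exists ts : seq (rat * rat),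
  flow_comp V W [seq (ratr r.1, ratr r.2) | r <- ts] x y].

Lemma rational_leaf_countable x : N x -> countable (rational_leaf x).
Proof.
move=> Nx; pose f (ts : seq (rat * rat)) :=
  xget x [set y | flow_comp V W [seq (ratr r.1, ratr r.2) | r <- ts] x y].
apply: (@sub_countable _ _ _ (f @` setT)).
  apply: subset_card_le => y [ts xy]; exists ts => //.
  have fP := xgetPex x (ex_intro _ y xy).
  exact: flow_comp_unique Nx fP xy.
by apply: sub_countable (countableP _); exact: card_image_le.
Qed.

(** Stated with flows instead of coordinates, so that it can be carried from box to box by
    [leaf_induction]; by [rationally_near_box] it puts a rational point into the plaque of [y] in
    any box. *)
Definition rationally_near x y := forall d : R, 0 < d -> exists (a b : R) p q,
  [/\ `|a| < d, `|b| < d, flow W b y p, flow V a p q & rational_leaf x q].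

Lemma line_norm_le (k : 'I_2) : `|line k : 'rV[R]_(2 + (n + 2))| <= 1.
Proof.
apply: mx_norm_le => // i j; rewrite ord1 -(fintype.splitK j).
case: (fintype.split j) => l /=; rewrite ?row_mxEl ?row_mxEr !mxE ?normr0 //.
by case: (_ && _); rewrite ?normr1 ?normr0.
Qed.

Lemma box_norm_near (p : 'rV[R]_(2 + (n + 2))) a b e :
  `|a| < (e - `|p|) / 2 -> `|b| < (e - `|p|) / 2 ->
  `|p + a *: line 0 + b *: line 1| < e.
Proof.
move=> a1 b1; rewrite (le_lt_trans (ler_normD _ _)) //.
have := ler_normD p (a *: line 0).
have := line_norm_le 0; have := line_norm_le 1; rewrite !normrZ => l1 l0.
have la : `|a| * `|line 0 : 'rV[R]_(2 + (n + 2))| <= `|a| by rewrite ler_piMr.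
have lb : `|b| * `|line 1 : 'rV[R]_(2 + (n + 2))| <= `|b| by rewrite ler_piMr.
by move: la lb a1 b1; move: (`|a| * _) (`|b| * _) => *; lra.
Qed.

Lemma box_point c e z a b : flow_box_at c e -> cdom c z ->
  `|a| < (e - `|cmap c z|) / 2 -> `|b| < (e - `|cmap c z|) / 2 ->
  exists z', [/\ cdom c z', rsubmx (cmap c z') = rsubmx (cmap c z),
    lsubmx (cmap c z') 0 0 = lsubmx (cmap c z) 0 0 + a &
    lsubmx (cmap c z') 0 1 = lsubmx (cmap c z) 0 1 + b].
Proof.
move=> cb cz a1 b1; have [cz' zE] := box_mem cb (box_norm_near a1 b1).
exists (cinv c (cmap c z + a *: line 0 + b *: line 1)).
split=> //; rewrite zE; first by rewrite !rsubmx_line.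
  by rewrite !lsubmx_line eqxx mulr1 (_ : 0 == 1 = false) // mulr0 addr0.
by rewrite !lsubmx_line eqxx mulr1 (_ : 1 == 0 = false) // mulr0 addr0.
Qed.

(** Moves shorter than half the distance to the boundary of the cube stay in the box, and uniqueness
    identifies the given flows with the straight ones there. *)
Lemma rationally_near_box x y c e : flow_box_at c e -> cdom c y -> N y ->
  rationally_near x y ->
  exists q, [/\ rational_leaf x q, cdom c q & rsubmx (cmap c q) = rsubmx (cmap c y)].
Proof.
move=> cb cy Ny xy; have d0 : 0 < (e - `|cmap c y|) / 2.
  by rewrite divr_gt0 // subr_gt0; exact: box_cmap_lt cb cy.
have [a [b [p [q [a1 b1 yp pq Qq]]]]] := xy _ d0.
have [z [cz zr z0 z1]] := box_point cb cy a1 b1.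
have [p'] := box_flow2 VS WS cb cy cz (esym zr).
rewrite z0 z1 !(addrC (lsubmx _ _ _)) !addrK => yp' pz.
rewrite -(flow_unique clN boxes lW Ny yp yp') in pz.
have Np := flow_N clN boxes lW yp Ny.
by exists z; rewrite -(flow_unique clN boxes lV Np pq pz); split; rewrite // (flow_unique clN boxes lV Np pq pz).
Qed.

Lemma ratr_near (a d : R) : 0 < d -> exists r : rat, `|ratr r - a| < d.
Proof.
move=> d0; have [|r] := @rat_in_itvoo R (a - d) (a + d).
  by rewrite ltrBlDr -addrA ltrDl addr_gt0.
by rewrite in_itv /= => /andP[r1 r2]; exists r; rewrite ltr_norml; apply/andP; split; lra.
Qed.

Lemma rationally_near_plaque x y z c e : flow_box_at c e -> cdom c y -> cdom c z ->
  N y -> rsubmx (cmap c y) = rsubmx (cmap c z) ->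
  rationally_near x y -> rationally_near x z.
Proof.
move=> cb cy cz Ny yz xy d d0.
have [q [[ts xq] cq qE]] := rationally_near_box cb cy Ny xy.
pose D := Num.min d ((e - `|cmap c z|) / 2).
have D0 : 0 < D.
  by rewrite lt_min d0 divr_gt0 // subr_gt0; exact: box_cmap_lt cb cz.
have Dd : D <= d by rewrite ge_min lexx.
have De : D <= (e - `|cmap c z|) / 2 by rewrite ge_min lexx orbT.
(* The target [z'] is chosen near [z] so that the times from the rational point [q] to [z'] are
   exactly the rationals [a'] and [b']. The times from [z] to [z'] are the rounding errors, below
   [D]. *)
have [a' a'P] := ratr_near (lsubmx (cmap c z) 0 0 - lsubmx (cmap c q) 0 0) D0.
have [b' b'P] := ratr_near (lsubmx (cmap c z) 0 1 - lsubmx (cmap c q) 0 1) D0.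
have [z' [cz' zr z0 z1]] :=
  box_point cb cz (lt_le_trans a'P De) (lt_le_trans b'P De).
have [p'] := box_flow2 VS WS cb cz cz' (esym zr).
have shiftl (v w : R) : v + w - v = w by ring.
rewrite z0 z1 !shiftl => zp pz'.
have [p] := box_flow2 VS WS cb cq cz' (etrans qE (etrans yz (esym zr))).
rewrite z0 z1 => qp pz.
have shift (u v w : R) : v + (w - (v - u)) - u = w by ring.
rewrite shift in qp; rewrite shift in pz.
eexists; eexists; exists p', z'; split.
- exact: lt_le_trans a'P Dd.
- exact: lt_le_trans b'P Dd.
- exact: zp.
- exact: pz'.
- by exists ((a', b') :: ts); exists q, p.
Qed.

Lemma leaf_rationally_near x y : N x -> leaf x y -> rationally_near x y.
Proof.
move=> Nx; apply: (leaf_induction VS WS clN boxes) => //.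
  move=> z Nz; have [c [e [cb cz]]] := boxes Nz; exists c, e; split=> //.
  by move=> y' z' cy cz' Ny yz; exact: rationally_near_plaque cb cy cz' Ny yz.
have fW := flow_refl boxes lW Nx; have fV := flow_refl boxes lV Nx.
move=> d d0; exists (0 : R), (0 : R), x, x; split.
- by rewrite normr0.
- by rewrite normr0.
- exact fW.
- exact fV.
- by exists [::].
Qed.

Lemma leaf_box_countable x c e j : N x -> flow_box_at c e ->
  countable ((fun z => rsubmx (cmap c z) 0 j) @` (leaf x `&` cdom c)).
Proof.
move=> Nx cb.
apply: (@sub_countable _ _ _ ((fun z => rsubmx (cmap c z) 0 j) @` (rational_leaf x))).
  apply: subset_card_le => _ [y [xy cy] <-].
  have Ny := leaf_N VS WS clN boxes Nx xy.
  have [q [Qq cq qE]] := rationally_near_box cb cy Ny (leaf_rationally_near Nx xy).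
  by exists q; rewrite ?qE.
by apply: sub_countable (rational_leaf_countable Nx); exact: card_image_le.
Qed.

(** The straight segment between the two points stays in the convex box and keeps the transverse
    coordinates fixed, so [box_leaf] places it in the leaf. *)
Lemma plaque_segment x c e y z : N x -> flow_box_at c e -> leaf x y ->
  cdom c y -> cdom c z -> rsubmx (cmap c y) = rsubmx (cmap c z) ->
  exists S, [/\ connected S, S y, S z & S `<=` leaf x `&` cdom c].
Proof.
move=> Nx cb xy cy cz yz.
pose l (s : R) := cmap c y + s *: (cmap c z - cmap c y).
have ye := box_cmap_lt cb cy; have ze := box_cmap_lt cb cz.
have le s : 0 <= s <= 1 -> `|l s| < e.
  move=> /andP[s0 s1].
  have -> : l s = (1 - s) *: cmap c y + s *: cmap c z.
    by apply/matrixP => i j; rewrite !mxE; ring.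
  rewrite (le_lt_trans (ler_normD _ _)) // !normrZ (ger0_norm s0).
  rewrite ger0_norm ?subr_ge0 //.
  have : (1 - s) * `|cmap c y| + s * `|cmap c z| < (1 - s) * e + s * e.
    have [->|s_neq0] := eqVneq s 0; first by rewrite subr0 !mul1r !mul0r !addr0.
    by rewrite ler_ltD ?ler_wpM2l ?subr_ge0 ?(ltW ye) // ltr_pM2l // lt0r s_neq0.
  by rewrite -mulrDl subrK mul1r.
exists ((fun s => cinv c (l s)) @` `[0, 1]%classic); split.
- apply: connected_continuous_connected; first exact: segment_connected.
  apply: continuous_in_subspaceT => s; rewrite inE /= in_itv /= => s01.
  apply: (@continuous_comp _ _ _ l (cinv c)).
    exact: differentiable_continuous (ex_diff (is_diff_def := is_diff_line _ _ _)).
  have [cs sE] := box_mem cb (le s s01).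
  by apply: cinv_cont; exists (cinv c (l s)).
- exists 0; first by rewrite /= in_itv /= lexx ler01.
  by rewrite /l scale0r addr0 cmapK.
- exists 1; first by rewrite /= in_itv /= lexx ler01.
  by rewrite /l scale1r addrC subrK cmapK.
- move=> w [s /=]; rewrite in_itv /= => s01 <-.
  have [cs sE] := box_mem cb (le s s01); split=> //.
  apply: leaf_trans xy _; apply: (box_leaf VS WS cb cy cs).
  by rewrite sE /l linearD linearZ linearB /= yz subrr scaler0 addr0.
Qed.

Lemma component_plaque x c e y : N x -> flow_box_at c e -> leaf x y -> cdom c y ->
  connected_component (leaf x `&` cdom c) y = plaque 2 N c y.
Proof.
move=> Nx cb xy cy; apply/seteqP; split=> [z xz|z [cz Nz /tail_zero_rsubmx yz]].
  have [xz' cz] := connected_component_sub xz.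
  split=> //; first exact: leaf_N VS WS clN boxes _ Nx _ xz'.
  apply/tail_zero_rsubmx; apply/eqP; rewrite linearB subr_eq0; apply/eqP/rowP => j.
  set K := connected_component _ _ in xz.
  pose f z := rsubmx (cmap c z) 0 j.
  apply: (@countable_connected_eq R (f @` K)).
  - apply: sub_countable (leaf_box_countable j Nx cb).
    apply: subset_card_le => _ [w Kw <-]; exists w => //.
    exact: connected_component_sub Kw.
  - apply: connected_continuous_connected; first exact: component_connected.
    apply: continuous_in_subspaceT => w; rewrite inE => /connected_component_sub[_ cw].
    apply: (@continuous_comp _ _ _ (fun w => rsubmx (cmap c w)) (fun v => v 0 j)).
      apply: (@continuous_comp _ _ _ (cmap c) (fun v => rsubmx v)).
        exact: cmap_cont.
      exact: (@Ck_rsubmx R 0 2 (n + 2) setT).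
    exact: coord_continuous.
  - by exists z.
  - by exists y => //; apply: connected_component_refl.
have yz' : rsubmx (cmap c y) = rsubmx (cmap c z).
  by move/eqP: yz; rewrite linearB subr_eq0 => /eqP.
have [S [cS Sy Sz SL]] := plaque_segment Nx cb xy cy cz yz'.
exact: connected_component_max Sy SL cS _ Sz.
Qed.

Lemma leaf_connected x : N x -> connected (leaf x).
Proof.
move=> Nx; suff <- : connected_component (leaf x) x = leaf x.
  exact: component_connected.
apply/seteqP; split; first exact: connected_component_sub.
(* Membership in the leaf is carried along in the induction because [plaque_segment] asks for it. *)
move=> y xy; suff [] : leaf x y /\ connected_component (leaf x) x y by [].
apply: (@leaf_induction R n X V W N VS WS clN boxes
  (fun y => leaf x y /\ connected_component (leaf x) x y) _ x Nx _ y xy).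
  move=> z Nz; have [c [e [cb cz]]] := boxes Nz; exists c, e; split=> //.
  move=> y' z' cy cz' Ny yz [xy' Cy].
  have [S [cS Sy Sz SL]] := plaque_segment Nx cb xy' cy cz' yz.
  split; first by have [] := SL _ Sz.
  apply: connected_component_trans Cy _.
  apply: (connected_component_max Sy _ cS Sz).
  by move=> w /SL[].
split; first exact: leaf_refl.
by apply: connected_component_refl; exact: leaf_refl.
Qed.

End leaf_components.

(** * Trajectories and the foliation *)

Lemma connected_locally_const (T : topologicalType) (U : set T) (P : T -> Prop) :
  open U -> connected U ->
  (forall z, U z -> \forall w \near z, P w <-> P z) ->
  forall z z', U z -> P z -> U z' -> P z'.
Proof.
move=> oU cU Ploc z z' Uz Pz Uz'.
have opn (Q : T -> Prop) : (forall z, U z -> \forall w \near z, Q w <-> Q z) ->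
    open [set w | U w /\ Q w].
  move=> Qloc; rewrite openE => w [Uw Qw]; rewrite /interior.
  have nU : \forall r \near w, U r by exact: open_nbhs_nbhs.
  by apply: filterS2 nU (Qloc _ Uw) => r Ur [_ wr]; split=> //; exact: wr.
have BU : [set w | U w /\ P w] = U.
  apply: cU; first by exists z.
    exists [set w | U w /\ P w]; first exact: opn.
    by apply/seteqP; split=> w [Uw]; [split | case].
  exists (~` [set w | U w /\ ~ P w]).
    apply: open_closedC; apply: opn => w /Ploc; apply: filterS => r [rw wr].
    by split=> nP Pr; apply: nP; [exact: wr|exact: rw].
  apply/seteqP; split=> w [Uw]; first by move=> Pw; split=> // -[_].
  by move=> nn; split=> //; apply: contrapT => nP; exact: nn.
by have [] : [set w | U w /\ P w] z' by rewrite BU.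
Qed.

(** * Maps of a complex variable along the leaves *)

Section ddir.
Context {R : realType} {m : nat} (X : manifold R m) (g : R[i] -> X).
Variable c : chart R m X.
Local Notation G := (fun p : R * R => cmap c (g (p.1 +i* p.2))).

Lemma complex_line (z w : R[i]) (s : R) : z + s%:C * w =
  (complex.Re z + s * complex.Re w) +i* (complex.Im z + s * complex.Im w).
Proof.
case: z w => a b [a' b']; apply/eqP; rewrite eq_complex /=.
by apply/andP; split; apply/eqP; ring.
Qed.

(** [ddir] differentiates along real lines in the complex plane, whereas smoothness is expressed on
    [R * R]; this passes from one to the other. *)
Lemma ddirE z w : differentiable G (complex.Re z, complex.Im z) ->
  ddir g c z w = 'D_(complex.Re w, complex.Im w) G (complex.Re z, complex.Im z).
Proof.
move=> Gd.
have Gd0 : differentiable G ((complex.Re z, complex.Im z) +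
    (0 : R) *: ((complex.Re w, complex.Im w) : R * R)).
  by rewrite scale0r addr0.
have -> : ddir g c z w = 'D_1 (fun s : R => G ((complex.Re z, complex.Im z) +
    s *: ((complex.Re w, complex.Im w) : R * R))) 0.
  have -> : (fun s : R => G ((complex.Re z, complex.Im z) +
      s *: ((complex.Re w, complex.Im w) : R * R))) = (fun s => cmap c (g (z + s%:C * w))).
    by apply/funext => s; rewrite complex_line.
  by [].
by have [_ ->] := is_derive_line Gd0; rewrite scale0r addr0.
Qed.

Lemma is_derive_segment (z v : R[i]) (s : R) :
  let w := z + s%:C * v in
  differentiable G (complex.Re w, complex.Im w) ->
  is_derive s 1 (fun s : R => cmap c (g (z + s%:C * v)))
    (complex.Re v *: ddir g c w 1 + complex.Im v *: ddir g c w 'i).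
Proof.
move=> w Gd; rewrite !ddirE //=.
have wE : (complex.Re w, complex.Im w) = (complex.Re z, complex.Im z) +
    s *: ((complex.Re v, complex.Im v) : R * R).
  by rewrite /w complex_line.
have vE : (complex.Re v, complex.Im v) =
    complex.Re v *: ((1, 0) : R * R) + complex.Im v *: ((0, 1) : R * R).
  by congr pair => /=; rewrite scaler0 ?addr0 ?add0r; exact: (esym (mulr1 _)).
rewrite -!derive_dirZ // -derive_dirD // -vE wE.
have -> : (fun s : R => cmap c (g (z + s%:C * v))) = (fun s : R =>
    G ((complex.Re z, complex.Im z) + s *: ((complex.Re v, complex.Im v) : R * R))).
  by apply/funext => r /=; rewrite complex_line.
by apply: is_derive_line; rewrite -wE.
Qed.

End ddir.

Section maps_along_leaves.
Context {R : realType} {n : nat} (X : manifold R (2 + (n + 2))).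
Variables (V W : vfield X) (N : set X) (U : set R[i]) (g : R[i] -> X).
Hypotheses (VS : smooth_vfield V) (WS : smooth_vfield W).
Hypothesis boxes : forall x, N x -> exists c e, is_flow_box V W N c e /\ cdom c x.
Hypotheses (oU : open (U : set R[i]^o)) (cU : connected (U : set R[i]^o)).
Hypotheses (gS : smooth_map_on U g) (gN : forall z, U z -> N (g z)).
Hypothesis gV : forall z c, U z -> atlas c -> cdom c (g z) ->
  ddir g c z 1 = V c (g z) /\ ddir g c z 'i = W c (g z).

Lemma normC_le2 (s : R) : -2 < s < 2 -> `|s%:C| <= 2 :> R[i].
Proof.
move=> s2; rewrite normc_def /= expr0n addr0 sqrtr_sqr.
  have -> : 2 = (2 : R)%:C :> R[i] by rewrite rmorph_nat.
by rewrite lecR ltW // ltr_norml.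
Qed.

(** Along the segment from [z] to [w] the coordinate expression has constant derivative, a
    combination of the first two coordinate vectors, so the other coordinates do not change. *)
Lemma map_near_plaque z c e : U z -> is_flow_box V W N c e -> cdom c (g z) ->
  \forall w \near (z : R[i]^o),
    cdom c (g w) /\ rsubmx (cmap c (g w)) = rsubmx (cmap c (g z)).
Proof.
move=> Uz cb cz; have [ac _ _ _] := cb.
have nU : \forall w \near (z : R[i]^o), U w by exact: open_nbhs_nbhs.
have nc : \forall w \near (z : R[i]^o), cdom c (g w).
  by apply: (gS.1 z Uz); apply: open_nbhs_nbhs; split=> //; exact: cdom_open.
have nn : \forall w \near (z : R[i]^o), U w /\ cdom c (g w) by apply: filterS2 nU nc.
move/nbhs_normP : nn => [d /= d0 dP]; apply/nbhs_normP.
(* The segment is prolonged to parameters between -2 and 2, making 0 and 1 interior; half the radius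
   keeps the prolonged segment in the ball. *)
exists (d / 2) => [|w /= wd]; first by rewrite /= divr_gt0.
have seg (s : R) : -2 < s < 2 -> U (z + s%:C * (w - z)) /\ cdom c (g (z + s%:C * (w - z))).
  move=> /normC_le2 s2; apply: dP => /=.
  rewrite opprD addrA subrr sub0r normrN normrM -(distrC z).
  rewrite (le_lt_trans (ler_wpM2r _ s2)) //.
  by rewrite -ltr_pdivlMl // mulrC.
have der (s : R) : -2 < s < 2 -> is_derive s 1 (fun s : R => cmap c (g (z + s%:C * (w - z))))
    (complex.Re (w - z) *: line 0 + complex.Im (w - z) *: line 1).
  move=> /seg [Us cs]; have [V1 W1] := gV Us ac cs.
  have := line_fieldV W N VS; have := line_fieldW V N WS.
  move=> [_ /(_ c e _ cb cs) Wl] [_ /(_ c e _ cb cs) Vl].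
  rewrite -Wl -Vl -V1 -W1; apply: is_derive_segment.
  apply: (gS.2 c ac 1).1; rewrite /=.
  by case: (z + s%:C * (w - z)) Us cs.
have I0 : -2 < (0 : R) < 2 by apply/andP; split; lra.
have I1 : -2 < (1 : R) < 2 by apply/andP; split; lra.
have := curve_affine der I0 I1; rewrite mul0r addr0 mul1r addrC subrK => wE.
have [_ cw] := seg 1 I1; rewrite mul1r addrC subrK in cw.
split=> //; rewrite wE linearD linearZ /= linearD !linearZ /= !row_mxKr.
by rewrite !scaler0 addr0 scaler0 addr0.
Qed.

Lemma map_in_leaf z z' : U z -> U z' -> leaf V W (g z) (g z').
Proof.
move=> Uz Uz'.
apply: (@connected_locally_const R[i]^o U (fun w => leaf V W (g z) (g w)) oU cU _
  z z' Uz (leaf_refl V W (g z)) Uz') => w Uw.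
have [c [e [cb cw]]] := boxes (gN Uw).
apply: filterS (map_near_plaque Uw cb cw) => r [cr rw].
split=> zr; apply: leaf_trans zr _; first exact: (box_leaf VS WS cb cr cw rw).
exact: (box_leaf VS WS cb cw cr (esym rw)).
Qed.

End maps_along_leaves.

Lemma toC_pair_inj (R : realType) m (a b v w : 'rV[R]_m) :
  2^-1 *: (toC a - 'i *: toC b) = 2^-1 *: (toC v - 'i *: toC w) -> a = v /\ b = w.
Proof.
have two : (2 : R[i])^-1 != 0 by rewrite invr_eq0 pnatr_eq0.
move=> /(scalerI two) ab.
have E j : a 0 j = v 0 j /\ b 0 j = w 0 j.
  have := congr1 (fun u : 'rV[R[i]]_m => u 0 j) ab; rewrite !mxE => /eqP.
  rewrite eq_complex /= => /andP[/eqP r1 /eqP i1]; split; lra.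
by split; apply/rowP => j; have [] := E j.
Qed.

Lemma toCM (R : realType) m n p (A : 'M[R]_(m, n)) (B : 'M[R]_(n, p)) :
  toC A *m toC B = toC (A *m B).
Proof.
apply/matrixP => i j; rewrite !mxE rmorph_sum; apply: eq_bigr => k _.
by rewrite !mxE rmorphM.
Qed.

Lemma toCD (R : realType) m n (A B : 'M[R]_(m, n)) : toC (A + B) = toC A + toC B.
Proof. by apply/matrixP => i j; rewrite !mxE rmorphD. Qed.

Lemma toCN (R : realType) m n (A : 'M[R]_(m, n)) : toC (- A) = - toC A.
Proof. by apply/matrixP => i j; rewrite !mxE rmorphN. Qed.

Lemma complex_row (R : realType) m (z : 'rV[R[i]]_m) :
  z = toC (map_mx (@complex.Re R) z) - 'i *: toC (- map_mx (@complex.Im R) z).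
Proof.
apply/rowP => j; rewrite !mxE; case: (z 0 j) => a b; apply/eqP.
rewrite eq_complex /=; apply/andP; split; apply/eqP; ring.
Qed.

Lemma phhs_cvf (R : realType) m (X : manifold R m) (J om : mxfield X)
    (HR HI : X -> R) (V : vfield X) (Z : cvfield X) c x :
  phhs J om HR -> hamiltonian_vf om HR V -> hamiltonian_cvf J om HR HI Z ->
  atlas c -> cdom c x ->
  Z c x = 2^-1 *: (toC (V c x) - 'i *: toC (Jvf J V c x)).
Proof.
move=> hX hV hZ ac cx; have [[_ _ /(_ c x ac cx) ZJ] /(_ c x ac cx) ZO] := hZ.
have [_ /(_ c x ac cx)[_ omu] _] := phhs_symplectic hX.
have JJ := (phhs_almost_complex hX).2 c x ac cx.
move: (complex_row (Z c x)) ZJ ZO; set a := map_mx _ _; set b := - map_mx _ _.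
move=> ZE; rewrite {1 2}ZE => ZJ ZO.
have ii (A : 'rV[R[i]]_m) : 'i *: ('i *: A) = - A.
  by rewrite scalerA -expr2 sqr_i scaleN1r.
have [aJ bJ] : a *m J c x = b /\ b *m J c x = - a.
  apply: toC_pair_inj; congr (_ *: _); move: ZJ.
  rewrite mulmxBl -scalemxAl !toCM => ->.
  by rewrite scalerBr ii opprK addrC toCN scalerN opprK.
(* The real part of [(a - i b) (om - i J om)] is [a om - b J om]; since [b J = - a], this is twice
   [a om]. *)
have aV : a + a = V c x.
  apply/eqP; rewrite -subr_eq0; apply/eqP/(bil_nondegenerate omu) => w.
  apply/eqP; rewrite bilBl subr_eq0; apply/eqP; rewrite (phhs_dHR hV w ac cx).
  rewrite bilDl; have := ZO w; rewrite ZE /OmegaC.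
  have -> : (toC w)^T = toC w^T by apply/matrixP => i j; rewrite !mxE.
  rewrite mulmxBl !mulmxBr -!scalemxAl -!scalemxAr !toCM ii.
  rewrite !mulmxA bJ !mulmxBl !mulNmx -!scalemxAl !toCM !mulNmx !toCN !mxE => /(congr1 (@complex.Re R)).
  rewrite /dhamC /bil !mxE /=; move: (\sum_j _) (\sum_j _) (\sum_j _) => r s t.
  by rewrite !(mul0r, mul1r, mulr0, subr0, oppr0, addr0, add0r, opprK) => ->.
have half (z : 'rV[R[i]]_m) : z = 2^-1 *: (z + z).
  have two : 2%:R != 0 :> R[i] by rewrite pnatr_eq0.
  by apply: (scalerI two); rewrite scalerA mulfV // scale1r scaler_nat mulr2n.
rewrite {1}ZE [LHS]half -aV /Jvf -aV mulmxDl aJ !toCD; congr (_ *: _).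
by rewrite addrACA -opprD -scalerDr.
Qed.

Lemma smooth_fun_continuous (R : realType) m (X : manifold R m) (f : X -> R) :
  smooth_fun f -> continuous f.
Proof.
move=> fS x; have [c ac cx] := atlas_cover x.
have fc : {for x, continuous ((fun p => f (cinv c p)) \o cmap c)}.
  apply: continuous_comp; first exact: cmap_cont.
  by apply: (fS c ac 0); exists x.
have nd : \forall y \near x, cdom c y.
  by apply: open_nbhs_nbhs; split=> //; exact: cdom_open.
have nE : \forall y \near x, ((fun p => f (cinv c p)) \o cmap c) y = f y.
  by apply: filterS nd => y cy /=; rewrite cmapK.
have fx := nbhs_singleton nE.
rewrite /continuous_at -fx; apply: cvg_trans fc.
exact: near_eq_cvg.
Qed.

Lemma energy_level_closed (R : realType) m (X : manifold R m) (HR HI : X -> R) E :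
  smooth_fun HR -> smooth_fun HI -> closed (energy_level HR HI E).
Proof.
move=> /smooth_fun_continuous RC /smooth_fun_continuous IC.
have -> : energy_level HR HI E =
    HR @^-1` [set complex.Re E] `&` HI @^-1` [set complex.Im E].
  apply/seteqP; split=> x; rewrite /energy_level /hamC /=; first by move=> <-.
  by move=> [-> ->]; case: E.
have cl (r : R) : closed [set r].
  exact: accessible_closed_set1 (hausdorff_accessible (@Rhausdorff R)) r.
by apply: closedI; [move: RC|move: IC] => /continuous_closedP; exact.
Qed.

(** * The foliation of a regular level *)

Section foliation.
Context {R : realType} {n : nat} (X : manifold R (2 + (n + 2))).
Variables (J om : mxfield X) (HR HI : X -> R) (V : vfield X) (E : R[i]).
Hypotheses (hX : phhs J om HR) (hV : hamiltonian_vf om HR V).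
Hypotheses (hHI : is_primitive (interior_prod om (Jvf J V)) HI).
Hypothesis hE : regular_value HR HI E.
Local Notation W := (Jvf J V).
Local Notation N := (energy_level HR HI E).

Lemma energy_flow_box x : N x -> exists c e, [/\ is_flow_box V W N c e, cdom c x &
  forall y, cdom c y -> rsubmx (rsubmx (cmap c y)) = energy HR HI E y].
Proof.
move=> Nx; have [c [e [ac cx e0 img cP]]] := flow_box_chart hX hV hHI hE Nx.
exists c, e; split=> // [|y /cP[]//]; split=> // y cy; have [Vy Wy yE] := cP y cy.
by split; rewrite // yE; exact: energy_levelP.
Qed.

(** In the box [H - E] is the last pair of coordinates, a linear function, hence equal to its own
    differential. *)
Lemma flow_box_dfun c e y u : is_flow_box V W N c e ->
  (forall y, cdom c y -> rsubmx (rsubmx (cmap c y)) = energy HR HI E y) -> cdom c y ->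
  rsubmx (rsubmx u) = \row_j (if j == 0 then dfun HR c y u else dfun HI c y u).
Proof.
move=> [ac _ _ _] cE cy; rewrite -(derive_energy E hX hHI ac u cy).
pose L : {linear 'rV[R]_(2 + (n + 2)) -> 'rV[R]_2} := rsubmx \o rsubmx.
have Lc : continuous L by exact: linear_rV_continuous.
have nE : \forall p \near cmap c y, L p = energy HR HI E (cinv c p).
  have nc : \forall p \near cmap c y, (cmap c @` cdom c) p.
    by apply: open_nbhs_nbhs; split; [exact: img_open|exists y].
  by apply: filterS nc => p /cinv_dom[cp pE]; rewrite -cE // pE.
rewrite -(near_eq_derive _ nE) deriveE ?diff_lin //.
exact: linear_differentiable.
Qed.

(** The first tangent space is the kernel of [dH], invariant by the Cauchy-Riemann equations; the
    second is the plane of [V] and [W], which [J] rotates. *)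
Lemma flow_box_tail_invariant c e y : is_flow_box V W N c e ->
  (forall y, cdom c y -> rsubmx (rsubmx (cmap c y)) = energy HR HI E y) -> cdom c y ->
  tail_invariant (2 + n) (J c y) /\ tail_invariant 2 (J c y).
Proof.
move=> cb cE cy; have [ac _ _ /(_ y cy)[Vy Wy _]] := cb.
split=> v; last first.
  rewrite !tail_zero_rsubmx => v0.
  have -> : v = lsubmx v 0 0 *: V c y + lsubmx v 0 1 *: W c y.
    have := @rsubmx_eq_line R n 0 v; rewrite linear0 v0 => /(_ erefl).
    by rewrite add0r !linear0 !mxE !subr0 Vy Wy.
  rewrite (J_invariant_plane V hX) // Vy Wy linearD !linearZ /= !row_mxKr.
  by rewrite !scaler0 addr0.
rewrite !tail_zero_rsubmx2 !(flow_box_dfun _ cb cE cy) => /rowP v0.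
have := v0 0; have := v0 1; rewrite !mxE /= => vI vR.
apply/rowP => j; rewrite !mxE (phhs_dHR_J hX hV hHI) // (phhs_dHI_J hX hV hHI) //.
by rewrite vI vR oppr0; case: ifP.
Qed.

Definition leaves : set (set X) := [set L | exists2 x, N x & L = leaf V W x].

Let VS : smooth_vfield V := hV.1.
Let WS : smooth_vfield W := Jvf_smooth hX hV.
Let clN : closed N := energy_level_closed (phhs_smooth hX) hHI.1.
Let boxes x : N x -> exists c e, is_flow_box V W N c e /\ cdom c x.
Proof. by move=> /energy_flow_box[c [e [cb cx _]]]; exists c, e. Qed.

Lemma leaves_foliation : pseudo_holomorphic_foliation J N leaves.
Proof.
split.
- move=> _ [x Nx ->]; split; first by exists x; exact: leaf_refl.
    exact: (leaf_N VS WS clN boxes Nx).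
  exact: (leaf_connected VS WS clN boxes Nx).
- move=> _ _ [x Nx ->] [y Ny ->] [z [xz yz]].
  by rewrite (leaf_eq VS WS clN boxes Nx xz) (leaf_eq VS WS clN boxes Ny yz).
- by move=> x Nx; exists (leaf V W x); [exists x|exact: leaf_refl].
- exists (2 + n)%N, 2; split; first by rewrite leq_addr leq_add2l leq_addr.
  move=> x /energy_flow_box[c [e [cb cx cE]]]; have [ac _ _ cP] := cb.
  exists c; split=> //; last by move=> y _ cy; exact: flow_box_tail_invariant cb cE cy.
  split.
    split=> // y cy; have [_ _ Ny] := cP y cy.
    by rewrite Ny; split=> /tail_zero_rsubmx2.
  move=> _ y [x0 Nx0 ->] xy cy.
  exact: (component_plaque VS WS clN boxes Nx0 cb xy cy).
Qed.

Lemma trajectory_in_leaf Z U g : hamiltonian_cvf J om HR HI Z ->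
  trajectory J Z U g -> (forall z, U z -> N (g z)) ->
  exists2 L, leaves L & forall z, U z -> L (g z).
Proof.
move=> hZ [[[z0 Uz0] oU cU] [gS _] gZ] gN.
exists (leaf V W (g z0)); first by exists (g z0) => //; exact: gN.
move=> z Uz; apply: (map_in_leaf VS WS boxes oU cU gS gN _ Uz0 Uz).
move=> w c Uw ac cw; have := gZ w c Uw ac cw.
by rewrite (phhs_cvf hX hV hZ ac cw); exact: toC_pair_inj.
Qed.

End foliation.

(** Two independent fields in the kernel of a differential of rank two force [2 + 2 <= m]. *)
Lemma regular_dimension (R : realType) m (X : manifold R m) (J om : mxfield X)
    (HR HI : X -> R) (V : vfield X) (E : R[i]) x :
  phhs J om HR -> hamiltonian_vf om HR V ->
  is_primitive (interior_prod om (Jvf J V)) HI -> regular_value HR HI E ->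
  energy_level HR HI E x -> exists n, m = (2 + (n + 2))%N.
Proof.
move=> hX hV hHI hE Nx; have [c ac cx] := atlas_cover x.
have reg := hE x Nx c ac cx.
have dE : differentiable (fun p => energy HR HI E (cinv c p)) (cmap c x).
  by apply: (energy_smooth E hX hHI ac 1).1; exists x.
pose M := jacobian (fun p => energy HR HI E (cinv c p)) (cmap c x).
have ME u : u *m M = \row_j (if j == 0 then dfun HR c x u else dfun HI c x u).
  by rewrite -deriveEjacobian // (derive_energy E hX hHI ac).
have Ur := phhs_row_free hX hV hHI ac cx reg.
have Mr := phhs_row_full hX hV hHI ac cx reg ME.
have UM : col_mx (V c x) (Jvf J V c x) *m M = 0.
  rewrite mul_col_mx !ME; have [-> -> -> ->] := phhs_invariant hX hV hHI ac cx.
  by apply/matrixP => i j; rewrite !mxE; case: fintype.split => k; rewrite mxE; case: ifP.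
have := mulmx0_rank_max UM; rewrite (eqP Ur) (eqP Mr) => m4.
by exists (m - 4)%N; rewrite addnCA subnK.
Qed.

Theorem proposition15 (R : realType) (m : nat) (X : manifold R m)
    (J om : mxfield X) (HR HI : X -> R) (V : vfield X) (Z : cvfield X)
    (E : R[i])
    (hX : phhs J om HR)
    (hV : hamiltonian_vf om HR V)
    (hHI : is_primitive (interior_prod om (Jvf J V)) HI)
    (hZ : hamiltonian_cvf J om HR HI Z)
    (hE : regular_value HR HI E) :
  (forall c x, atlas c -> cdom c x ->
     Z c x = 2^-1 *: (toC (V c x) - 'i *: toC (Jvf J V c x))) /\
  exists F : set (set X),
    [/\ pseudo_holomorphic_foliation J (energy_level HR HI E) F,
        forall x0, energy_level HR HI E x0 ->
          F (flow_leaf J V x0) /\ flow_leaf J V x0 x0 &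
        forall (U : set R[i]) (g : R[i] -> X), trajectory J Z U g ->
          (forall z, U z -> hamC HR HI (g z) = E) ->
          exists2 L, F L & forall z, U z -> L (g z)].
Proof.
split=> [c x|]; first exact: phhs_cvf hX hV hZ.
(* An empty level gives no lower bound on [m]; it carries the empty family of leaves, with
   [d = p = 0]. *)
have [[x Nx]|N0] := pselect (exists x, energy_level HR HI E x); last first.
  exists set0; split.
  - split=> //; first by move=> x Nx; case: N0; exists x.
    by exists 0%N, 0%N; split=> // x Nx; case: N0; exists x.
  - by move=> x Nx; case: N0; exists x.
  - by move=> U g [[[z Uz] _ _] _ _] gE; case: N0; exists (g z); exact: gE.
have [n mE] := regular_dimension hX hV hHI hE Nx; subst m.
exists (leaves J HR HI V E); split.
- exact: leaves_foliation hX hV hHI hE.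
- by move=> y Ny; split; [exists y|exact: leaf_refl].
- by move=> U g; exact: trajectory_in_leaf hX hV hHI hE _ _ _ hZ.
Qed.
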